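(* Let $\Omega$ be a star graph with outer paths $\Omega_1,\ldots,\Omega_N$ $(N\ge2)$ of equal thickness, and assume that $$F(1)+\big((N-1)^2-1\big)F(a)>0.$$ Let $\Omega'$ be a graph obtained by replacing the center point $\mathrm P$ of $\Omega$ by a bounded finite graph $D$, and let $\mathcal P'(i,j)$ be the propagation index for $\Omega'$. Then $\mathcal P'(i,j)=1$ for any $i\ne j$ if the total length of the edges of $D$ is sufficiently small.
   Context: Metric graphs: a metric graph is a connected graph each of whose edges $E$ is identified with an interval $[0,L_E]$ (finite length $L_E>0$) or $[0,\infty)$ (infinite length); directions of edges only serve to fix coordinates. Multiple edges, loops and vertices of degree $1$ are allowed. Each edge $E$ has a constant thickness $\rho_E>0$. At a vertex $V$ with incident edges $E_1,\ldots,E_m$ (a loop is counted twice), $\frac{\partial u}{\partial\nu_k}(V)$ denotes the derivative of $u$ at $V$ along $E_k$ in the direction pointing from $V$ into the interior of $E_k$; the Kirchhoff condition at $V$ is $\sum_{k=1}^m\rho_{E_k}\frac{\partial u}{\partial\nu_k}(V)=0$. Star graph: $N$ half lines $\Omega_1,\dots,\Omega_N$ (outer paths), with coordinates $x_i\in[0,\infty)$, whose endpoints $x_i=0$ are identified with a single vertex $\mathrm P$. Replacing $\mathrm P$ by a bounded finite metric graph $D$ (finitely many edges of finite length) gives $\Omega'=D\cup\Omega_1'\cup\cdots\cup\Omega_N'$, where $\Omega_i'$ is a half line with coordinate $x_i\in[0,\infty)$ and the same thickness as $\Omega_i$, with $D\cap\Omega_i'=\{\mathrm P_i\}$, where $\mathrm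 P_i$ (corresponding to $x_i=0$) is a vertex of $D$; the $\mathrm P_i$ are not necessarily distinct. Nonlinearity: $f\in C^1$ and for some $0<a<1$: $f(0)=f(a)=f(1)=0$, $f<0$ on $(0,a)$, $f>0$ on $(a,1)$, $f'(0)<0$, $f'(a)>0$, $f'(1)<0$, $\int_0^1f(s)\,ds>0$. $F(s)=\int_0^sf(r)\,dr$. Solution of $\partial_tu=\Delta_{\Omega'}u+f(u)$ on a time interval: a function $u(t,x)$ continuous in $(t,x)$ that satisfies $\partial_tu=\partial_x^2u+f(u)$ on each edge except at endpoints, with $\partial_xu$ continuous on each edge up to the endpoints, and the Kirchhoff condition at every vertex. Traveling wave: $(\phi,c)$, $c>0$, is the unique pair with $\phi''+c\phi'+f(\phi)=0$ and $0<\phi<1$ on $\mathbb R$, $\phi(-\infty)=1$, $\phi(+\infty)=0$, $\phi(0)=a$. Front-like solution and limit profile on $\Omega'$: for each $i$ there is a unique entire solution $\widehat u_i$ (defined for all $t\in\mathbb R$) with $0<\widehat u_i<1$ and $\lim_{t\to-\infty}\big(\sup_{x_i\in\Omega_i'}|\widehat u_i|_{\Omega_i'}(t,x_i)-\phi(-x_i-ct)|+\sup_{\Omega'\setminus\Omega_i'}|\widehat u_i(t,\cdot)|\big)=0$; it is strictly increasing in $t$. The limit profile is $\widehat v_i(x)=\lim_{t\to\infty}\widehat u_i(t,x)$. Propagation index: for $i\ne j$, $\lim_{x_j\to\infty}\widehat v_i|_{\Omega_j'}(x_j)$ exists and equals $1$ or $0$; $\mathcal P'(i,j)$ is this value ($1$: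 propagation; $0$: blocking).
   Formalization: ''Sufficiently small'' is taken with a threshold depending on fixed positive lower and upper bounds for the thicknesses of the edges of D; uniformly over all thicknesses the claim fails (a very thick, very short pendant edge blocks). *)

(* Defs.v *)
From HB Require Import structures.
From mathcomp Require Import all_boot all_order all_algebra.
From mathcomp Require Import all_classical all_reals all_analysis.

Set Implicit Arguments.
Unset Strict Implicit.
Unset Printing Implicit Defensive.

Import Order.TTheory GRing.Theory Num.Theory.
Import numFieldNormedType.Exports.

Local Open Scope classical_set_scope.
Local Open Scope ring_scope.

(* A finite metric graph.  An edge e is identified with [0, len e], from esrc e
   (coordinate 0) to edst e; loops and multiple edges are allowed.  A ray is an
   edge of infinite length, identified with [0, +oo) and starting at rsrc. *)
Record metric_graph (R : realType) := MetricGraph {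
  vertex : finType;
  edge : finType;
  ray : finType;
  esrc : edge -> vertex;
  edst : edge -> vertex;
  rsrc : ray -> vertex;
  len : edge -> {posnum R};
  ethick : edge -> {posnum R};
  rthick : ray -> {posnum R};
  graph_connected : forall v w : vertex,
    connect (fun v1 v2 => [exists e : edge,
      (esrc e == v1) && (edst e == v2) || (esrc e == v2) && (edst e == v1)]) v w
}.

Section metric_graphs.
Context {R : realType}.
Implicit Type G : metric_graph R.

Definition bounded_graph G := #|ray G| = 0%N.

Definition total_length G : R := \sum_(e : edge G) (len e)%:num.

Lemma star_connected (v w : unit) :
  connect (fun v1 v2 : unit => [exists e : void,
    (of_void unit e == v1) && (of_void unit e == v2) ||
    (of_void unit e == v2) && (of_void unit e == v1)]) v w.
Proof. by case: v; case: w; exact: connect0. Qed.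

Definition star_graph (N : nat) (rho : 'I_N -> {posnum R}) : metric_graph R :=
  @MetricGraph R unit void 'I_N (of_void unit) (of_void unit) (fun=> tt)
    (of_void _) (of_void _) rho star_connected.

(* The graph obtained from a star graph Om by replacing its center by the
   bounded graph D; the i-th ray now starts at the vertex P i of D.  (Rays of D
   would be dropped: this is meant for D with bounded_graph D.) *)
Definition replace_center (Om D : metric_graph R) (P : ray Om -> vertex D) :
    metric_graph R :=
  @MetricGraph R (vertex D) (edge D) (ray Om) (@esrc R D) (@edst R D) P
    (@len R D) (@ethick R D) (@rthick R Om) (@graph_connected R D).

(* A function on G is represented by a family w : bond G -> R -> R, where w b x
   is the value at the point of coordinate x of the edge or ray b; values for x
   outside bond_set b are irrelevant. *)
Definition bond G : Type := (edge G + ray G)%type.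

Definition bond_set G (b : bond G) : set R :=
  match b with
  | inl e => `[0, (len e)%:num]
  | inr _ => `[0, +oo[
  end.

Definition bond_interior G (b : bond G) : set R :=
  match b with
  | inl e => `]0, (len e)%:num[
  | inr _ => `]0, +oo[
  end.

Definition at_vertex G (v : vertex G) (b : bond G) (x : R) : Prop :=
  match b with
  | inl e => (x = 0 /\ esrc e = v) \/ (x = (len e)%:num /\ edst e = v)
  | inr r => x = 0 /\ rsrc r = v
  end.

(* w takes the same value at all coordinates representing the same vertex. *)
Definition single_valued G (w : bond G -> R -> R) : Prop :=
  forall v b x b' x', at_vertex v b x -> at_vertex v b' x' -> w b x = w b' x'.

(* Given the continuity of the function on the closed bond, these conditions
   mean that the (one-sided at the endpoints) derivative exists and is
   continuous on the closed bond. *)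
Definition C1_up_to_ends G (b : bond G) (g : R -> R) : Prop :=
  [/\ forall x, bond_interior b x -> derivable g x 1,
      forall x, bond_interior b x -> {for x, continuous (derive1 g)},
      cvg (derive1 g x @[x --> 0^'+])
    & match b with
      | inl e => cvg (derive1 g x @[x --> (len e)%:num^'-])
      | inr _ => True
      end].

(* Derivatives at the endpoints of a bond, pointing into its interior. *)
Definition dnu_src (g : R -> R) : R := lim ((g h - g 0) / h @[h --> 0^'+]).
Definition dnu_dst (L : R) (g : R -> R) : R :=
  lim ((g (L - h) - g L) / h @[h --> 0^'+]).

Definition kirchhoff G (v : vertex G) (w : bond G -> R -> R) : Prop :=
  \sum_(e : edge G | esrc e == v) (ethick e)%:num * dnu_src (w (inl e))
  + \sum_(e : edge G | edst e == v)
      (ethick e)%:num * dnu_dst (len e)%:num (w (inl e))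
  + \sum_(r : ray G | rsrc r == v) (rthick r)%:num * dnu_src (w (inr r)) = 0.

Definition entire_solution (f : R -> R) G (u : R -> bond G -> R -> R) : Prop :=
  [/\ forall t, single_valued (u t),
      forall b, {within [set z : R * R | bond_set b z.2],
                  continuous (fun z : R * R => u z.1 b z.2)},
      forall t b x, bond_interior b x ->
        [/\ derivable (fun s => u s b x) t 1,
            derivable (u t b) x 1,
            derivable (derive1 (u t b)) x 1
          & derive1 (fun s => u s b x) t
            = derive1 (derive1 (u t b)) x + f (u t b x)],
      forall t b, C1_up_to_ends b (u t b)
    & forall t v, kirchhoff v (u t)].

Definition off_ray G (i : ray G) : set (bond G * R) :=
  [set q | [/\ bond_set q.1 q.2, q.1 <> inr i & ~ at_vertex (rsrc i) q.1 q.2]].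

Definition front_like_solution (f phi : R -> R) (c : R) G (i : ray G)
    (u : R -> bond G -> R -> R) : Prop :=
  [/\ entire_solution f u,
      forall t b x, bond_set b x -> 0 < u t b x < 1
    & sup [set `|u t (inr i) x - phi (- x - c * t)|
            | x in bond_set (inr i : bond G)]
      + sup [set `|u t q.1 q.2| | q in off_ray i] @[t --> -oo%R] --> (0 : R)].

Definition limit_profile G (u : R -> bond G -> R -> R) (v : bond G -> R -> R) :
    Prop :=
  forall b x, bond_set b x -> u t b x @[t --> +oo%R] --> v b x.

(* P'(i, j) = k, where u is the front-like solution coming from the ray i. *)
Definition propagation_index G (u : R -> bond G -> R -> R) (j : ray G) (k : R) :
    Prop :=
  exists v, limit_profile u v /\ v (inr j) x @[x --> +oo%R] --> k.

(* Meaningful for s >= 0. *)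
Definition potential (f : R -> R) (s : R) : R :=
  (\int[lebesgue_measure]_(r in `[0, s]) f r)%R.

Definition bistable (f : R -> R) (a : R) : Prop :=
  [/\ 0 < a < 1,
      (forall s, derivable f s 1) /\ continuous (derive1 f),
      [/\ f 0 = 0, f a = 0 & f 1 = 0],
      (forall s, 0 < s < a -> f s < 0) /\ (forall s, a < s < 1 -> 0 < f s)
    & [/\ derive1 f 0 < 0, 0 < derive1 f a, derive1 f 1 < 0 & 0 < potential f 1]].

Definition traveling_wave (f : R -> R) (a : R) (phi : R -> R) (c : R) : Prop :=
  [/\ 0 < c,
      forall z, [/\ derivable phi z 1, derivable (derive1 phi) z 1
                  & derive1 (derive1 phi) z + c * derive1 phi z + f (phi z) = 0],
      forall z, 0 < phi z < 1,
      (phi z @[z --> -oo%R] --> (1 : R)) /\ (phi z @[z --> +oo%R] --> (0 : R))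
    & phi 0 = a].

End metric_graphs.

(* Main.v *)
From HB Require Import structures.
Require Import Defs.
From mathcomp Require Import all_boot all_order all_algebra.
From mathcomp Require Import all_classical all_reals all_analysis.
From mathcomp Require Import ring lra.

(** The solution [u] in fact converges to 1 everywhere, which gives the limit
    profile and the propagation index at once.  Let [v = low u] be the lower
    relaxed limit of [u] as time tends to infinity.  Comparison with barriers,
    carried out by looking at first contact points, shows that [v] is a
    supersolution of the stationary problem in the viscosity sense, inside the
    bonds ([low_super_at]) and, for the Kirchhoff condition, at the vertices
    ([low_vertex]).  It remains to see that [v = 1].

    On the ray [i] where the front comes from, [v] tends to 1 at infinity, because
    the front lowered by a small constant is a stationary subsolution lying below
    [u] from a very negative time on ([front_like_invades]).  Let [F] be the
    primitive of [f] vanishing at 0.  Energy considerations bound the slope with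
    which [v] leaves the origin of a ray at a height [A]: from below by that of
    the stationary solution joining [A] to 1, namely sqrt (2 (F 1 - F A)), on the
    ray [i] ([ray_slope_ge_invaded]), and by - sqrt (- 2 F A), or almost 0 if
    F A > 0, on the other rays ([ray_slope_ge]), since [v] is nonnegative.  As the
    rays have the same thickness, the total flux of [v] on the rays at their
    origins is, if these have about the same height [A], essentially at least a
    positive multiple of sqrt (F 1 - F A) - (N - 1) sqrt (- F A); the hypothesis
    on the potential says that this is positive where [F] is minimal, hence at
    all heights below 1.

    Let [beta] be the minimum of [v] on [D], and suppose that [beta < 1].  The flux
    surplus is turned into a barrier on [D] by solving a resistor network problem:
    there is a function on [D], with large constant second derivative on the
    edges, whose fluxes at the vertices strictly exceed what the rays require
    ([core_potential]).  By Ohm's law its oscillation is at most total current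
    times total resistance ([potential_oscillation]), which is small with the
    total length, uniformly in the shape of [D], since thicknesses are bounded
    below.  Raising this function until it touches [v] contradicts the
    supersolution property at the contact point, whose height is close to [beta]
    ([core_flux_contradiction]).  When [F beta > 0] the surplus is not uniform as
    [beta] tends to 1, but then arbitrarily small slopes can be used
    ([core_height_high]).  So [v = 1] on [D], and a front sliding in from the
    origin of each ray gives [v = 1] there ([ray_saturated]). *)

Set Implicit Arguments.
Unset Strict Implicit.
Unset Printing Implicit Defensive.

Import Order.TTheory GRing.Theory Num.Theory.
Import numFieldNormedType.Exports.

Local Open Scope classical_set_scope.
Local Open Scope ring_scope.

(** * One-variable calculus near a point *)

Section calculus.
Context {R : realType}.
Implicit Types (g : R -> R) (a b k s A B x y z l r d m C e : R).

Lemma is_derive_add g1 g2 x a b : is_derive x 1 g1 a -> is_derive x 1 g2 b ->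
  is_derive x 1 (fun y => g1 y + g2 y) (a + b).
Proof. exact: is_deriveD. Qed.

Lemma is_derive_opp g x a : is_derive x 1 g a ->
  is_derive x 1 (fun y => - g y) (- a).
Proof. exact: is_deriveN. Qed.

Lemma is_derive_sub g1 g2 x a b : is_derive x 1 g1 a -> is_derive x 1 g2 b ->
  is_derive x 1 (fun y => g1 y - g2 y) (a - b).
Proof. exact: is_deriveB. Qed.

Lemma is_derive_mulC g x a k : is_derive x 1 g a ->
  is_derive x 1 (fun y => k * g y) (k * a).
Proof. exact: is_deriveZ. Qed.

Lemma is_derive_const x k : is_derive x 1 (fun _ : R => k) 0.
Proof. exact: is_derive_cst. Qed.

Lemma is_derive_mul g1 g2 x a b : is_derive x 1 g1 a -> is_derive x 1 g2 b ->
  is_derive x 1 (fun y => g1 y * g2 y) (g1 x * b + g2 x * a).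
Proof. exact: is_deriveM. Qed.

Lemma is_derive_affine k s x : is_derive x 1 (fun y => k * y + s) k.
Proof.
have := is_derive_add (is_derive_mulC k (is_derive_id x 1)) (is_derive_const x s).
by rewrite mulr1 addr0.
Qed.

Lemma is_derive_comp_affine g k s x a : is_derive (k * x + s) 1 g a ->
  is_derive x 1 (fun y => g (k * y + s)) (a * k).
Proof.
by move=> ga; have := @is_derive1_comp _ g (fun y => k * y + s) x a k ga
  (is_derive_affine k s x).
Qed.

Lemma is_derive_comp_shift g s x a : is_derive (s + x) 1 g a ->
  is_derive x 1 (fun y => g (s + y)) a.
Proof.
move=> ga; have := @is_derive_comp_affine g 1 s x a; rewrite mul1r addrC mulr1.
move=> /(_ ga).
by congr (is_derive _ _ _ _); apply/funext => y; rewrite mul1r addrC.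
Qed.

Lemma is_derive_quad A B C x :
  is_derive x 1 (fun y => A + B * y + C * y ^+ 2 / 2) (B + C * x).
Proof.
have -> : (fun y => A + B * y + C * y ^+ 2 / 2) =
    (fun y => A + B * y + (C / 2) * (y * y)) by apply/funext => y; field.
have dx := is_derive_id x 1.
have := is_derive_add (is_derive_add (is_derive_const x A) (is_derive_mulC B dx))
  (is_derive_mulC (C / 2) (is_derive_mul dx dx)).
by move/is_derive_eq; apply; rewrite /=; field.
Qed.

Lemma near_shift0 (P : R -> Prop) x :
  (\forall z \near x, P z) <-> (\forall y \near 0, P (x + y)).
Proof.
rewrite (near_shift 0 x); split; apply: filterS => y /=;
  by rewrite subr0 addrC.
Qed.

Lemma near_le_ball (P : R -> Prop) x : (\forall z \near x, P z) ->
  exists2 r, 0 < r & forall z, `|z - x| <= r -> P z.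
Proof.
move=> /nbhs_ballP[r /= r0 rP]; exists (r / 2); first by rewrite divr_gt0.
move=> z zx; apply: rP; rewrite /ball /= distrC (le_lt_trans zx)//.
by rewrite ltr_pdivrMr//; lra.
Qed.

Lemma ball_le_near (P : R -> Prop) x r : 0 < r ->
  (forall z, `|z - x| <= r -> P z) -> \forall z \near x, P z.
Proof.
move=> r0 rP; apply/nbhs_ballP; exists r => // z; rewrite /ball /= distrC => /ltW.
exact: rP.
Qed.

Lemma near0_in_interval l r z : l < z < r -> \forall y \near 0, l <= z + y <= r.
Proof.
move=> /andP[lz zr]; apply/(near_shift0 (fun x => l <= x <= r)).
by apply: filterS2 (lt_nbhsr lz) (lt_nbhsl zr) => x /ltW -> /ltW ->.
Qed.

Lemma near_right0 (P : R -> Prop) : (\forall y \near 0^'+, P y) ->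
  exists2 r, 0 < r & forall y, 0 < y <= r -> P y.
Proof.
rewrite near_withinE => /near_le_ball[r r0 rP]; exists r => // y /andP[y0 yr].
by apply: rP => //; rewrite subr0 gtr0_norm.
Qed.

Lemma right0_near (P : R -> Prop) r : 0 < r ->
  (forall y, 0 < y <= r -> P y) -> \forall y \near 0^'+, P y.
Proof.
move=> r0 rP; rewrite near_withinE; apply: (@ball_le_near _ 0 r) => // y yr y0.
by apply: rP; rewrite y0/=; move: yr; rewrite subr0 gtr0_norm.
Qed.

Lemma is_derive_near g x d e : is_derive x 1 g d -> 0 < e ->
  \forall y \near 0, `|g (x + y) - g x - d * y| <= e * `|y|.
Proof.
move=> [dg gd] e0.
have : (fun h : R => h^-1 *: (g (h *: (1:R) + x) - g x)) @ 0^' --> d.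
  by rewrite -gd; exact: dg.
move=> /cvgrPdist_le /(_ e e0); rewrite near_withinE; apply: filterS => y H.
have [->|y0] := eqVneq y 0; first by rewrite addr0 mulr0 subrr subr0 normr0 mulr0.
have /= := H y0; rewrite /GRing.scale/= mulr1 (addrC y) => H1.
have -> : g (x + y) - g x - d * y = - (d - y^-1 * (g (x + y) - g x)) * y.
  by field.
by rewrite normrM normrN ler_wpM2r.
Qed.

Lemma is_derive_near_le g x d d' : is_derive x 1 g d -> d < d' ->
  \forall y \near 0, (0 <= y -> g (x + y) <= g x + d' * y) /\
                     (y <= 0 -> g x + d' * y <= g (x + y)).
Proof.
move=> dg dd'; have e0 : 0 < d' - d by rewrite subr_gt0.
apply: filterS (is_derive_near dg e0) => y; rewrite ler_norml => /andP[H1 H2].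
by split=> y0; [move: H1 H2; rewrite ger0_norm//|move: H1 H2; rewrite ler0_norm//]; lra.
Qed.

Lemma is_derive_near_ge g x d d' : is_derive x 1 g d -> d' < d ->
  \forall y \near 0, (0 <= y -> g x + d' * y <= g (x + y)) /\
                     (y <= 0 -> g (x + y) <= g x + d' * y).
Proof.
move=> dg dd'; have e0 : 0 < d - d' by rewrite subr_gt0.
apply: filterS (is_derive_near dg e0) => y; rewrite ler_norml => /andP[H1 H2].
by split=> y0; [move: H1 H2; rewrite ger0_norm//|move: H1 H2; rewrite ler0_norm//]; lra.
Qed.

Lemma is_derive_continuous g x d : is_derive x 1 g d -> {for x, continuous g}.
Proof. by move=> dg; apply: differentiable_continuous; apply/derivable1_diffP. Qed.

Lemma MVT_le g (dg : R -> R) x y m : x <= y ->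
  (forall z, x <= z <= y -> is_derive z 1 g (dg z)) ->
  (forall z, x <= z <= y -> m <= dg z) -> m * (y - x) <= g y - g x.
Proof.
move=> xy gd dgm.
have [||c + ->] := @MVT_segment _ g dg x y xy.
- by move=> z; rewrite in_itv/= => /andP[/ltW ? /ltW ?]; apply: gd; apply/andP.
- apply: derivable_within_continuous => z; rewrite in_itv/= => zI.
  by have [] := gd z zI.
- by rewrite in_itv/= => cI; rewrite ler_wpM2r ?subr_ge0 ?dgm.
Qed.

Lemma near_dist_shrink (P : R -> Prop) : (\forall y \near 0, P y) ->
  \forall y \near (0 : R), forall z, `|z| <= `|y| -> P z.
Proof.
move=> /near_le_ball[r r0 H]; apply: (@ball_le_near _ 0 r) => // y.
by rewrite subr0 => yr z zy; apply: H; rewrite subr0 (le_trans zy).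
Qed.

(** Only the derivative of [dg] at the base point is available, so the proof is
    the mean value inequality for the difference with the parabola. *)
Lemma taylor2_ge g (dg : R -> R) x d2 C :
  (\forall z \near x, is_derive (z : R) 1 g (dg z)) -> is_derive x 1 dg d2 -> C < d2 ->
  \forall y \near 0, g x + dg x * y + C * y ^+ 2 / 2 <= g (x + y).
Proof.
move=> gd dgd Cd.
have H1 := near_dist_shrink (is_derive_near_ge dgd Cd).
have H2 := near_dist_shrink ((near_shift0 _ _).1 gd).
near=> y.
have K1 : forall z, `|z| <= `|y| -> (0 <= z -> dg x + C * z <= dg (x + z)) /\
                     (z <= 0 -> dg (x + z) <= dg x + C * z).
  by near: y; exact: H1.
have K2 : forall z, `|z| <= `|y| -> is_derive (x + z) 1 g (dg (x + z)).
  by near: y; exact: H2.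
pose k z := g (x + z) - (dg x * z + C * z ^+ 2 / 2).
have kd z : `|z| <= `|y| -> is_derive z 1 k (dg (x + z) - (dg x + C * z)).
  move=> zy; rewrite /k.
  apply: is_derive_sub; first by apply: is_derive_comp_shift; exact: K2.
  have := is_derive_quad 0 (dg x) C z.
  by congr (is_derive _ _ _ _); apply/funext => w; rewrite add0r.
have k0 : k 0 = g x by rewrite /k addr0; ring.
suff : k 0 <= k y by rewrite k0 /k; lra.
have [y0|/ltW y0] := leP 0 y.
  have := @MVT_le k (fun z => dg (x + z) - (dg x + C * z)) 0 y 0 y0.
  rewrite mul0r subr_ge0; apply=> z /andP[z0 zy].
    by apply: kd; rewrite !ger0_norm ?(le_trans z0).
  by rewrite subr_ge0; apply: (K1 z _).1 => //; rewrite !ger0_norm ?(le_trans z0).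
have := @MVT_le (fun z => - k z) (fun z => - (dg (x + z) - (dg x + C * z))) y 0 0 y0.
rewrite mul0r opprK addrC subr_ge0; apply=> z /andP[yz z0].
  apply/is_derive_opp/kd; rewrite !ler0_norm ?lerN2//; exact: le_trans z0.
rewrite oppr_ge0 subr_le0; apply: (K1 z _).2 => //.
rewrite !ler0_norm ?lerN2//; exact: le_trans z0.
Unshelve. all: by end_near.
Qed.
End calculus.

(** * Touching points and lower semicontinuity *)

Section touching.
Context {R : realType}.
Implicit Types (g : R -> R) (a b k s A B x y z l r d m C e : R).

(** First-order comparison on both sides identifies [B] with the derivative; if
    [d2] were smaller than [C], Taylor's inequality with an intermediate curvature
    would then put [g] below the parabola. *)
Lemma touching_second_derivative g (dg : R -> R) x d2 B C :
  (\forall z \near x, is_derive (z : R) 1 g (dg z)) -> is_derive x 1 dg d2 ->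
  (\forall y \near 0, g x + B * y + C * y ^+ 2 / 2 <= g (x + y)) -> C <= d2.
Proof.
move=> gd dgd touch; rewrite leNgt; apply/negP => Cd.
have dgx := nbhs_singleton gd.
have BE : dg x = B.
  apply/eqP; rewrite eq_le; apply/andP; split; rewrite leNgt; apply/negP => lt.
  - pose e := dg x - B; have e0 : 0 < e by rewrite subr_gt0.
    have h : B + e / 2 < dg x by rewrite /e; lra.
    have [r r0 H] : exists2 r, 0 < r & forall y, `|y - 0| <= r ->
       (y <= 0 -> g (x + y) <= g x + (B + e / 2) * y) /\
       g x + B * y + C * y ^+ 2 / 2 <= g (x + y).
      apply: near_le_ball; apply: filterS2 (is_derive_near_ge dgx h) touch.
      by move=> y [_ ? ?].
    pose y := Num.min r (e / (2 * (`|C| + 1))).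
    have C0 : 0 < `|C| + 1 by rewrite ltr_pwDr.
    have y0 : 0 < y by rewrite lt_min r0 divr_gt0// mulr_gt0.
    have yr : `|- y - 0| <= r by rewrite subr0 normrN gtr0_norm// ge_min lexx.
    have [/(_ _) H1 H2] := H _ yr.
    have ye : y * (2 * (`|C| + 1)) <= e by rewrite -ler_pdivlMr ?mulr_gt0// ge_min lexx orbT.
    have {H2} := le_trans H2 (H1 _); rewrite oppr_le0 (ltW y0) => /(_ isT).
    have /ler_normlP [nC _] : `|C| <= `|C| by [].
    have : - (`|C| * y) <= C * y by rewrite -mulNr ler_wpM2r ?(ltW y0)//; lra.
    by nra.
  - pose e := B - dg x; have e0 : 0 < e by rewrite subr_gt0.
    have h : dg x < B - e / 2 by rewrite /e; lra.
    have [r r0 H] : exists2 r, 0 < r & forall y, `|y - 0| <= r ->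
       (0 <= y -> g (x + y) <= g x + (B - e / 2) * y) /\
       g x + B * y + C * y ^+ 2 / 2 <= g (x + y).
      apply: near_le_ball; apply: filterS2 (is_derive_near_le dgx h) touch.
      by move=> y [? _ ?].
    pose y := Num.min r (e / (2 * (`|C| + 1))).
    have C0 : 0 < `|C| + 1 by rewrite ltr_pwDr.
    have y0 : 0 < y by rewrite lt_min r0 divr_gt0// mulr_gt0.
    have yr : `|y - 0| <= r by rewrite subr0 gtr0_norm// ge_min lexx.
    have [/(_ _) H1 H2] := H _ yr.
    have ye : y * (2 * (`|C| + 1)) <= e by rewrite -ler_pdivlMr ?mulr_gt0// ge_min lexx orbT.
    have {H2} := le_trans H2 (H1 (ltW y0)).
    have /ler_normlP [nC _] : `|C| <= `|C| by [].
    have : - (`|C| * y) <= C * y by rewrite -mulNr ler_wpM2r ?(ltW y0)//; lra.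
    by nra.
pose e := (C - d2) / 2.
have gNd : \forall z \near x, is_derive (z : R) 1 (fun y => - g y) (- dg z).
  by apply: filterS gd => z; exact: is_derive_opp.
have e2 : - (C - e) < - d2 by rewrite /e; lra.
have H := taylor2_ge gNd (is_derive_opp dgd) e2.
have [r r0 {}H] := near_le_ball (filterI H touch).
have : `|r - 0| <= r by rewrite subr0 gtr0_norm.
have e0 : 0 < e * r ^+ 2 by rewrite mulr_gt0 ?exprn_gt0// /e; lra.
by move=> /H [/=]; rewrite BE; lra.
Qed.

Definition lsc_in (S : set R) (v : R -> R) :=
  forall x m, S x -> m < v x -> \forall z \near x, S z -> m < v z.

Lemma lsc_in_sub (S S' : set R) v : S' `<=` S -> lsc_in S v -> lsc_in S' v.
Proof.
by move=> SS H x m /SS Sx mv; apply: filterS (H x m Sx mv) => z Hz /SS; exact: Hz.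
Qed.

Lemma lsc_in_min (S : set R) v : compact S -> S !=set0 -> lsc_in S v ->
  exists2 x0, S x0 & forall x, S x -> v x0 <= v x.
Proof.
move=> /compact_near_coveringP /near_covering_withinP cS [x1 Sx1] lv.
have lb : \forall m \near +oo, S `<=` [set x | - m < v x].
  apply: (cS _ _ (fun m x => - m < v x)) => x Sx.
  have vx : v x - 1 < v x by rewrite ltrBlDr ltrDl.
  near=> z m => /= Sz; apply: (@le_lt_trans _ _ (v x - 1)).
    by rewrite lerNl; near: m; exact: nbhs_pinfty_ge (num_real _).
  by move: Sz; near: z; apply: lv => //.
have [m mP] := filter_ex lb.
pose V := v @` S.
have hV : has_inf V.
  by split; [exists (v x1), x1|exists (- m) => _ [x Sx <-]; exact/ltW/mP].
apply: contrapT => nex.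
have gt x : S x -> inf V < v x.
  move=> Sx; rewrite lt_neqAle; apply/andP; split; last by apply: ge_inf; [case: hV|exists x].
  apply/eqP => E; apply: nex; exists x => // z Sz.
  by rewrite -E; apply: ge_inf; [case: hV|exists z].
have : \forall e \near 0^'+, S `<=` [set x | inf V + e < v x].
  apply: (cS _ _ (fun e x => inf V + e < v x)) => x Sx.
  pose c := (inf V + v x) / 2.
  have vc : c < v x by have := gt x Sx; rewrite /c; lra.
  have c0 : 0 < c - inf V by have := gt x Sx; rewrite /c; lra.
  near=> z e => /= Sz; apply: (@le_lt_trans _ _ c).
    by rewrite -lerBrDl; near: e; exact: nbhs_right_le.
  by move: Sz; near: z; apply: lv => //.
move=> H; have [e [eP e0]] := filter_ex (filterI H (nbhs_right_gt (0 : R))).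
have [_ [x Sx <-]] := inf_adherent e0 hV.
by apply/negP; rewrite -leNgt; apply/ltW/eP.
Unshelve. all: by end_near. Qed.

(** Continuous deformation argument: compactness in space yields a first time at
    which the gap fails to be positive; lower semicontinuity makes it nonpositive
    somewhere at that time, continuity in time keeps it nonnegative everywhere. *)
Lemma first_touch (J : finType) (S : J -> set R) (gap : J -> R -> R -> R) T T' :
  (forall j, compact (S j)) ->
  (forall j s x, T <= s <= T' -> S j x -> 0 < gap j s x ->
     \forall x' \near x & s' \near s, T <= s' <= T' -> S j x' -> 0 < gap j s' x') ->
  (forall j s x, T < s <= T' -> S j x -> gap j s x < 0 ->
     \forall s' \near s, T <= s' <= T' -> gap j s' x < 0) ->
  (forall j x, S j x -> 0 < gap j T x) ->
  (forall s j x, T < s <= T' -> S j x -> gap j s x = 0 ->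
     (forall j' x', S j' x' -> 0 <= gap j' s x') ->
     (forall s' j' x', T <= s' < s -> S j' x' -> 0 < gap j' s' x') -> False) ->
  forall s j x, T <= s <= T' -> S j x -> 0 < gap j s x.
Proof.
move=> cS lsc usc init notouch s j x sT Sx; rewrite ltNge; apply/negP => bad.
pose Bad := [set s | T <= s <= T' /\ exists j x, S j x /\ gap j s x <= 0].
have Bs : Bad s by split=> //; exists j, x.
have hB : has_inf Bad by split; [exists s|exists T => t [/andP[]]].
pose s1 := inf Bad.
have s1s : s1 <= s by apply: ge_inf => //; case: hB.
have Ts1 : T <= s1 by apply: lb_le_inf; [case: hB|move=> t [/andP[]]].
have s1T' : s1 <= T' by apply: le_trans s1s _; case/andP: sT.
have before t j' x' : T <= t < s1 -> S j' x' -> 0 < gap j' t x'.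
  move=> /andP[Tt ts1] Sx'; rewrite ltNge; apply/negP => b'.
  have : s1 <= t.
    apply: ge_inf; first by case: hB.
    by split; [rewrite Tt (le_trans (ltW ts1))|exists j', x'].
  by rewrite leNgt ts1.
have Bs1 : exists j x, S j x /\ gap j s1 x <= 0.
  apply: contrapT => nB.
  have pos j' x' : S j' x' -> 0 < gap j' s1 x'.
    by move=> Sx'; rewrite ltNge; apply/negP => b'; apply: nB; exists j', x'.
  have : \forall t \near s1, forall j', S j' `<=` [set x' | T <= t <= T' -> 0 < gap j' t x'].
    apply: (@filter_forall _ J (fun j' t => S j' `<=` [set x' | T <= t <= T' -> 0 < gap j' t x'])
      (nbhs s1) (nbhs_filter s1)) => j'.
    have /compact_near_coveringP /near_covering_withinP cSj := cS j'.
    apply: (cSj _ _ (fun t x' => T <= t <= T' -> 0 < gap j' t x')) => x' Sx'.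
    have Ts1T : T <= s1 <= T' by rewrite Ts1.
    have := lsc j' s1 x' Ts1T Sx' (pos _ _ Sx').
    by apply: filterS => -[? ?] /= H ? ?; exact: H.
  move=> /near_le_ball[r r0 rP].
  have [t [/andP[Tt tT'] [j' [x' [Sx' b']]]] tlt] := inf_adherent r0 hB.
  have : 0 < gap j' t x'.
    apply: rP => //; last by rewrite Tt.
    have s1t : s1 <= t by apply: ge_inf; [case: hB|split; [rewrite Tt|exists j', x']].
    by rewrite ger0_norm ?subr_ge0// lerBlDl; exact: ltW.
  by rewrite ltNge b'.
have [j1 [x1 [Sx1 g1]]] := Bs1.
have Tlts1 : T < s1.
  rewrite lt_neqAle Ts1 andbT; apply/eqP => E.
  by have := init _ _ Sx1; rewrite E ltNge g1.
have Ts1T : T < s1 <= T' by rewrite Tlts1.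
have nonneg j' x' : S j' x' -> 0 <= gap j' s1 x'.
  move=> Sx'; rewrite leNgt; apply/negP => neg.
  have /near_le_ball[r r0 rP] := usc _ _ _ Ts1T Sx' neg.
  pose t := Num.max T (s1 - r).
  have ts1 : t < s1 by rewrite gt_max Tlts1/= ltrBlDr ltrDl.
  have Tt : T <= t by rewrite le_max lexx.
  have : gap j' t x' < 0.
    apply: rP; last by rewrite Tt (le_trans (ltW ts1)).
    rewrite ler0_norm ?opprB; last by rewrite subr_le0 ltW.
    by rewrite lerBlDl -lerBlDr le_max lexx orbT.
  by rewrite ltNge ltW// before// Tt.
apply: (notouch s1 j1 x1) => //.
by apply/eqP; rewrite eq_le g1 nonneg.
Qed.
End touching.

(** * Primitives and the bistable potential *)

Section primitives.
Context {R : realType}.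
Notation mu := (@lebesgue_measure R).

Lemma right_primitive (g : R -> R) (m : R) : continuous g ->
  exists G : R -> R, forall x, m < x -> is_derive x 1 G (g x).
Proof.
move=> cg; exists (fun x => (\int[mu]_(t in `[m, x]) g t)%R) => x mx.
have x1 : x < x + 1 by rewrite ltrDl.
have ig : mu.-integrable `[m, x + 1] (EFin \o g).
  apply: continuous_compact_integrable; first exact: segment_compact.
  exact: continuous_subspaceT.
have [dG GE] := continuous_FTC1_closed x1 ig mx (cg x).
by split; [exact: dG|rewrite -derive1E; exact: GE].
Qed.

(** The reflected function provides a primitive on a left half-line; the two
    primitives are glued along the interval where both are defined. *)
Lemma continuous_primitive (g : R -> R) : continuous g ->
  exists G : R -> R, forall x : R, is_derive x 1 G (g x).
Proof.
move=> cg; have [G1 dG1] := right_primitive (-1) cg.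
have cgN : continuous (fun x => g (- x)).
  by move=> x; apply: (@continuous_comp _ _ _ -%R g); [exact: opp_continuous|exact: cg].
have [G0 dG0] := right_primitive (-1) cgN.
pose G2 x := - G0 (- x).
have dG2 (x : R) : x < 1 -> is_derive x 1 G2 (g x).
  move=> x1; have Nx1 : -1 < - x by rewrite ltrN2.
  have := dG0 _ Nx1; rewrite opprK => d0.
  have dN : is_derive x 1 (fun y : R => - y) (- 1) by exact: is_deriveNid.
  have := is_derive_opp (is_derive1_comp d0 dN).
  by move/is_derive_eq; apply; rewrite mulrN1 opprK.
have G12 x : -1 < x -> x < 0 -> G2 x + (G1 0 - G2 0) = G1 x.
  move=> x1 x0.
  have dD (y : R) : x <= y <= 0 -> is_derive y 1 (fun y => G1 y - G2 y) 0.
    move=> /andP[xy y0]; rewrite -[0](subrr (g y)).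
    apply: is_derive_sub; first by apply: dG1; exact: lt_le_trans xy.
    by apply: dG2; exact: le_lt_trans ltr01.
  have h1 := @MVT_le _ (fun y => G1 y - G2 y) (fun=> 0) x 0 0 (ltW x0) dD (fun _ _ => lexx 0).
  have dN (y : R) : x <= y <= 0 -> is_derive y 1 (fun y => - (G1 y - G2 y)) (- 0).
    by move=> yI; apply: is_derive_opp; exact: dD.
  have := @MVT_le _ _ (fun=> - 0) x 0 0 (ltW x0) dN.
  rewrite oppr0 => /(_ (fun _ _ => lexx 0)) h2.
  by move: h1 h2; rewrite mul0r; lra.
pose G x := if x < 0 then G2 x + (G1 0 - G2 0) else G1 x.
exists G => x; have [x0|x0] := ltP x 0.
  have d2 : is_derive x 1 (fun x => G2 x + (G1 0 - G2 0)) (g x).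
    have x1 : x < 1 by exact: lt_trans ltr01.
    by have := is_derive_add (dG2 x x1) (is_derive_const x (G1 0 - G2 0)); rewrite addr0.
  apply: near_eq_is_derive d2.
  by near=> z; rewrite /G ifT//; near: z; exact: lt_nbhsl.
have d1 : is_derive x 1 G1 (g x) by apply: dG1; exact: lt_le_trans x0.
apply: near_eq_is_derive d1.
near=> z; rewrite /G; case: ifPn => // z0; rewrite G12//.
by near: z; apply: lt_nbhsr; exact: lt_le_trans x0.
Unshelve. all: by end_near. Qed.

Lemma Rintegral_primitive (g G : R -> R) (x : R) : continuous g -> 0 < x ->
  (forall y, 0 <= y <= x -> is_derive y 1 G (g y)) ->
  (\int[mu]_(t in `[0, x]) g t)%R = G x - G 0.
Proof.
move=> cg x0 dG; rewrite /Rintegral (@continuous_FTC2 _ g G) //.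
- exact: continuous_subspaceT.
- have cG y : 0 <= y <= x -> {for y, continuous G}.
    by move=> /dG; exact: is_derive_continuous.
  split.
  + move=> y; rewrite in_itv/= => /andP[/ltW y0 /ltW yx].
    by have [] : is_derive y 1 G (g y) by apply: dG; rewrite y0.
  + by apply: cvg_at_right_filter; apply: cG; rewrite lexx ltW.
  + by apply: cvg_at_left_filter; apply: cG; rewrite lexx ltW.
- move=> y; rewrite in_itv/= => /andP[/ltW y0 /ltW yx].
  have [_] : is_derive y 1 G (g y) by apply: dG; rewrite y0.
  by rewrite derive1E.
Qed.
End primitives.

Section bistable_potential.
Context {R : realType}.
Variables (f : R -> R) (a : R).
Hypothesis hf : bistable f a.

Lemma bistable_continuous : continuous f.
Proof.
move=> x; have [_ [df _] _ _ _] := hf.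
exact/differentiable_continuous/derivable1_diffP.
Qed.

(** [potential] is meaningful for nonnegative arguments only, whereas barriers
    are also differentiated at height 0. *)
Definition potential_primitive (F : R -> R) :=
  F 0 = 0 /\ forall x : R, is_derive x 1 F (f x).

Lemma potential_primitive_exists : exists F, potential_primitive F.
Proof.
have [G dG] := continuous_primitive bistable_continuous.
exists (fun x => G x - G 0); split; first by rewrite subrr.
move=> x; rewrite -[f x]subr0.
exact: is_derive_sub (dG x) (is_derive_const _ _).
Qed.

Variable F : R -> R.
Hypothesis hF : potential_primitive F.

Lemma potential_primitiveE s : 0 < s -> potential f s = F s.
Proof.
move=> s0; rewrite -[RHS]subr0 -hF.1.
apply: Rintegral_primitive => //; first exact: bistable_continuous.
by move=> y _; exact: hF.2.
Qed.

Lemma primitive_increment x y m : x <= y ->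
  (forall z, x <= z <= y -> m <= f z) -> m * (y - x) <= F y - F x.
Proof.
move=> xy; apply: MVT_le => // z _; exact: hF.2.
Qed.

Lemma primitive_decrement x y m : x <= y ->
  (forall z, x <= z <= y -> f z <= m) -> F y - F x <= m * (y - x).
Proof.
move=> xy fm.
have := @MVT_le _ (fun z => - F z) (fun z => - f z) x y (- m) xy.
have H z : x <= z <= y -> is_derive z 1 (fun z => - F z) (- f z).
  by move=> _; apply: is_derive_opp; exact: hF.2.
move=> /(_ H) H2.
suff : - m * (y - x) <= - F y - - F x by lra.
by apply: H2 => z /fm; rewrite lerN2.
Qed.

Let a0 : 0 < a. Proof. by have [/andP[]] := hf. Qed.
Let a1 : a < 1. Proof. by have [/andP[]] := hf. Qed.
Let f0 : f 0 = 0. Proof. by have [_ _ []] := hf. Qed.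
Let fa : f a = 0. Proof. by have [_ _ []] := hf. Qed.
Let f1 : f 1 = 0. Proof. by have [_ _ []] := hf. Qed.
Let fneg s : 0 < s < a -> f s < 0. Proof. by have [_ _ _ [H _] _] := hf; exact: H. Qed.
Let fpos s : a < s < 1 -> 0 < f s. Proof. by have [_ _ _ [_ H] _] := hf; exact: H. Qed.

Lemma bistable_le0 s : 0 <= s <= a -> f s <= 0.
Proof.
rewrite !le_eqVlt => /andP[/predU1P[<-|s0]]; first by rewrite f0 eqxx.
by move=> /predU1P[->|sa]; [rewrite fa eqxx|rewrite fneg ?orbT// s0].
Qed.

Lemma bistable_ge0 s : a <= s <= 1 -> 0 <= f s.
Proof.
rewrite !le_eqVlt => /andP[/predU1P[<-|s0]]; first by rewrite fa eqxx.
by move=> /predU1P[->|sa]; [rewrite f1 eqxx|rewrite fpos ?orbT// s0].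
Qed.

Lemma primitive_nincr x y : 0 <= x -> x <= y -> y <= a -> F y <= F x.
Proof.
move=> x0 xy ya; rewrite -subr_le0 -(mul0r (y - x)).
apply: primitive_decrement => //.
by move=> z /andP[xz zy]; apply: bistable_le0; rewrite (le_trans x0 xz) (le_trans zy).
Qed.

Lemma primitive_ndecr x y : a <= x -> x <= y -> y <= 1 -> F x <= F y.
Proof.
move=> x0 xy ya; rewrite -subr_ge0 -(mul0r (y - x)).
apply: primitive_increment => //.
by move=> z /andP[xz zy]; apply: bistable_ge0; rewrite (le_trans x0 xz) (le_trans zy).
Qed.

Lemma primitive_min s : 0 <= s <= 1 -> F a <= F s.
Proof.
move=> /andP[s0 s1]; have [sa|/ltW as_] := leP s a.
  exact: primitive_nincr.
exact: primitive_ndecr.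
Qed.

Lemma primitive_max r s : 0 <= r -> r <= s -> s <= 1 -> F r <= Num.max 0 (F s).
Proof.
move=> r0 rs s1; rewrite le_max; have [ra|/ltW ar] := leP r a.
  by rewrite -{1}hF.1 primitive_nincr.
by rewrite (primitive_ndecr ar rs s1) orbT.
Qed.

Lemma primitive_MVT x y : x < y ->
  exists2 z, x < z < y & F y - F x = f z * (y - x).
Proof.
move=> xy; have [||c + E] := @MVT _ F f x y xy.
- by move=> z _; exact: hF.2.
- apply: derivable_within_continuous => z _.
  by have [] := hF.2 z.
- by rewrite in_itv/= => ?; exists c.
Qed.

Lemma primitive_lt0 s : 0 < s <= a -> F s < 0.
Proof.
move=> /andP[s0 sa]; have [z /andP[z0 zs] E] := primitive_MVT s0.
have := fneg; move=> /(_ z); rewrite z0 (lt_le_trans zs sa) => /(_ isT) fz.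
by move: E; rewrite hF.1 !subr0 => ->; rewrite pmulr_llt0.
Qed.

Lemma primitive_lt1 s : a <= s < 1 -> F s < F 1.
Proof.
move=> /andP[sa s1].
have [z /andP[z0 zs] E] := primitive_MVT s1.
have := @fpos z; rewrite (le_lt_trans sa z0) zs => /(_ isT) fz.
by rewrite -subr_gt0 E pmulr_lgt0// subr_gt0.
Qed.

Lemma bistable_bound : exists2 L, 0 < L & forall x, 0 <= x <= 1 -> `|f x| <= L.
Proof.
have cf : continuous (fun x => `|f x|).
  move=> x; apply: (@continuous_comp _ _ _ f (fun z => `|z|)); first exact: bistable_continuous.
  exact: norm_continuous.
have [c _ cP] := EVT_max (@ler01 R) (continuous_subspaceT cf).
exists (`|f c| + 1); first by rewrite ltr_pwDr.
by move=> x xI; rewrite ler_wpDr// cP// in_itv.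
Qed.
End bistable_potential.

(** * The traveling front *)

Section wave.
Context {R : realType}.
Variables (f : R -> R) (a : R) (phi : R -> R) (c : R).
Implicit Types x y z : R.
Hypotheses (hf : bistable f a) (hphi : traveling_wave f a phi c).

Lemma derivable_is_derive1 (g : R -> R) (x : R) : derivable g x 1 ->
  is_derive x 1 g (derive1 g x).
Proof. by move=> dg; rewrite derive1E; exact: derivableP. Qed.

Lemma bistable_is_derive (x : R) : is_derive x 1 f (derive1 f x).
Proof. by apply: derivable_is_derive1; have [_ []] := hf. Qed.

Lemma bistable_lipschitz :
  exists2 L, 0 < L & forall x y, -1 <= x -> x <= y -> y <= 1 -> `|f y - f x| <= L * (y - x).
Proof.
have cf : continuous (fun x => `|derive1 f x|).
  move=> x; apply: (@continuous_comp _ _ _ (derive1 f) (fun z => `|z|)).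
    by have [_ [_ H] _ _ _] := hf; exact: H.
  exact: norm_continuous.
have N11 : (-1 : R) <= 1 by lra.
have [k _ kP] := EVT_max N11 (continuous_subspaceT cf).
exists (`|derive1 f k| + 1); first by rewrite ltr_pwDr.
move=> x y x1 xy y1.
have [||z zI ->] := @MVT_segment _ f (derive1 f) x y xy.
- by move=> z _; exact: bistable_is_derive.
- exact: continuous_subspaceT (bistable_continuous hf).
rewrite normrM (ger0_norm (_ : 0 <= y - x)) ?subr_ge0// ler_wpM2r ?subr_ge0//.
rewrite ler_wpDr// kP//; move: zI; rewrite !in_itv/= => /andP[xz zy].
by rewrite (le_trans x1 xz) (le_trans zy).
Qed.

Local Notation dphi := (derive1 phi).
Local Notation ddphi := (derive1 (derive1 phi)).

Lemma wave_is_derive (z : R) : is_derive z 1 phi (dphi z).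
Proof. by have [_ /(_ z)[H _ _] _ _ _] := hphi; exact: derivable_is_derive1. Qed.

Lemma wave_is_derive2 (z : R) : is_derive z 1 dphi (ddphi z).
Proof. by have [_ /(_ z)[_ H _] _ _ _] := hphi; exact: derivable_is_derive1. Qed.

Lemma wave_ode z : ddphi z = - c * dphi z - f (phi z).
Proof. by have [_ /(_ z)[_ _ H] _ _ _] := hphi; lra. Qed.

Lemma wave_continuous : continuous phi.
Proof. by move=> z; exact: is_derive_continuous (wave_is_derive z). Qed.

Lemma dwave_continuous : continuous dphi.
Proof. by move=> z; exact: is_derive_continuous (wave_is_derive2 z). Qed.

Let c0 : 0 < c. Proof. by have [] := hphi. Qed.
Let phi01 z : 0 < phi z < 1. Proof. by have [_ _ H _ _] := hphi; exact: H. Qed.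

Lemma wave_near_Ny e : 0 < e -> exists Z, forall z, z <= Z -> 1 - e < phi z.
Proof.
move=> e0; have [_ _ _ [/cvgrPdist_lt/(_ e e0)[Z [_ ZP]] _] _] := hphi.
exists (Z - 1) => z zZ; have := ZP z; rewrite /= => /(_ (le_lt_trans zZ _)).
by rewrite ltrBlDr ltrDl ltr01 => /(_ isT); rewrite ltr_norml; lra.
Qed.

Lemma wave_near_y e : 0 < e -> exists Z, forall z, Z <= z -> phi z < e.
Proof.
move=> e0; have [_ _ _ [_ /cvgrPdist_lt/(_ e e0)[Z [_ ZP]]] _] := hphi.
exists (Z + 1) => z zZ; have := ZP z; rewrite /= => /(_ (lt_le_trans _ zZ)).
by rewrite ltrDl ltr01 => /(_ isT); rewrite ltr_norml; lra.
Qed.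

Lemma wave_surjective M : 0 < M < 1 -> exists s, phi s = M.
Proof.
move=> /andP[M0 M1].
have [Z1 H1] := @wave_near_Ny (1 - M) ltac:(lra).
have [Z2 H2] := wave_near_y M0.
pose z1 := Num.min Z1 Z2; pose z2 := Num.max Z1 Z2.
have z12 : z1 <= z2 by rewrite ge_min le_max lexx.
have [|s _ <-] := @IVT _ phi z1 z2 M z12 (continuous_subspaceT wave_continuous).
  have h1 := H1 z1; have h2 := H2 z2.
  rewrite ge_min lexx/= in h1; rewrite le_max lexx orbT in h2.
  have {}h1 := h1 isT; have {}h2 := h2 isT.
  by rewrite ge_min le_max; apply/andP; split; apply/orP; [right|left]; lra.
by exists s.
Qed.

Section wave_energy.
Variable F : R -> R.
Hypothesis hF : potential_primitive f F.

Let energy z := dphi z * dphi z / 2 + F (phi z).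

Lemma wave_energy_derive (z : R) : is_derive z 1 energy (- c * (dphi z * dphi z)).
Proof.
have dF := hF.2 (phi z).
have := is_derive_add (is_derive_mulC (1 / 2)
  (is_derive_mul (wave_is_derive2 z) (wave_is_derive2 z))) (is_derive1_comp dF (wave_is_derive z)).
move=> H; have {H} := is_derive_eq H; move=> /(_ (- c * (dphi z * dphi z))).
rewrite wave_ode => H.
have -> : energy = (fun y => 1 / 2 * (dphi y * dphi y) + (F \o phi) y).
  by apply/funext => y; rewrite /energy /=; lra.
by apply: H; field.
Qed.

Lemma wave_energy_nincr x y : x <= y -> energy y <= energy x.
Proof.
move=> xy; have := @MVT_le _ (fun z => - energy z) (fun z => - (- c * (dphi z * dphi z))) x y 0 xy.
have H (z : R) : x <= z <= y -> is_derive z 1 (fun z => - energy z) (- (- c * (dphi z * dphi z))).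
  by move=> _; apply: is_derive_opp; exact: wave_energy_derive.
move=> /(_ H); suff : forall z : R, x <= z <= y -> 0 <= - (- c * (dphi z * dphi z)).
  by move=> h1 /(_ h1); lra.
by move=> z _; rewrite -mulNr opprK mulr_ge0 ?(ltW c0)// -expr2 sqr_ge0.
Qed.

Lemma wave_energy_ge0 z : 0 <= energy z.
Proof.
rewrite leNgt; apply/negP => Ez.
have [F0 dF] := hF.
have cF : {for 0, continuous F} by exact: is_derive_continuous (dF 0).
move/cvgrPdist_lt : cF => /(_ (- energy z)); rewrite oppr_gt0 => /(_ Ez).
rewrite F0 => /near_le_ball[r r0 rP].
have [Z ZP] := wave_near_y r0.
pose y := Num.max z Z.
have := rP (phi y); rewrite subr0 gtr0_norm; last by case/andP: (phi01 y).
have /ltW -> : phi y < r by apply: ZP; rewrite le_max lexx orbT.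
move=> /(_ isT); rewrite sub0r normrN ltr_norml => /andP[H _].
have : energy y <= energy z by apply: wave_energy_nincr; rewrite le_max lexx.
by have := sqr_ge0 (dphi y); rewrite /energy expr2; move: H; rewrite /energy; lra.
Qed.

Lemma wave_noncritical_low z : phi z <= a -> dphi z <> 0.
Proof.
move=> za dz; have := wave_energy_ge0 z; rewrite /energy dz mul0r mul0r add0r.
rewrite leNgt; apply/negP; rewrite negbK; apply: (primitive_lt0 hf hF).
by rewrite za andbT; case/andP: (phi01 z).
Qed.
End wave_energy.

(** The energy [phi'^2 / 2 + F phi] decreases to a nonnegative limit while [F]
    is negative on (0, a], so no critical point lies at a height at most [a].  If
    [phi'] were positive somewhere, [phi] would have a local minimum further to
    the left, and the equation puts such a minimum at a height at most [a]; if
    [phi'] vanished somewhere, the equation would give [phi = a] there. *)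
Lemma wave_decreasing z : dphi z < 0.
Proof.
have [F hF] := potential_primitive_exists hf.
have dle z0 : dphi z0 <= 0.
  rewrite leNgt; apply/negP => d0.
  have p1 : 0 < 1 - phi z0 by case/andP: (phi01 z0) => _; rewrite subr_gt0.
  have [Z ZP] := wave_near_Ny p1.
  pose z2 := Num.min Z (z0 - 1).
  have z2z0 : z2 < z0 by rewrite gt_min; apply/orP; right; rewrite ltrBlDr ltrDl.
  have pz2 : phi z0 < phi z2 by have := ZP z2; rewrite ge_min lexx => /(_ isT); lra.
  have [z1 z1I z1min] := EVT_min (ltW z2z0) (continuous_subspaceT wave_continuous).
  have pz1 : phi z1 <= phi z0 by apply: z1min; rewrite in_itv/= lexx ltW.
  have z1z2 : z2 < z1.
    rewrite lt_neqAle; move: (z1I); rewrite in_itv/= => /andP[-> _]; rewrite andbT.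
    by apply/eqP => E; move: pz2; rewrite E ltNge pz1.
  have z1z0 : z1 < z0.
    rewrite lt_neqAle; move: (z1I); rewrite in_itv/= => /andP[_ ->]; rewrite andbT.
    apply/eqP => E.
    have dd : 0 < dphi z0 / 2 < dphi z0 by apply/andP; split; lra.
    case/andP: dd => d1 d2.
    have /near_le_ball[r r0 rP] := is_derive_near_ge (wave_is_derive z0) d2.
    pose y := Num.min r (z0 - z2).
    have y0 : 0 < y by rewrite lt_min r0 subr_gt0.
    have := rP (- y); rewrite subr0 normrN gtr0_norm// ge_min lexx => /(_ isT)[_].
    rewrite oppr_le0 (ltW y0) => /(_ isT) H.
    have : phi z1 <= phi (z0 - y).
      apply: z1min; rewrite in_itv/=; apply/andP; split; last by lra.
      by rewrite lerBrDl -lerBrDr ge_min lexx orbT.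
    by rewrite E; nra.
  have inI : z1 \in `]z2, z0[ by rewrite in_itv/= z1z2.
  have : is_derive z1 1 phi 0.
    apply: (derive1_at_min (ltW z2z0)) inI _.
      by move=> x _; have [] := wave_is_derive x.
    by move=> x; rewrite in_itv/= => /andP[/ltW ? /ltW ?]; apply: z1min; rewrite in_itv/=; apply/andP.
  move=> [_ dz1]; have dz1' : dphi z1 = 0 by rewrite derive1E.
  have : 0 <= ddphi z1.
    apply: (@touching_second_derivative _ phi dphi z1 _ 0 0).
    - by apply: (@filterE _ (nbhs z1)) => z'; exact: wave_is_derive.
    - exact: wave_is_derive2.
    - have z1int : z2 < z1 < z0 by rewrite z1z2.
      apply: filterS (near0_in_interval z1int) => y yI; rewrite !mul0r !addr0.
      by apply: z1min; rewrite in_itv.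
  rewrite wave_ode dz1' => ff.
  have fp : f (phi z1) <= 0 by lra.
  apply: (wave_noncritical_low hF _ dz1').
  rewrite leNgt; apply/negP => az.
  move: fp; rewrite leNgt => /negP; apply.
  by have [_ _ _ [_ H] _] := hf; apply: H; rewrite az; case/andP: (phi01 z1).
rewrite lt_neqAle dle andbT; apply/eqP => dz.
have : is_derive z 1 dphi 0.
  apply: (@derive1_at_max _ _ (z - 1) (z + 1)).
  - by lra.
  - by move=> x _; have [] := wave_is_derive2 x.
  - by rewrite in_itv/=; apply/andP; split; lra.
  - by move=> x _; rewrite dz; exact: dle.
move=> [_ ddz]; have := wave_ode z; rewrite derive1E ddz dz mulr0 sub0r => /esym/eqP.
rewrite oppr_eq0 => /eqP fz.
have := phi01 z => /andP[p0 p1].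
have [_ _ _ [fneg fpos] _] := hf.
have [pa|ap|E] := ltgtP (phi z) a.
- by have := fneg (phi z); rewrite p0 pa fz ltxx => /(_ isT).
- by have := fpos (phi z); rewrite ap p1 fz ltxx => /(_ isT).
- by apply: (wave_noncritical_low hF _ dz); rewrite E.
Qed.

Lemma wave_nincr x y : x <= y -> phi y <= phi x.
Proof.
move=> xy; have := @MVT_le _ (fun z => - phi z) (fun z => - dphi z) x y 0 xy.
rewrite mul0r => H; suff : 0 <= - phi y - - phi x by lra.
apply: H => z _; last by rewrite oppr_ge0 ltW// wave_decreasing.
by apply: is_derive_opp; exact: wave_is_derive.
Qed.

(** Shifted down by a small constant, the front profile is a strict stationary
    subsolution: where it is steep the term [- c * phi'] wins, and near the
    stable states 0 and 1 the reaction term does. *)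
Lemma wave_strict_subsolution : exists2 k0, 0 < k0 &
  forall k z, 0 < k <= k0 -> 0 < ddphi z + f (phi z - k).
Proof.
have [_ [_ cf'] _ _ [f'0 _ f'1 _]] := hf.
have near_neg s : derive1 f s < 0 -> exists2 d, 0 < d &
    forall z, `|z - s| <= d -> derive1 f z < 0.
  move=> fs; apply: near_le_ball.
  move/cvgrPdist_lt : (cf' s) => /(_ (- derive1 f s)); rewrite oppr_gt0 => /(_ fs).
  by apply: filterS => z; rewrite ltr_norml => /andP[H _]; lra.
have [d0 d00 d0P] := near_neg 0 f'0.
have [d1 d10 d1P] := near_neg 1 f'1.
have decr x y : x <= y -> (forall z, x <= z <= y -> derive1 f z < 0) -> f y <= f x.
  move=> xy neg; have := @MVT_le _ (fun z => - f z) (fun z => - derive1 f z) x y 0 xy.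
  rewrite mul0r => H; suff : 0 <= - f y - - f x by lra.
  apply: H => z zI; last by rewrite oppr_ge0 ltW// neg.
  by apply: is_derive_opp; exact: bistable_is_derive.
pose d := Num.min (Num.min d0 d1) 1 / 2.
have d_gt0 : 0 < d by rewrite divr_gt0// !lt_min d00 d10 ltr01.
have [dd0 dd1 dd] : [/\ 2 * d <= d0, 2 * d <= d1 & 2 * d <= 1].
  by rewrite /d mulrC divfK// !ge_min !lexx !orbT.
have [Z1 H1] := wave_near_Ny d_gt0; have [Z2 H2] := wave_near_y d_gt0.
pose z1 := Num.min Z1 Z2; pose z2 := Num.max Z1 Z2.
have z12 : z1 <= z2 by rewrite ge_min le_max lexx.
have [zm _ zmP] := EVT_max z12 (continuous_subspaceT dwave_continuous).
pose m := - c * dphi zm.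
have m0 : 0 < m by rewrite /m mulNr oppr_gt0 pmulr_rlt0// wave_decreasing.
have [L L0 lipL] := bistable_lipschitz.
exists (Num.min d (m / (2 * L))); first by rewrite lt_min d_gt0 divr_gt0// mulr_gt0.
move=> k z /andP[k0]; rewrite le_min => /andP[kd km].
have dz := wave_decreasing z; have cdz : 0 < - c * dphi z.
  by rewrite mulNr oppr_gt0 pmulr_rlt0.
rewrite wave_ode; have /andP[p0 p1] := phi01 z.
have pk : phi z - k <= phi z by lra.
have [pd|dp] := leP (phi z) d.
  suff : f (phi z) <= f (phi z - k) by lra.
  by apply: decr => // w /andP[? ?]; apply: d0P; rewrite ler_norml; apply/andP; split; lra.
have [pd|pd] := leP (1 - d) (phi z).
  suff : f (phi z) <= f (phi z - k) by lra.
  by apply: decr => // w /andP[? ?]; apply: d1P; rewrite ler_norml; apply/andP; split; lra.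
have z1z : z1 <= z.
  rewrite leNgt; apply/negP => zz1; have := H1 z; apply/implyP; rewrite negb_imply.
  by rewrite -leNgt (ltW pd) andbT (le_trans (ltW zz1))// ge_min lexx.
have zz2 : z <= z2.
  rewrite leNgt; apply/negP => zz1; have := H2 z; apply/implyP; rewrite negb_imply.
  by rewrite -leNgt (ltW dp) andbT (le_trans _ (ltW zz1))// le_max lexx orbT.
have mz : m <= - c * dphi z.
  by rewrite /m !mulNr lerN2 ler_pM2l// zmP// in_itv/= z1z.
have kk : k * (2 * L) <= m by rewrite -ler_pdivlMr// mulr_gt0.
have := lipL (phi z - k) (phi z).
have -> : -1 <= phi z - k by lra.
move=> /(_ isT pk (ltW p1)); rewrite ler_norml => /andP[_].
have -> : phi z - (phi z - k) = k by ring.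
by nra.
Qed.

End wave.

(** * Viscosity supersolutions and travel times *)

Section viscosity.
Context {R : realType}.
Implicit Types (f v : R -> R) (x y z m : R).

(** Viscosity formulation of [v'' + f v <= 0]: the tests are parabolas touching
    [v] from below, which makes sense for a lower semicontinuous [v]. *)
Definition super_at f v x := forall B C,
  (\forall y \near 0, v x + B * y + C * y ^+ 2 / 2 <= v (x + y)) ->
  C + f (v x) <= 0.

Definition ray_supersolution f v :=
  [/\ lsc_in `[0, +oo[ v, forall x, 0 <= x -> 0 <= v x <= 1
    & forall x, 0 < x -> super_at f v x].

(** Between the slopes [hl < hr] of a convex corner there is room for a parabola
    of arbitrarily large curvature. *)
Lemma super_at_no_corner f v x hl hr : super_at f v x -> hl < hr ->
  (\forall y \near 0^'+, v x + hr * y <= v (x + y)) ->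
  (\forall y \near 0^'+, v x - hl * y <= v (x - y)) -> False.
Proof.
move=> sx hlr /near_right0[r1 r10 H1] /near_right0[r2 r20 H2].
pose C := 1 - f (v x); pose b := (hl + hr) / 2; pose d := (hr - hl) / 2.
have d0 : 0 < d by rewrite divr_gt0// subr_gt0.
have K0 : 0 < `|C| + 1 by rewrite ltr_pwDr.
suff : C + f (v x) <= 0 by rewrite /C; lra.
apply: (sx b).
have m0 : 0 < Num.min (Num.min r1 r2) (d / (`|C| + 1)).
  by rewrite !lt_min r10 r20 divr_gt0.
apply: (@ball_le_near _ _ 0 _ m0) => y; rewrite subr0 !le_min => /andP[/andP[yr1 yr2]].
rewrite ler_pdivlMr// => yd.
have Cy : C * y ^+ 2 / 2 <= d * `|y|.
  have : C <= `|C| by exact: ler_norm.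
  have : `|y| ^+ 2 = y ^+ 2 by rewrite real_normK// num_real.
  have : 0 <= `|y| by [].
  have : 0 <= y ^+ 2 by exact: sqr_ge0.
  have : 0 <= `|C| by [].
  by nra.
have [y0|y0|y0] := ltgtP y 0; last by rewrite y0 addr0 mulr0 expr0n/= mulr0 mul0r !addr0.
  have ny : `|y| = - y by rewrite ltr0_norm.
  have := H2 (- y); rewrite oppr_gt0 y0 -ny yr2 => /(_ isT).
  by rewrite ny opprK /b; move: Cy; rewrite ny /d; nra.
have ny : `|y| = y by rewrite gtr0_norm.
have := H1 y; rewrite y0 -{1}ny yr1 => /(_ isT).
by move: Cy; rewrite ny /b /d; nra.
Qed.

Lemma lsc_in_comp_add (S : set R) v (X ell : R -> R) : lsc_in S v ->
  continuous X -> {homo X : x y / x < y} -> continuous ell ->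
  lsc_in S (fun x => X (v x) + ell x).
Proof.
move=> lv cX Xmono cl x m Sx mx.
pose e := (X (v x) + ell x - m) / 2.
have e0 : 0 < e by rewrite divr_gt0// subr_gt0.
have /cvgrPdist_lt/(_ e e0)/near_le_ball[r r0 rP] := cX (v x).
have vr : v x - r < v x by rewrite ltrBlDr ltrDl.
have lv' := lv x _ Sx vr.
have /cvgrPdist_lt/(_ e e0) cl' := cl x.
near=> z => Sz.
have vz : v x - r < v z by move: Sz; near: z; exact: lv'.
have lz : `|ell x - ell z| < e by near: z; exact: cl'.
have := rP (v x - r); rewrite addrAC subrr add0r normrN gtr0_norm// => /(_ (lexx _)).
move: lz; rewrite !ltr_norml => /andP[_ l1] /andP[_ l2].
have := Xmono _ _ vz; rewrite /e in l1 l2; lra.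
Unshelve. all: by end_near. Qed.

Lemma lsc_in_shift v x1 : 0 <= x1 -> lsc_in `[0, +oo[ v ->
  lsc_in `[0, +oo[ (fun y => v (x1 + y)).
Proof.
move=> x10 lv x m; rewrite /= in_itv/= andbT => x0 mv.
have Sx : `[0, +oo[%classic (x1 + x) by rewrite /= in_itv/= andbT addr_ge0.
have := lv _ _ Sx mv; move=> /near_le_ball[r r0 rP].
apply: (ball_le_near r0) => z zx; rewrite /= in_itv/= andbT => z0.
apply: rP; last by rewrite /= in_itv/= andbT addr_ge0.
by rewrite opprD addrACA subrr add0r.
Qed.
End viscosity.

Section travel_time.
Context {R : realType}.
Implicit Types x y z r A : R.
Variables (f F : R -> R).
Hypotheses (cf : continuous f) (dF : forall x : R, is_derive x 1 F (f x)).
Variables (E eta B : R).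
Hypothesis eta_gt0 : 0 < eta.
Hypothesis B_ge0 : 0 <= B.
Let Q r := E + eta * r - F r.
Hypothesis Q_gt0 : forall r, 0 <= r <= B -> 0 < Q r.

Let dQ (r : R) : is_derive r 1 Q (eta - f r).
Proof.
apply: is_derive_sub => //.
have -> : (fun r => E + eta * r) = (fun r => eta * r + E).
  by apply/funext => y; rewrite addrC.
exact: is_derive_affine.
Qed.

Let cQ : continuous Q. Proof. by move=> r; exact: is_derive_continuous (dQ r). Qed.

(** Travel-time functions: along a solution of [w' = sqrt (2 * Q w)], the value
    [X w] grows at unit speed.  Since [w'' = Q' w], such a [w] is a strict
    stationary subsolution as soon as [Q' + f > 0], which is what the choice
    [Q r = E + eta * r - F r] achieves.  Working with [X] instead of [w] avoids
    solving the differential equation: a touching point of a translate of [w] is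
    a minimum of [X (v x) + x] or [X (v x) - x], and the last clause provides a
    parabola, still a strict subsolution, below that translate. *)
Lemma travel_time : exists X : R -> R,
  [/\ continuous X, {homo X : x y / x < y},
      forall A, 0 <= A <= B -> is_derive A 1 X (Num.sqrt (2 * (E + eta * A - F A)))^-1
    & forall A, 0 <= A <= B -> \forall y \near 0,
        X (A - Num.sqrt (2 * (E + eta * A - F A)) * y + (eta / 2 - f A) * y ^+ 2 / 2)
        <= X A - y].
Proof.
have [rm rmI rmP] := EVT_min B_ge0 (continuous_subspaceT cQ).
(* Truncating Q at q0 makes the integrand positive and continuous on the whole
   line without changing it near the heights in [0, B]. *)
pose q0 := Q rm / 2.
have Qrm : 0 < Q rm by apply: Q_gt0; move: rmI; rewrite in_itv.
have q00 : 0 < q0 by rewrite divr_gt0.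
have q0Q r : 0 <= r <= B -> q0 < Q r.
  move=> rI; apply: lt_le_trans (_ : Q rm <= _); first by rewrite /q0; lra.
  by apply: rmP; rewrite in_itv.
pose g r := (Num.sqrt (2 * Num.max (Q r) q0))^-1.
have mq r : 0 < Num.max (Q r) q0 by rewrite lt_max q00 orbT.
have g0 r : 0 < g r by rewrite invr_gt0 sqrtr_gt0 mulr_gt0.
have cg : continuous g.
  move=> r; apply: cvgV; first by rewrite gt_eqF// sqrtr_gt0 mulr_gt0.
  apply: (@continuous_comp _ _ _ (fun r => 2 * Num.max (Q r) q0) Num.sqrt); last exact: sqrt_continuous.
  apply: cvgM; first exact: cvg_cst.
  by apply: continuous_max; [exact: cQ|exact: cvg_cst].
have [X dX] := continuous_primitive cg.
have cX : continuous X by move=> r; exact: is_derive_continuous (dX r).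
have Xlt : {homo X : x y / x < y}.
  move=> x y xy; have [|z _ Ez] := @MVT _ X g x y xy (fun z _ => dX z).
    exact: continuous_subspaceT.
  by rewrite -subr_gt0 Ez mulr_gt0// subr_gt0.
have gE r : q0 < Q r -> g r = (Num.sqrt (2 * Q r))^-1.
  by move=> /ltW qr; rewrite /g max_l.
exists X; split => //.
  by move=> A AI; have := dX A; rewrite gE// q0Q.
move=> A AI; rewrite -/(Q A).
set h := Num.sqrt (2 * Q A); set C := eta / 2 - f A.
have QA : 0 < Q A by exact: Q_gt0.
have h0 : 0 < h by rewrite sqrtr_gt0 mulr_gt0.
have h2 : h ^+ 2 = 2 * Q A by rewrite sqr_sqrtr// mulr_ge0// ltW.
pose q (y : R) := A + (- h) * y + C * y ^+ 2 / 2.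
have dq (y : R) : is_derive y 1 q (- h + C * y) by exact: is_derive_quad.
have q00' : q 0 = A by rewrite /q mulr0 expr0n/= mulr0 mul0r !addr0.
(* D compares the squared slopes of the parabola and of the trajectory at the
   common height q y. *)
pose D y := (h - C * y) * (h - C * y) - 2 * Q (q y).
have D0 : D 0 = 0 by rewrite /D q00' mulr0 subr0 -expr2 h2 subrr.
have dD : is_derive (0 : R) 1 D (h * eta).
  have dl : is_derive (0 : R) 1 (fun y => h - C * y) (- C).
    have -> : (fun y => h - C * y) = (fun y => (- C) * y + h).
      by apply/funext => y; rewrite mulNr addrC.
    exact: is_derive_affine.
  have dQq : is_derive (q 0) 1 Q (eta - f A) by rewrite -[X in f X]q00'; exact: dQ.
  have := is_derive_sub (is_derive_mul dl dl) (is_derive_mulC 2 (is_derive1_comp dQq (dq 0))).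
  by move/is_derive_eq; apply; rewrite mulr0 /C; field.
have heta : 0 < h * eta by rewrite mulr_gt0.
have Dsign := is_derive_near_ge dD heta.
have qpos : \forall y \near 0, q0 < Q (q y).
  have : {for 0, continuous (Q \o q)}.
    apply: continuous_comp; last exact: cQ.
    exact: is_derive_continuous (dq 0).
  move=> /cvgrPdist_lt; rewrite /= q00' => /(_ (Q A - q0)).
  rewrite subr_gt0 => /(_ (q0Q _ AI)); apply: filterS => y.
  by rewrite ltr_norml => /andP[_]; lra.
have lpos : \forall y \near 0, 0 < h - C * y.
  have : {for 0, continuous (fun y => h - C * y)}.
    by move=> ?; apply: cvgB; [exact: cvg_cst|apply: cvgM; [exact: cvg_cst|exact: cvg_id]].
  move=> /cvgrPdist_lt/(_ h h0); rewrite mulr0 subr0; apply: filterS => y.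
  by rewrite ltr_norml => /andP[_]; lra.
have all_near : \forall y \near (0 : R), forall z, `|z| <= `|y| ->
    [/\ 0 <= z -> 0 <= D z, z <= 0 -> D z <= 0, q0 < Q (q z) & 0 < h - C * z].
  apply: near_dist_shrink; apply: filterS3 Dsign qpos lpos => z.
  by rewrite D0 !mul0r !add0r => -[? ?] ? ?.
apply: filterS all_near => y small.
have -> : A - h * y + C * y ^+ 2 / 2 = q y by rewrite /q mulNr.
pose k (z : R) := X (q z) + z.
have dk (z : R) : is_derive z 1 k (g (q z) * (- h + C * z) + 1).
  exact: is_derive_add (is_derive1_comp (dX _) (dq z)) (is_derive_id z 1).
have k0 : k 0 = X A by rewrite /k q00' addr0.
have gz z : `|z| <= `|y| -> g (q z) * (- h + C * z) + 1 =
    1 - (h - C * z) / Num.sqrt (2 * Q (q z)).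
  by move=> /small[_ _ /gE -> _]; rewrite mulrC; ring.
have sq0 z : `|z| <= `|y| -> 0 < Num.sqrt (2 * Q (q z)).
  by move=> /small[_ _ H _]; rewrite sqrtr_gt0 mulr_gt0// (lt_trans q00).
suff : k y <= k 0 by rewrite k0 /k; lra.
have [y0|/ltW y0] := leP 0 y.
  have := @MVT_le _ (fun z => - k z) (fun z => - (g (q z) * (- h + C * z) + 1)) 0 y 0 y0.
  rewrite mul0r => H; suff : 0 <= - k y - - k 0 by lra.
  apply: H => z /andP[z0 zy].
  have zy' : `|z| <= `|y| by rewrite !ger0_norm.
  rewrite gz// opprB subr_ge0 ler_pdivlMr ?sq0// mul1r.
  have [/(_ z0) H1 _ _ H2] := small _ zy'.
  rewrite -(ger0_norm (ltW H2)) -sqrtr_sqr ler_wsqrtr// expr2 -subr_ge0.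
  exact: H1.
have := @MVT_le _ k (fun z => g (q z) * (- h + C * z) + 1) y 0 0 y0.
rewrite mul0r => H; suff : 0 <= k 0 - k y by lra.
apply: H => z /andP[yz z0] //.
have zy' : `|z| <= `|y| by rewrite !ler0_norm ?lerN2.
rewrite gz// subr_ge0 ler_pdivrMr ?sq0// mul1r.
have [_ /(_ z0) H1 _ H2] := small _ zy'.
rewrite -(ger0_norm (ltW H2)) -sqrtr_sqr ler_wsqrtr// expr2 -subr_le0.
exact: H1.
Qed.
End travel_time.

(** * Supersolutions on a ray *)

Section rays.
Context {R : realType}.
Variables (f : R -> R) (a : R) (phi : R -> R) (c : R).
Implicit Types (v : R -> R) (x y z r s k A : R).
Hypotheses (hf : bistable f a) (hphi : traveling_wave f a phi c).

Lemma ray_set x : `[0, +oo[%classic x <-> 0 <= x.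
Proof. by rewrite /= in_itv/= andbT. Qed.

Lemma moving_wave_continuous (th x s : R) :
  {for (x, s), continuous (fun p : R * R => phi (th * p.1 - p.2))}.
Proof.
apply: (@continuous_comp _ _ _ (fun p : R * R => th * p.1 - p.2) phi).
  apply: cvgB; last exact: cvg_snd.
  by apply: cvgM; [exact: cvg_cst|exact: cvg_fst].
exact: wave_continuous hphi _.
Qed.

(** The strictness margin leaves room for a curvature slightly smaller than the
    second derivative of the front. *)
Lemma moving_wave_touch (th s k x : R) : th * th = 1 ->
  0 < derive1 (derive1 phi) (th * x - s) + f (phi (th * x - s) - k) ->
  exists b C, [/\ 0 < C + f (phi (th * x - s) - k),
    C < derive1 (derive1 phi) (th * x - s) &
    \forall y \near 0, phi (th * x - s) - k + b * y + C * y ^+ 2 / 2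
                       <= phi (th * (x + y) - s) - k].
Proof.
move=> th1; set dd := derive1 (derive1 phi) _ => pos.
pose m := dd + f (phi (th * x - s) - k).
pose C := dd - m / 2.
exists (derive1 phi (th * x - s) * th), C; split.
- by rewrite /C /m; lra.
- by rewrite /C -/m; move: pos; rewrite -/m; lra.
pose g z := phi (th * z + - s) - k.
have dg (z : R) : is_derive z 1 g (derive1 phi (th * z + - s) * th).
  have := is_derive_sub (is_derive_comp_affine (wave_is_derive hphi (th * z + - s)))
    (is_derive_const z k).
  by rewrite subr0.
have ddg : is_derive x 1 (fun z => derive1 phi (th * z + - s) * th) dd.
  have : is_derive x 1 (fun z => th * derive1 phi (th * z + - s)) (th * (dd * th)).
    by apply: is_derive_mulC; apply: is_derive_comp_affine; exact: wave_is_derive2 hphi _.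
  rewrite mulrCA th1 mulr1; congr (is_derive _ _ _ _).
  by apply/funext => z; rewrite mulrC.
have Cdd : C < dd by rewrite /C -/m; move: pos; rewrite -/m; lra.
have gd : \forall z \near x, is_derive (z : R) 1 g (derive1 phi (th * z + - s) * th).
  exact: filterE dg.
exact: taylor2_ge gd ddg Cdd.
Qed.

(** Sliding method: since the ends stay strictly below [v], a first contact would
    take place at an interior point, where the front has a parabola below it that
    contradicts [super_at]. *)
Lemma wave_slide v l r (th k s0 s1 : R) : l <= r -> s0 <= s1 -> th * th = 1 ->
  (forall z, 0 < derive1 (derive1 phi) z + f (phi z - k)) ->
  lsc_in `[l, r] v -> (forall x, l < x < r -> super_at f v x) ->
  (forall x, l <= x <= r -> phi (th * x - s0) - k < v x) ->
  (forall s, s0 <= s <= s1 -> phi (th * l - s) - k < v l /\ phi (th * r - s) - k < v r) ->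
  forall x, l <= x <= r -> phi (th * x - s1) - k < v x.
Proof.
move=> lr s01 th1 strict lv sv init ends x xlr.
have segE z : `[l, r]%classic z <-> l <= z <= r by rewrite /= in_itv.
pose gap (j : unit) s z := v z - (phi (th * z - s) - k).
have s1I : s0 <= s1 <= s1 by rewrite s01 lexx.
rewrite -subr_gt0; change (0 < gap tt s1 x).
apply: (@first_touch _ unit (fun=> `[l, r]%classic) gap s0 s1 _ _ _ _ _ s1 tt x s1I) => //.
- by move=> ?; exact: segment_compact.
- move=> [] s z _ Sz gz.
  pose m := (v z + (phi (th * z - s) - k)) / 2.
  have mv : m < v z by move: gz; rewrite /gap /m; lra.
  have Wm : 0 < m + k - phi (th * z - s) by move: gz; rewrite /gap /m; lra.
  have /cvgrPdist_lt/(_ _ Wm) /= Wn := @moving_wave_continuous th z s.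
  have c1 : fst @ (z, s) --> z by exact: cvg_fst.
  have := c1 _ (lv z m Sz mv).
  apply: filterS2 Wn => -[z' s'] /= H1 H2 _ /H2 H3.
  by move: H1; rewrite ltr_norml /gap => /andP[H1 _]; lra.
- move=> [] s z _ Sz gz.
  have Wm : 0 < phi (th * z - s) - k - v z by move: gz; rewrite /gap; lra.
  have cs : {for s, continuous (fun s => phi (th * z - s))}.
    apply: (@continuous_comp _ _ _ (fun s => th * z - s) phi).
      by apply: cvgB; [exact: cvg_cst|exact: cvg_id].
    exact: wave_continuous hphi _.
  move/cvgrPdist_lt: cs => /(_ _ Wm) /=; apply: filterS => s'.
  by rewrite ltr_norml /gap => /andP[_ ?] _; lra.
- by move=> [] z /segE zI; rewrite subr_gt0; exact: init.
- move=> s [] z /andP[/ltW ss ss1] /segE zI gz nonneg _.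
  have /ends[el er] : s0 <= s <= s1 by rewrite ss.
  have zl : l < z.
    rewrite lt_neqAle; move: (zI) => /andP[-> _]; rewrite andbT; apply/eqP => E.
    by move: gz el; rewrite /gap -E; lra.
  have zr : z < r.
    rewrite lt_neqAle; move: (zI) => /andP[_ ->]; rewrite andbT; apply/eqP => E.
    by move: gz er; rewrite /gap E; lra.
  have vz : v z = phi (th * z - s) - k by move: gz; rewrite /gap; lra.
  have [b [C [Cpos _ touch]]] := moving_wave_touch th1 (strict (th * z - s)).
  have zlr : l < z < r by rewrite zl.
  have : C + f (v z) <= 0.
    apply: (sv z zlr b).
    apply: filterS2 touch (near0_in_interval zlr) => y H /segE/(nonneg tt); rewrite /gap vz; lra.
  by rewrite vz leNgt Cpos.
Qed.

(** A slightly lowered front invading the ray from its end point slides below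
    [v], because it stays below 1 at the end point and is negative far away. *)
Lemma ray_saturated v : ray_supersolution f v -> v 0 = 1 -> forall x, 0 <= x -> v x = 1.
Proof.
move=> [lv v01 sv] v0 x x0; apply/eqP; rewrite eq_le.
have /andP[_ ->] := v01 x x0; rewrite leNgt; apply/negP => vx.
have [k0 k00 strict] := wave_strict_subsolution hf hphi.
pose k := Num.min k0 ((1 - v x) / 2).
have kpos : 0 < k by rewrite lt_min k00 divr_gt0// subr_gt0.
have kx : k <= (1 - v x) / 2 by rewrite ge_min lexx orbT.
have kk0 : 0 < k <= k0 by rewrite kpos ge_min lexx.
have [Z1 H1] := wave_near_Ny hphi kpos.
have [Z2 H2] := wave_near_y hphi kpos.
pose s1 := Num.max (x - Z1) (- Z2).
pose r := Num.max x (Z2 + s1).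
have phi1 z : phi z < 1 by have [_ _ /(_ z)/andP[]] := hphi.
suff : phi (1 * x - s1) - k < v x.
  have : 1 - k < phi (1 * x - s1).
    by apply: H1; rewrite mul1r lerBlDr -lerBlDl le_max lexx.
  by move: kx; lra.
apply: (@wave_slide v 0 r 1 k (- Z2) s1).
- by rewrite le_max x0.
- by rewrite le_max lexx orbT.
- by rewrite mulr1.
- by move=> z; exact: strict.
- by apply: lsc_in_sub lv => z; rewrite ray_set /= in_itv/= => /andP[].
- by move=> z /andP[z0 _]; exact: sv.
- move=> z /andP[z0 _]; rewrite mul1r opprK.
  have := H2 (z + Z2); rewrite lerDr => /(_ z0).
  by have /andP[? _] := v01 z z0; lra.
- move=> s /andP[s0 s1s]; rewrite mulr0 sub0r v0; split; first by have := phi1 (- s); lra.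
  have r0 : 0 <= r by rewrite le_max x0.
  have : phi (1 * r - s) < k.
    apply: H2; rewrite mul1r lerBrDr (@le_trans _ _ (Z2 + s1))//; first by rewrite lerD2l.
    by rewrite le_max lexx orbT.
  by have /andP[? _] := v01 r r0; lra.
- by rewrite x0 le_max lexx.
Qed.

Definition tends_to_one v := forall e, 0 < e -> exists X, forall x, X <= x -> 1 - e < v x.

(** The front, slightly lowered, slides back from infinity, where [v] is close to
    1, until its height before lowering is [phi s0] at the end point. *)
Lemma ray_above_wave v s0 : ray_supersolution f v -> tends_to_one v ->
  phi s0 <= v 0 -> forall y, 0 <= y -> phi (s0 - y) <= v y.
Proof.
move=> [lv v01 sv] v1 v0 y y0; rewrite leNgt; apply/negP => vy.
have [k0 k00 strict] := wave_strict_subsolution hf hphi.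
pose k := Num.min k0 ((phi (s0 - y) - v y) / 2).
have kpos : 0 < k by rewrite lt_min k00 divr_gt0// subr_gt0.
have kx : k <= (phi (s0 - y) - v y) / 2 by rewrite ge_min lexx orbT.
have kk0 : 0 < k <= k0 by rewrite kpos ge_min lexx.
have [X HX] := v1 _ kpos.
have [Z2 H2] := wave_near_y hphi kpos.
pose r := Num.max y X.
have r0 : 0 <= r by rewrite le_max y0.
have phi1 z : phi z < 1 by have [_ _ /(_ z)/andP[]] := hphi.
pose t0 := - Num.max s0 (Z2 + r).
suff : phi (-1 * y - - s0) - k < v y.
  have -> : -1 * y - - s0 = s0 - y by ring.
  by move: kx vy; lra.
apply: (@wave_slide v 0 r (-1) k t0 (- s0)).
- exact: r0.
- by rewrite /t0 lerN2 le_max lexx.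
- by rewrite mulrNN mulr1.
- by move=> z; exact: strict.
- by apply: lsc_in_sub lv => z; rewrite ray_set /= in_itv/= => /andP[].
- by move=> z /andP[z0 _]; exact: sv.
- move=> z /andP[z0 zr]; rewrite /t0 mulN1r opprK.
  have := H2 (- z + Num.max s0 (Z2 + r)).
  have -> : Z2 <= - z + Num.max s0 (Z2 + r).
    have : Z2 + r <= Num.max s0 (Z2 + r) by rewrite le_max lexx orbT.
    by lra.
  by move=> /(_ isT); have /andP[? _] := v01 z z0; lra.
- move=> s /andP[_ ss]; rewrite mulr0 sub0r; split.
    have : phi (- s) <= phi s0 by apply: (wave_nincr hf hphi); rewrite lerNr.
    by lra.
  have := HX r; rewrite le_max lexx orbT => /(_ isT).
  by have := phi1 (-1 * r - s); lra.
- by rewrite y0 le_max lexx.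
Qed.

Variable F : R -> R.
Hypothesis hF : potential_primitive f F.

(** A trajectory leaving the height [A] with a slope steeper than [- p] would have
    positive energy, hence become negative further along the ray.  In terms of
    travel times: [X (v x) + x] cannot have a minimum smaller than [X A]. *)
Lemma ray_slope_ge v A p : ray_supersolution f v -> 0 <= A <= v 0 -> 0 < p ->
  - (2 * F A) < p ^+ 2 -> \forall y \near 0^'+, A - p * y <= v y.
Proof.
move=> [lv v01 sv] /andP[A0 Av] p0 Ap.
have A1 : A <= 1 by have /andP[_] := v01 0 (lexx 0); exact: le_trans.
pose P := Num.max 0 (F A) - F A.
have P2 : 2 * P < p ^+ 2.
  by rewrite /P maxEle; case: ifP => _; [have : 0 < p ^+ 2 by rewrite exprn_gt0|]; lra.
(* The slack is shared between E and eta * A, where A <= 1. *)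
pose eta := (p ^+ 2 / 2 - P) / 4.
have eta0 : 0 < eta by rewrite /eta; lra.
pose E := Num.max 0 (F A) + eta.
have Qpos r : 0 <= r <= A -> 0 < E + eta * r - F r.
  move=> /andP[r0 rA]; have := primitive_max hf hF r0 rA A1.
  have : 0 <= eta * r by rewrite mulr_ge0// ltW.
  by rewrite /E; lra.
have [X [cX Xlt dX Xtouch]] := travel_time hF.2 eta0 A0 Qpos.
have Xle x y : x <= y -> X x <= X y by rewrite le_eqVlt => /predU1P[->//|/Xlt/ltW].
have AA : 0 <= A <= A by rewrite A0 lexx.
set h := Num.sqrt (2 * (E + eta * A - F A)) in dX *.
pose rr := X 1 - X 0 + 1.
have rr0 : 0 < rr by have : X 0 <= X 1 by [exact: Xle]; rewrite /rr; lra.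
have v0x x : 0 <= x -> X 0 <= X (v x) <= X 1.
  by move=> x0; have /andP[? ?] := v01 x x0; rewrite !Xle.
have above x : 0 <= x -> X A <= X (v x) + x.
  have lg : lsc_in `[0, rr] (fun x => X (v x) + x).
    apply: lsc_in_comp_add => //; last by move=> ?; exact: cvg_id.
    by apply: lsc_in_sub lv => z; rewrite ray_set /= in_itv/= => /andP[].
  have ne : (`[0, rr] : set R) !=set0 by exists 0; rewrite /= in_itv/= lexx ltW.
  have [x0 x0I x0min] := lsc_in_min (@segment_compact _ _ _) ne lg.
  move: x0I; rewrite /= in_itv/= => /andP[x00 x0r].
  have [min_ok|bad] := leP (X A) (X (v x0) + x0).
    move=> xx0; have [xr|rx] := leP x rr.
      by apply: le_trans min_ok _; apply: x0min; rewrite /= in_itv/= xx0.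
    have := Xle _ _ A1; have /andP[+ _] := v0x x xx0.
    by move: rx; rewrite /rr; lra.
  exfalso.
  have BA : v x0 < A.
    by rewrite ltNge; apply/negP => /Xle; lra.
  have x0gt : 0 < x0.
    rewrite lt_neqAle x00 andbT; apply/eqP => E0.
    by move: BA; rewrite -E0 ltNge Av.
  have x0lt : x0 < rr.
    rewrite ltNge; apply/negP => rx; have := Xle _ _ A1.
    have /andP[+ _] := v0x x0 x00; move: rx bad; rewrite /rr; lra.
  have BI : 0 <= v x0 <= A by rewrite (ltW BA) andbT; have /andP[] := v01 x0 x00.
  have := sv x0 x0gt; rewrite /super_at.
  move=> /(_ (- Num.sqrt (2 * (E + eta * v x0 - F (v x0)))) (eta / 2 - f (v x0))).
  have touch := Xtouch _ BI.
  have x0int : 0 < x0 < rr by rewrite x0gt.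
  move=> H; have : eta / 2 - f (v x0) + f (v x0) <= 0.
    apply: H; apply: filterS2 touch (near0_in_interval x0int) => y t1 yI.
    have := x0min (x0 + y); rewrite /= in_itv/= yI => /(_ isT) t2.
    rewrite leNgt; apply/negP; rewrite mulNr => /Xlt; lra.
  by lra.
have QA : 0 < E + eta * A - F A by exact: Qpos.
have h0 : 0 < h by rewrite sqrtr_gt0 mulr_gt0.
have hp : h < p.
  rewrite -(ltr_pXn2r (n := 2))// ?nnegrE ?ltW// /h sqr_sqrtr ?mulr_ge0 ?(ltW QA)//.
  have : eta * A <= eta by rewrite ler_piMr// ltW.
  by rewrite /E; move: P2 eta0; rewrite /eta /P; lra.
have dk : is_derive (0 : R) 1 (fun y => X (- p * y + A)) (h^-1 * - p).
  by apply: is_derive_comp_affine; rewrite mulr0 add0r; exact: dX.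
have hlt : h^-1 * - p < - 1.
  by rewrite mulrN ltrN2 mulrC ltr_pdivlMr// mul1r.
have /near_le_ball[r r0 rP] := is_derive_near_le dk hlt.
apply: (right0_near r0) => y /andP[y0 yr].
have := rP y; rewrite subr0 gtr0_norm// => /(_ yr)[/(_ (ltW y0))].
rewrite mulr0 !add0r => H _.
have -> : A - p * y = - p * y + A by ring.
rewrite leNgt; apply/negP => /Xlt; have := above y (ltW y0); move: H; lra.
Qed.
End rays.

Section invaded_rays.
Context {R : realType}.
Variables (f : R -> R) (a : R) (phi : R -> R) (c : R).
Implicit Types (v : R -> R) (x y z r s k A : R).
Hypotheses (hf : bistable f a) (hphi : traveling_wave f a phi c).
Variable F : R -> R.
Hypothesis hF : potential_primitive f F.

Lemma near_top_level A q : A < 1 -> q ^+ 2 < 2 * (F 1 - F A) -> 0 < F 1 ->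
  exists M, [/\ A < M, a < M, M < 1, 0 < F M & q ^+ 2 < 2 * (F M - F A)].
Proof.
move=> A1 qF F1.
have a1 : a < 1 by have [/andP[]] := hf.
pose e := Num.min (F 1) (F 1 - F A - q ^+ 2 / 2).
have e0 : 0 < e by rewrite lt_min F1; lra.
have cF : {for 1, continuous F} by exact: is_derive_continuous (hF.2 1).
move/cvgrPdist_lt : cF => /(_ e e0)/near_le_ball[r r0 rP].
pose d := Num.min r (Num.min ((1 - A) / 2) ((1 - a) / 2)).
have d0 : 0 < d by rewrite !lt_min r0 !divr_gt0// subr_gt0.
have dA : d <= (1 - A) / 2 by rewrite /d !ge_min lexx orbT.
have da : d <= (1 - a) / 2 by rewrite /d !ge_min lexx !orbT.
have dr : d <= r by rewrite ge_min lexx.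
exists (1 - d).
have := rP (1 - d); rewrite addrAC subrr add0r normrN gtr0_norm// => /(_ dr).
rewrite ltr_norml lt_min => /andP[_ /andP[H1 H2]].
by split; lra.
Qed.

(** The points at height at most [M] form a closed set, by lower semicontinuity,
    which is bounded as [M < 1]. *)
Lemma last_low_point v M : lsc_in `[0, +oo[ v -> tends_to_one v -> v 0 <= M -> M < 1 ->
  exists x1, [/\ 0 <= x1, v x1 <= M & forall x, x1 < x -> M < v x].
Proof.
move=> lv v1 vM M1; pose Z := [set x | 0 <= x /\ v x <= M].
have M1' : 0 < 1 - M by rewrite subr_gt0.
have [X HX] := v1 _ M1'.
have hZ : has_sup Z.
  split; first by exists 0; split.
  exists X => x [x0 vx]; rewrite leNgt; apply/negP => /ltW /HX.
  by rewrite opprB addrCA subrr addr0; move: vx; lra.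
pose x1 := sup Z.
have x10 : 0 <= x1 by apply: (ub_le_sup hZ.2); split.
exists x1; split => //; last first.
  move=> x x1x; rewrite ltNge; apply/negP => vx.
  have : x <= x1 by apply: (ub_le_sup hZ.2); split => //; exact: le_trans (ltW x1x).
  by rewrite leNgt x1x.
rewrite leNgt; apply/negP => Mv.
have := lv x1 M; rewrite ray_set => /(_ x10 Mv)/near_le_ball[r r0 rP].
have [x [x0 vx] xr] := sup_adherent r0 hZ.
have xx1 : x <= x1 by exact: (ub_le_sup hZ.2).
have : M < v x.
  apply: rP; last by rewrite ray_set.
  by rewrite ler0_norm ?subr_le0// opprB lerBlDr -lerBlDl ltW.
by rewrite ltNge vx.
Qed.

Lemma ray_supersolution_shift v x1 : 0 <= x1 -> ray_supersolution f v ->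
  ray_supersolution f (fun y => v (x1 + y)).
Proof.
move=> x10 [lv v01 sv]; split; first exact: lsc_in_shift.
  by move=> y y0; apply: v01; exact: addr_ge0.
move=> y y0 b C H; apply: (sv (x1 + y) _ b); first exact: ltr_wpDl.
by apply: filterS H => z; rewrite addrA.
Qed.

(** Beyond [x1] the front through the height [v x1] stays below [v]. *)
Lemma right_slope_ge_wave v x1 s0 h : ray_supersolution f v -> tends_to_one v ->
  0 <= x1 -> v x1 = phi s0 -> h < - derive1 phi s0 ->
  \forall y \near 0^'+, v x1 + h * y <= v (x1 + y).
Proof.
move=> rv v1 x10 vx1 slope.
have v1s : tends_to_one (fun y => v (x1 + y)).
  move=> e e0; have [Y HY] := v1 e e0; exists Y => y Yy; apply: HY.
  by rewrite ler_wpDl.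
have s0v : phi s0 <= v (x1 + 0) by rewrite addr0 vx1.
have above := ray_above_wave hf hphi (ray_supersolution_shift x10 rv) v1s s0v.
have Nslope : derive1 phi s0 < - h by move: slope; lra.
have /near_le_ball[r r0 rP] := is_derive_near_le (wave_is_derive hphi s0) Nslope.
apply: (right0_near r0) => y /andP[y0 yr].
apply: le_trans (above y (ltW y0)).
have := rP (- y); rewrite subr0 normrN gtr0_norm// => /(_ yr)[_].
by rewrite oppr_le0 (ltW y0) => /(_ isT); rewrite mulrNN vx1.
Qed.

(** The bound is the slope at height [A] of the stationary solution that joins [A]
    to 1.  The barrier has top height [M] close to 1 and a small slope there.  Its
    contact with [v] can only be at the end point of the ray or at the last point
    where [v <= M]; in the latter case [v] continues with at least the slope of
    the front, or jumps above [M], which makes a convex corner. *)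
Lemma ray_slope_ge_invaded v A q : ray_supersolution f v -> tends_to_one v ->
  0 <= A <= v 0 -> A < 1 -> 0 <= q -> q ^+ 2 < 2 * (F 1 - F A) -> 0 < F 1 ->
  \forall y \near 0^'+, A + q * y <= v y.
Proof.
move=> rv v1 /andP[A0 Av] A1 q0 qF F1; have [lv v01 sv] := rv.
have [M [AM aM M1 FM qM]] := near_top_level A1 qF F1.
have below_M : \forall y \near 0^'+, A + q * y <= M.
  have q10 : 0 < q + 1 by rewrite ltr_wpDl.
  apply: (@right0_near _ _ ((M - A) / (q + 1))).
    by rewrite divr_gt0// subr_gt0.
  by move=> y /andP[y0]; rewrite ler_pdivlMr//; nra.
have [vM|Mv] := leP (v 0) M; last first.
  have := lv 0 M; rewrite ray_set => /(_ (lexx 0) Mv) H.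
  have H' : \forall y \near 0^'+, M < v y.
    have := H; move=> /near_le_ball[r r0 rP]; apply: (right0_near r0) => y /andP[y0 yr].
    by apply: rP; [rewrite subr0 gtr0_norm|rewrite ray_set ltW].
  by apply: filterS2 below_M H' => y H1 /ltW; exact: le_trans.
have [x1 [x10 vx1 after]] := last_low_point lv v1 vM M1.
have a0 : 0 < a by have [/andP[]] := hf.
have M0 : 0 < M by exact: lt_trans aM.
have [s0 s0M] : exists s0, phi s0 = M by apply: (wave_surjective hphi); rewrite M0.
pose sg := - derive1 phi s0.
have sg0 : 0 < sg by rewrite oppr_gt0; exact: wave_decreasing hf hphi s0.
(* With this eta, the slope of the barrier at its top is smaller than sg. *)
pose eta := sg ^+ 2 / 4.
have eta0 : 0 < eta by rewrite divr_gt0// exprn_gt0.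
have Qpos r : 0 <= r <= M -> 0 < F M + eta * r - F r.
  move=> /andP[]; rewrite le_eqVlt => /predU1P[<-|r0] rM.
    by rewrite mulr0 addr0 hF.1 subr0.
  have := primitive_max hf hF (ltW r0) rM (ltW M1).
  have er : 0 < eta * r by rewrite mulr_gt0.
  by rewrite (max_r (ltW FM)); lra.
have [Xt [cX Xlt dX Xtouch]] := travel_time hF.2 eta0 (ltW M0) Qpos.
have Xle x y : x <= y -> Xt x <= Xt y by rewrite le_eqVlt => /predU1P[->//|/Xlt/ltW].
have lg : lsc_in `[0, x1] (fun x => Xt (v x) + - x).
  apply: lsc_in_comp_add => //; last by move=> ?; exact: opp_continuous.
  by apply: lsc_in_sub lv => z; rewrite ray_set /= in_itv/= => /andP[].
have ne : (`[0, x1] : set R) !=set0 by exists 0; rewrite /= in_itv/= lexx.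
have [x0 x0I x0min] := lsc_in_min (@segment_compact _ _ _) ne lg.
have {}x0min x : 0 <= x <= x1 -> Xt (v x0) - x0 <= Xt (v x) - x.
  by move=> xI; apply: x0min; rewrite /= in_itv.
move: x0I; rewrite /= in_itv/= => /andP[x00 x01].
have AI : 0 <= A <= M by rewrite A0 ltW.
have [min_ok|bad] := leP (Xt A) (Xt (v x0) - x0).
  have := dX A AI; set h := Num.sqrt (2 * (F M + eta * A - F A)) => dXA.
  have h0 : 0 < h by rewrite sqrtr_gt0 mulr_gt0// Qpos.
  have qh : q < h.
    rewrite -(ltr_pXn2r (n := 2))// ?nnegrE ?(ltW h0)// /h sqr_sqrtr.
      have : 0 <= eta * A by rewrite mulr_ge0// ltW.
      by move: qM; lra.
    by rewrite mulr_ge0// ltW// Qpos.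
  have dk : is_derive (0 : R) 1 (fun y => Xt (q * y + A)) (h^-1 * q).
    by apply: is_derive_comp_affine; rewrite mulr0 add0r.
  have hlt : h^-1 * q < 1 by rewrite mulrC ltr_pdivrMr// mul1r.
  have /near_le_ball[r r0 rP] := is_derive_near_le dk hlt.
  have near_slope : \forall y \near 0^'+, Xt (A + q * y) <= Xt A + y.
    apply: (right0_near r0) => y /andP[y0 yr].
    have := rP y; rewrite subr0 gtr0_norm// => /(_ yr)[/(_ (ltW y0))].
    by rewrite mulr0 !add0r mul1r addrC.
  have pos : \forall y \near 0^'+, 0 < y :> R by exact: nbhs_right_gt.
  apply: filterS3 near_slope below_M pos => y H1 H2 y0.
  have [yx1|/after/ltW Mvy] := leP y x1; last exact: le_trans Mvy.
  rewrite leNgt; apply/negP => /Xlt.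
  have := x0min y; rewrite (ltW y0) yx1 => /(_ isT).
  by move: H1 min_ok; clear -hf hphi hF; lra.
exfalso.
have v0A : Xt A <= Xt (v 0) by exact: Xle.
have x0gt : 0 < x0.
  rewrite lt_neqAle x00 andbT; apply/eqP => E0.
  by move: bad; rewrite -E0 subr0 ltNge v0A.
have BM : v x0 <= M.
  rewrite leNgt; apply/negP => /Xlt.
  have := x0min x1; rewrite x10 lexx => /(_ isT).
  by have := Xle _ _ vx1; lra.
have BI : 0 <= v x0 <= M by rewrite BM andbT; have /andP[] := v01 x0 x00.
have := dX _ BI; have := Xtouch _ BI.
set h := Num.sqrt (2 * (F M + eta * v x0 - F (v x0))) => touch dXB.
have h0 : 0 < h by rewrite sqrtr_gt0 mulr_gt0// Qpos.
have [x0x1|x1x0] := ltP x0 x1.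
  have : eta / 2 - f (v x0) + f (v x0) <= 0.
    apply: (sv x0 x0gt h).
    have x0int : 0 < x0 < x1 by rewrite x0gt.
    have touchN : \forall y \near 0, Xt (v x0 + h * y + (eta / 2 - f (v x0)) * y ^+ 2 / 2)
        <= Xt (v x0) + y.
      have [r r0 rP] := near_le_ball touch.
      apply: (@ball_le_near _ _ 0 _ r0) => y; rewrite subr0 => yr.
      have := rP (- y); rewrite subr0 normrN => /(_ yr).
      by rewrite mulrN opprK sqrrN opprK.
    apply: filterS2 touchN (near0_in_interval x0int) => y t1 /x0min t2.
    by rewrite leNgt; apply/negP => /Xlt; move: t1 t2; clear -hf hphi hF; lra.
  by move: eta0; clear -hf hphi hF; lra.
have {x1x0} E1 : x0 = x1 by apply/eqP; rewrite eq_le x01.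
have left_slope hl : h < hl -> \forall y \near 0^'+, v x0 - hl * y <= v (x0 - y).
  move=> hhl.
  have dk : is_derive (0 : R) 1 (fun y => Xt (hl * y + v x0)) (h^-1 * hl).
    by apply: is_derive_comp_affine; rewrite mulr0 add0r.
  have hlt : 1 < h^-1 * hl by rewrite mulrC ltr_pdivlMr// mul1r.
  have /near_le_ball[r r0 rP] := is_derive_near_ge dk hlt.
  have mr : 0 < Num.min r x0 by rewrite lt_min r0.
  apply: (right0_near mr) => y /andP[y0]; rewrite le_min => /andP[yr yx0].
  have := rP (- y); rewrite subr0 normrN gtr0_norm// => /(_ yr)[_].
  rewrite oppr_le0 (ltW y0) => /(_ isT); rewrite mulr0 !add0r mul1r mulrN => H.
  have -> : v x0 - hl * y = - (hl * y) + v x0 by rewrite addrC.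
  have yI : 0 <= x0 - y <= x1.
    by rewrite subr_ge0 yx0/= (le_trans _ x01)// lerBlDr lerDl ltW.
  have t2 := x0min _ yI.
  by rewrite leNgt; apply/negP => /Xlt; move: H t2; clear -hf hphi hF; lra.
have [BltM|] := ltP (v x0) M; last first.
  move=> MB; have vM' : v x0 = M by apply/eqP; rewrite eq_le BM.
  have hsg : h < sg.
    rewrite -(ltr_pXn2r (n := 2))// ?nnegrE ?(ltW h0) ?(ltW sg0)// /h vM' sqr_sqrtr.
      have : eta * M <= eta by rewrite ler_piMr ?ltW.
      by move: eta0; rewrite /eta; clear -hf hphi hF; lra.
    by rewrite mulr_ge0// ltW// Qpos// lexx ltW.
  pose hl := (2 * h + sg) / 3; pose hr := (h + 2 * sg) / 3.
  apply: (@super_at_no_corner _ f v x0 hl hr); first exact: sv.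
  - by rewrite /hl /hr; move: hsg; clear -hf hphi hF; lra.
  - apply: (right_slope_ge_wave (s0 := s0)) => //; first by rewrite vM' s0M.
    by rewrite -/sg /hr; move: hsg; clear -hf hphi hF; lra.
  - by apply: left_slope; rewrite /hl; move: hsg; clear -hf hphi hF; lra.
apply: (@super_at_no_corner _ f v x0 (h + 1) (h + 2)); first exact: sv.
- by clear -hf hphi hF; lra.
- have h20 : 0 < h + 2 by move: h0; clear -hf hphi hF; lra.
  have r0 : 0 < (M - v x0) / (h + 2) by rewrite divr_gt0// subr_gt0.
  apply: (right0_near r0) => y /andP[y0]; rewrite ler_pdivlMr// => yM.
  have /after : x1 < x0 + y by rewrite E1 ltrDl.
  by move: yM; clear; nra.
- by apply: left_slope; clear -hf hphi hF; lra.
Qed.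
End invaded_rays.

(** * Resistor networks *)

Section network.
Context {R : realType} (V E : finType).
Variables (src dst : E -> V) (cond : E -> R).
Hypothesis cond_gt0 : forall e, 0 < cond e.
Let adj : rel V := fun v1 v2 => [exists e : E,
   (src e == v1) && (dst e == v2) || (src e == v2) && (dst e == v1)].
Hypothesis adj_connected : forall v w, connect adj v w.
Implicit Types (g b : V -> R).

Definition laplacian g v : R :=
  \sum_(e | src e == v) cond e * (g (dst e) - g (src e))
  + \sum_(e | dst e == v) cond e * (g (src e) - g (dst e)).

Lemma sum_by_endpoint (p : E -> V) (F : V -> E -> R) :
  \sum_v \sum_(e | p e == v) F v e = \sum_e F (p e) e.
Proof.
rewrite [RHS](partition_big p predT)//=; apply: eq_bigr => v _.
by apply: eq_bigr => e /eqP ->.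
Qed.

Lemma laplacian_energy g h : \sum_v h v * laplacian g v =
  - \sum_e cond e * (g (dst e) - g (src e)) * (h (dst e) - h (src e)).
Proof.
rewrite /laplacian -sumrN; under eq_bigr do rewrite mulrDr !mulr_sumr.
rewrite big_split/= !sum_by_endpoint -big_split/=.
by apply: eq_bigr => e _; ring.
Qed.

Lemma laplacian_sum g : \sum_v laplacian g v = 0.
Proof.
have := laplacian_energy g (fun=> 1).
under eq_bigr do rewrite mul1r; move=> ->.
by rewrite big1 ?oppr0// => e _; rewrite subrr mulr0.
Qed.

(** Along a path without repeated vertices every edge is used at most once. *)
Lemma potential_difference_path g p v : path adj v p -> uniq (v :: p) ->
  `|g v - g (last v p)| <=
  \sum_(e | (src e \in v :: p) && (dst e \in v :: p)) `|g (dst e) - g (src e)|.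
Proof.
elim: p v => [|w p IH] v /=; first by rewrite subrr normr0 sumr_ge0.
move=> /andP[/existsP[e0 e0P] pw] /andP[vp uwp].
apply: le_trans (ler_distD (g w) _ _) _.
have e0E : `|g v - g w| = `|g (dst e0) - g (src e0)|.
  by case/orP: e0P => /andP[/eqP<- /eqP<-] //; rewrite distrC.
have e0in : (src e0 \in [:: v, w & p]) && (dst e0 \in [:: v, w & p]).
  by case/orP: e0P => /andP[/eqP<- /eqP<-]; rewrite !inE !eqxx ?orbT.
rewrite (bigD1 e0)//= e0E lerD2l; apply: le_trans (IH w pw uwp) _.
rewrite big_mkcond [leRHS]big_mkcond /=; apply: ler_sum => e _.
case: ifP => [/andP[se de]|_]; last by case: ifP.
rewrite ifT//; apply/andP; split; first (apply/andP; split).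
- by rewrite inE se orbT.
- by rewrite inE de orbT.
- apply/eqP => E0; move: se de; rewrite E0 => se de.
  case/orP: e0P => /andP[/eqP s /eqP d]; move: vp.
    by rewrite -s se.
  by rewrite -d de.
Qed.

Lemma potential_difference g v w :
  `|g v - g w| <= \sum_e `|g (dst e) - g (src e)|.
Proof.
have /connectP[p pp ->] := adj_connected v w.
case/shortenP: pp => p' pp' up' _.
apply: le_trans (potential_difference_path _ pp' up') _.
rewrite big_mkcond/=; apply: ler_sum => e _; by case: ifP.
Qed.

Lemma laplacian_eq0 g : (forall v, laplacian g v = 0) -> forall v w, g v = g w.
Proof.
move=> Lg v w.
have E0 : \sum_e cond e * (g (dst e) - g (src e)) ^+ 2 = 0.
  have := laplacian_energy g g; under eq_bigr do rewrite Lg mulr0.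
  rewrite sumr_const mul0rn => /eqP; rewrite eq_sym oppr_eq0 => /eqP En.
  by apply: etrans En; apply: eq_bigr => e _; rewrite expr2 mulrA.
have : `|g v - g w| <= 0.
  apply: le_trans (potential_difference g v w) _.
  rewrite big1// => e _; apply/eqP; rewrite normr_eq0.
  have ge0 e' : true -> 0 <= cond e' * (g (dst e') - g (src e')) ^+ 2.
    by move=> _; rewrite mulr_ge0 ?sqr_ge0// ltW.
  have /(_ e isT)/eqP := psumr_eq0P ge0 E0.
  by rewrite mulf_eq0 gt_eqF//= sqrf_eq0.
by rewrite normr_le0 subr_eq0 => /eqP.
Qed.

(** The Laplacian is injective only modulo constants; adding the total mass of
    the unknown makes it injective, hence onto, and when the sources have total
    mass zero the unknown has total mass zero as well. *)
Lemma laplacian_solvable b : \sum_v b v = 0 -> exists g, forall v, laplacian g v = b v.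
Proof.
move=> b0; have [v0|noV] := pickP (@predT V); last first.
  by exists (fun=> 0) => v; have := noV v.
move=> _.
pose T (g : {ffun V -> R^o}) : {ffun V -> R^o} :=
  [ffun v => laplacian g v + \sum_w g w].
have Tlin : linear T.
  move=> k g h; apply/ffunP => v; rewrite !ffunE.
  have lapE : laplacian (k *: g + h) v = k * laplacian g v + laplacian h v.
    rewrite /laplacian mulrDr !mulr_sumr addrACA -!big_split/=.
    by congr (_ + _); apply: eq_bigr => e _; rewrite !ffunE /GRing.scale/=; ring.
  have sumE : \sum_w (k *: g + h) w = k * \sum_w g w + \sum_w h w.
    rewrite mulr_sumr -big_split/=.
    by apply: eq_bigr => w _; rewrite !ffunE.
  by rewrite lapE sumE /GRing.scale/=; ring.
pose TL := linfun (HB.pack T (GRing.isLinear.Build _ _ _ _ T Tlin) : {linear _ -> _}).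
have TLE (g : {ffun V -> R^o}) : TL g = T g by rewrite lfunE.
have V0 : (0 : R) < #|V|%:R by rewrite ltr0n; apply/card_gt0P; exists v0.
have mass (g : {ffun V -> R^o}) : \sum_v T g v = #|V|%:R * \sum_w g w.
  under eq_bigr do rewrite ffunE.
  by rewrite big_split/= laplacian_sum add0r sumr_const mulr_natl.
have ker : lker TL == 0%VS.
  apply/eqP/vspaceP => g; rewrite memv_ker memv0 TLE.
  apply/eqP/eqP => [Tg|->]; last first.
    apply/ffunP => v; rewrite !ffunE /laplacian !big1 ?addr0//.
    - by move=> w _; rewrite ffunE.
    - by move=> e _; rewrite !ffunE subrr mulr0.
    - by move=> e _; rewrite !ffunE subrr mulr0.
  have S0 : \sum_w g w = 0.
    have := mass g; rewrite Tg big1 => [/esym/eqP|v _]; last by rewrite ffunE.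
    by rewrite mulf_eq0 gt_eqF//= => /eqP.
  have Lg v : laplacian g v = 0.
    by have := congr1 (fun h : {ffun V -> R^o} => h v) Tg; rewrite !ffunE S0 addr0.
  have cst := laplacian_eq0 Lg.
  apply/ffunP => v; rewrite ffunE.
  have : \sum_w g w = #|V|%:R * g v.
    by under eq_bigr do rewrite (cst _ v); rewrite sumr_const mulr_natl.
  by rewrite S0 => /esym/eqP; rewrite mulf_eq0 gt_eqF//= => /eqP.
pose g := (TL^-1)%VF [ffun v => b v : R^o].
have Tg : T g = [ffun v => b v : R^o] by rewrite -TLE lker0_lfunVK.
exists g => v.
have S0 : \sum_w g w = 0.
  have := mass g; rewrite Tg; under eq_bigr do rewrite ffunE.
  by rewrite b0 => /esym/eqP; rewrite mulf_eq0 gt_eqF//= => /eqP.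
by have := congr1 (fun h : {ffun V -> R^o} => h v) Tg; rewrite !ffunE S0 addr0.
Qed.

(** Ohm's law: the oscillation is at most the total current times the total
    resistance, whatever the shape of the network.  The energy is at most
    oscillation times current, while Cauchy-Schwarz in the form
    [2 * |d| <= cond * d ^ 2 / B + B / cond] bounds the total variation, hence
    the oscillation, by energy and resistance. *)
Lemma potential_oscillation g B : 0 < B -> \sum_v `|laplacian g v| <= B ->
  forall v w, `|g v - g w| <= B * \sum_e (cond e)^-1.
Proof.
move=> B0 LB v w; set S := \sum_e `|g (dst e) - g (src e)|.
apply: le_trans (potential_difference g v w) _; rewrite -/S.
pose En := \sum_e cond e * (g (dst e) - g (src e)) ^+ 2.
have EnB : En <= S * B.
  have -> : En = - \sum_x (g x - g v) * laplacian g x.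
    rewrite laplacian_energy opprK; apply: eq_bigr => e _.
    by ring.
  rewrite -sumrN; apply: (@le_trans _ _ (\sum_x S * `|laplacian g x|)).
    apply: ler_sum => x _; apply: le_trans (ler_norm _) _.
    by rewrite normrN normrM ler_wpM2r// potential_difference.
  by rewrite -mulr_sumr ler_wpM2l// sumr_ge0.
have : 2 * S <= En / B + B * \sum_e (cond e)^-1.
  rewrite /S /En mulr_sumr mulr_suml mulr_sumr -big_split/=.
  apply: ler_sum => e _; set d := g (dst e) - g (src e).
  have c0 := cond_gt0 e.
  have -> : d ^+ 2 = `|d| ^+ 2 by rewrite real_normK// num_real.
  rewrite -subr_ge0.
  have -> : cond e * `|d| ^+ 2 / B + B / cond e - 2 * `|d| =
     (cond e / B) * (`|d| - B / cond e) ^+ 2.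
    by field; rewrite !gt_eqF.
  by rewrite mulr_ge0 ?sqr_ge0// divr_ge0// ltW.
have : En / B <= S by rewrite ler_pdivrMr.
by lra.
Qed.
End network.

(** * Lower limits for large times *)

Section lower_limit.
Context {R : realType}.
Variables (U : R -> R -> R) (S : set R).
Hypothesis U01 : forall t y, S y -> 0 <= U t y <= 1.
Implicit Types (x y z m t T r e : R).

Definition eventually_ge x m := exists T r,
  0 < r /\ forall t y, T <= t -> S y -> `|y - x| <= r -> m <= U t y.

(** The liminf of [U t y] as [t] tends to infinity and [y] tends to [x] within
    [S]. *)
Definition lower_limit x := sup [set m | eventually_ge x m].

Lemma lower_limit_has_sup x : S x -> has_sup [set m | eventually_ge x m].
Proof.
move=> Sx; split.
  exists 0; exists 0, 1; split=> // t y _ Sy _.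
  by have /andP[] := U01 t Sy.
exists 1 => m [T [r [r0 H]]]; apply: le_trans (H T x _ Sx _) _ => //.
  by rewrite subrr normr0 ltW.
by have /andP[] := U01 T Sx.
Qed.

Lemma lower_limit_ge x m : S x -> eventually_ge x m -> m <= lower_limit x.
Proof. by move=> Sx H; apply: (ub_le_sup (lower_limit_has_sup Sx).2). Qed.

Lemma lower_limit_gt x m : S x -> m < lower_limit x -> eventually_ge x m.
Proof.
move=> Sx mv; have e0 : 0 < lower_limit x - m by rewrite subr_gt0.
have [m' [T [r [r0 H]]] mm'] := sup_adherent e0 (lower_limit_has_sup Sx).
exists T, r; split=> // t y Tt Sy yx; apply: le_trans (H t y Tt Sy yx).
by move: mm'; rewrite opprB addrCA subrr addr0 => /ltW.
Qed.

Lemma lower_limit01 x : S x -> 0 <= lower_limit x <= 1.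
Proof.
move=> Sx; apply/andP; split.
  apply: lower_limit_ge => //; exists 0, 1; split=> // t y _ Sy _.
  by have /andP[] := U01 t Sy.
apply: ge_sup; first by case: (lower_limit_has_sup Sx).
move=> m [T [r [r0 H]]]; apply: le_trans (H T x _ Sx _) _ => //.
  by rewrite subrr normr0 ltW.
by have /andP[] := U01 T Sx.
Qed.

Lemma lower_limit_lsc : lsc_in S lower_limit.
Proof.
move=> x m Sx mv; pose m' := (m + lower_limit x) / 2.
have m'v : m' < lower_limit x by rewrite /m'; lra.
have [T [r [r0 H]]] := lower_limit_gt Sx m'v.
have r20 : 0 < r / 2 by rewrite divr_gt0.
apply: (ball_le_near r20) => z zx Sz; apply: (@lt_le_trans _ _ m').
  by rewrite /m'; lra.
apply: lower_limit_ge => //; exists T, (r / 2); split=> // t y Tt Sy yz.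
apply: H => //; rewrite (_ : y - x = (y - z) + (z - x)); last by ring.
by apply: le_trans (ler_normD _ _) _; lra.
Qed.

Lemma lower_limit_uniform (K : set R) (psi : R -> R) : compact K -> K `<=` S ->
  continuous psi -> (forall x, K x -> psi x < lower_limit x) ->
  \forall T \near +oo, forall t x, T <= t -> K x -> psi x < U t x.
Proof.
move=> /compact_near_coveringP /near_covering_withinP cK KS cpsi lt.
suff : \forall T \near +oo, K `<=` [set x | forall t, T <= t -> psi x < U t x].
  by apply: filterS => T H t x Tt /H; exact.
apply: (cK _ _ (fun T x => forall t, T <= t -> psi x < U t x)) => x Kx.
have Sx := KS x Kx; have ltx := lt x Kx.
pose m := (psi x + lower_limit x) / 2.
have mv : m < lower_limit x by rewrite /m; lra.
have mp : 0 < m - psi x by rewrite /m; lra.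
have [T [r [r0 H]]] := lower_limit_gt Sx mv.
have /cvgrPdist_lt/(_ _ mp) cp := cpsi x.
have nr : \forall z \near x, `|z - x| <= r by apply: (ball_le_near r0).
near=> z T' => Kz t T't.
have pz : psi z < m.
  have : `|psi x - psi z| < m - psi x by near: z; exact: cp.
  by rewrite ltr_norml => /andP[? _]; lra.
have zr : `|z - x| <= r by near: z; exact: nr.
have TT : T <= T' by near: T'; exact: nbhs_pinfty_ge (num_real _).
by apply: lt_le_trans pz (H _ _ _ _ zr); [exact: le_trans T't|exact: KS].
Unshelve. all: by end_near. Qed.
End lower_limit.

Definition jointly_continuous_on {R : realType} (S : set R) (U : R -> R -> R) :=
  forall t x e, S x -> 0 < e -> exists2 r, 0 < r & forall t' x', `|t' - t| <= r ->
    `|x' - x| <= r -> S x' -> `|U t' x' - U t x| < e.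

Section growth.
Context {R : realType} (J : finType).
Variables (U : J -> R -> R -> R) (S : J -> set R) (psi : J -> R -> R).
Implicit Types (x y z m t T r e k : R).
Hypothesis cU : forall j, jointly_continuous_on (S j) (U j).
Hypothesis cS : forall j, compact (S j).
Hypothesis cpsi : forall j, continuous (psi j).

(** The barrier rises from [psi - 2 * e] at speed [m].  The hypothesis excludes a
    first contact with [U], so that after time [3 * e / m] the barrier, still
    below [U], has reached [psi + e]. *)
Lemma barrier_growth T e m : 0 < e -> 0 < m ->
  (forall t j x, T <= t -> S j x -> psi j x - 2 * e < U j t x) ->
  (forall t k j x, T <= t -> `|k| <= 2 * e -> S j x -> U j t x = psi j x + k ->
     (forall j' x', S j' x' -> psi j' x' + k <= U j' t x') ->
     (\forall s \near t, s < t -> U j t x + m * (s - t) <= U j s x) -> False) ->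
  forall t j x, T + 3 * e / m <= t -> S j x -> psi j x + e < U j t x.
Proof.
move=> e0 m0 above notouch t j x Tt Sx.
pose T0 := t - 3 * e / m.
have em0 : 0 < 3 * e / m by rewrite divr_gt0// mulr_gt0.
have TT0 : T <= T0 by rewrite /T0; lra.
pose gap j s y := U j s y - (psi j y - 2 * e + m * (s - T0)).
suff : 0 < gap j t x.
  rewrite /gap /T0; have -> : m * (t - (t - 3 * e / m)) = 3 * e.
    by field; rewrite gt_eqF.
  by lra.
have tI : T0 <= t <= t by rewrite lexx /T0 lerBlDr lerDl ltW.
have lipg j' s s' y z : gap j' s' z - gap j' s y =
    U j' s' z - U j' s y - (psi j' z - psi j' y) - m * (s' - s).
  by rewrite /gap; ring.
apply: (@first_touch _ J S gap T0 t _ _ _ _ _ t j x tI Sx) => //.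
- move=> i s y _ Sy gy.
  have [d d0 d3] : exists2 d, 0 < d & gap i s y = 3 * d.
    by exists (gap i s y / 3); [rewrite divr_gt0|field].
  have [r r0 rP] := cU s Sy d0.
  have /cvgrPdist_lt/(_ _ d0)/near_le_ball[r1 r10 r1P] := @cpsi i y.
  have r20 : 0 < Num.min r r1 by rewrite lt_min r0.
  have r30 : 0 < Num.min r (d / m) by rewrite lt_min r0 divr_gt0.
  have ny : \forall z \near y, `|z - y| <= Num.min r r1 by apply: (ball_le_near r20).
  have ns : \forall z \near s, `|z - s| <= Num.min r (d / m) by apply: (ball_le_near r30).
  near=> z s' => _ Sz.
  have : `|z - y| <= Num.min r r1 by near: z; exact: ny.
  rewrite le_min => /andP[zr zr1].
  have : `|s' - s| <= Num.min r (d / m) by near: s'; exact: ns.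
  rewrite le_min ler_pdivlMr// => /andP[sr sm].
  have := rP s' z sr zr Sz; have := r1P z zr1.
  rewrite !ltr_norml => /andP[p1 p2] /andP[u1 u2].
  have : m * (s' - s) <= `|s' - s| * m.
    by rewrite mulrC ler_wpM2r ?(ltW m0)// ler_norm.
  by have := lipg i s s' y z; move: d3 p1 p2 u1 u2 sm; lra.
- move=> i s y _ Sy gy.
  have [d d0 d3] : exists2 d, 0 < d & gap i s y = - (2 * d).
    by exists (- gap i s y / 2); [rewrite divr_gt0// oppr_gt0|field].
  have [r r0 rP] := cU s Sy d0.
  have r30 : 0 < Num.min r (d / m) by rewrite lt_min r0 divr_gt0.
  apply: (ball_le_near r30) => s'; rewrite le_min ler_pdivlMr// => /andP[sr sm] _.
  have := rP s' y sr; rewrite subrr normr0 => /(_ (ltW r0) Sy).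
  rewrite ltr_norml => /andP[_ u2].
  have : m * (s - s') <= `|s' - s| * m.
    by rewrite mulrC ler_wpM2r ?(ltW m0)// distrC ler_norm.
  by have := lipg i s s' y y; move: d3 u2 sm; lra.
- move=> i y Sy; rewrite /gap subrr mulr0 addr0 subr_gt0; exact: above.
- move=> s i y /andP[T0s st] Sy gy nonneg before.
  pose k := m * (s - T0) - 2 * e.
  apply: (notouch s k i y) => //.
  + exact: le_trans (ltW T0s).
  + have ms : m * (s - T0) <= 3 * e.
      rewrite mulrC -ler_pdivlMr// /T0; lra.
    have : 0 <= m * (s - T0) by rewrite mulr_ge0 ?subr_ge0// ltW.
    by rewrite ler_norml /k => ?; apply/andP; split; lra.
  + by move: gy; rewrite /gap /k; lra.
  + by move=> j' y' /(nonneg j'); rewrite /gap /k; lra.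
  + have nT : \forall s' \near s, T0 < s' by exact: lt_nbhsr.
    apply: filterS nT => s' T0s' s's.
    have sI : T0 <= s' < s by rewrite (ltW T0s') s's.
    have /ltW := before s' i y sI Sy.
    by have := lipg i s s' y y; rewrite gy; lra.
Unshelve. all: by end_near. Qed.
End growth.

(** * Solutions at interior points and at vertices *)

Section one_sided_derivative.
Context {R : realType}.

(** By the mean value theorem the difference quotient inherits the limit of the
    derivative; this is why the limits defining [dnu_src] and [dnu_dst] exist for
    a solution. *)
Lemma right_difference_quotient (g dg : R -> R) (r l : R) : 0 < r ->
  (forall y : R, 0 < y < r -> is_derive y 1 g (dg y)) ->
  g y @[y --> 0^'+] --> g 0 -> dg y @[y --> 0^'+] --> l ->
  (g h - g 0) / h @[h --> 0^'+] --> l.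
Proof.
move=> r0 dgE g0 dgl; apply/cvgrPdist_le => e e0.
move/cvgrPdist_le : dgl => /(_ e e0)/near_right0[r1 r10 r1P].
have m0 : 0 < Num.min (r / 2) r1 by rewrite lt_min divr_gt0.
apply: (right0_near m0) => h /andP[h0]; rewrite le_min => /andP[hr hr1].
have hr' : h < r by lra.
have cont y : 0 < y < r -> {for y, continuous g}.
  by move=> /dgE; exact: is_derive_continuous.
have [||z zI E] := @MVT _ g dg 0 h h0.
- move=> y; rewrite in_itv/= => /andP[y0 yh]; apply: dgE.
  by rewrite y0 (lt_trans yh).
- apply/continuous_within_itvP => //; split => //.
  + move=> y; rewrite in_itv/= => /andP[y0 yh]; apply: cont.
    by rewrite y0 (lt_trans yh).
  + by apply: cvg_at_left_filter; apply: cont; rewrite h0.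
move: zI; rewrite in_itv/= => /andP[z0 zh].
rewrite E subr0 mulfK ?gt_eqF//; apply: r1P; rewrite z0/=.
by rewrite (le_trans (ltW zh)).
Qed.

Lemma right_quotient_ge (g : R -> R) (l q : R) :
  (g h - g 0) / h @[h --> 0^'+] --> l ->
  (\forall y \near 0^'+, g 0 + q * y <= g y) -> q <= l.
Proof.
move=> gl gq; apply: (cvgr_to_ge gl).
have pos : \forall y \near 0^'+, 0 < y :> R by exact: nbhs_right_gt.
apply: filterS2 gq pos => y H y0; rewrite ler_pdivlMr//; lra.
Qed.
End one_sided_derivative.

Section ends.
Context {R : realType}.
Variable G : metric_graph R.

(** An edge has two ends, so that a loop meets its vertex twice.  Coordinates along
    an end are distances to its vertex. *)
Definition bond_end : finType := (edge G + edge G + ray G)%type.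

Definition end_bond (j : bond_end) : bond G :=
  match j with inl (inl e) => inl e | inl (inr e) => inl e | inr k => inr k end.

Definition end_vertex (j : bond_end) : vertex G :=
  match j with inl (inl e) => esrc e | inl (inr e) => edst e | inr k => rsrc k end.

Definition end_coord (j : bond_end) (y : R) : R :=
  match j with inl (inr e) => (len e)%:num - y | _ => y end.

Definition end_thick (j : bond_end) : R :=
  match j with inl (inl e) => (ethick e)%:num | inl (inr e) => (ethick e)%:num
  | inr k => (rthick k)%:num end.

Definition end_dnu (j : bond_end) (w : bond G -> R -> R) : R :=
  match j with inl (inl e) => dnu_src (w (inl e))
  | inl (inr e) => dnu_dst (len e)%:num (w (inl e))
  | inr k => dnu_src (w (inr k)) end.

Definition end_len (j : bond_end) : R :=
  match j with inl (inl e) => (len e)%:num | inl (inr e) => (len e)%:num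
  | inr k => 1 end.

Lemma end_thick_gt0 j : 0 < end_thick j.
Proof. by case: j => [[e|e]|k] /=. Qed.

Lemma end_len_gt0 j : 0 < end_len j.
Proof. by case: j => [[e|e]|k] /=. Qed.

Lemma end_coord_interior j y : 0 < y < end_len j -> bond_interior (end_bond j) (end_coord j y).
Proof. by case: j => [[e|e]|k] /= /andP[y0 yL]; rewrite in_itv/=; apply/andP; split => //; lra. Qed.

Lemma end_coord_set j y : 0 <= y < end_len j -> bond_set (end_bond j) (end_coord j y).
Proof. by case: j => [[e|e]|k] /= /andP[y0 yL]; rewrite in_itv/=; apply/andP; split => //; lra. Qed.

Lemma end_coordB j y z : `|end_coord j y - end_coord j z| = `|y - z|.
Proof.
case: j => [[e|e]|k] //=; rewrite (_ : _ - _ - _ = - (y - z)) ?normrN//; ring.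
Qed.

Lemma end_coord_continuous j : continuous (end_coord j).
Proof.
case: j => [[e|e]|k] y; [exact: cvg_id| |exact: cvg_id].
by apply: cvgB; [exact: cvg_cst|exact: cvg_id].
Qed.

Lemma end_coordK j y : end_coord j (end_coord j y) = y.
Proof. by case: j => [[e|e]|k] //=; ring. Qed.

Lemma end_at_vertex j : at_vertex (end_vertex j) (end_bond j) (end_coord j 0).
Proof. by case: j => [[e|e]|k] /=; [left|right; rewrite subr0|]. Qed.

Lemma bond_interior_set (b : bond G) x : bond_interior b x -> bond_set b x.
Proof.
case: b => [e|k] /=; rewrite !in_itv/=; last by rewrite !andbT => /ltW.
by move=> /andP[/ltW -> /ltW ->].
Qed.

Lemma bond_interior_near (b : bond G) x : bond_interior b x ->
  \forall z \near x, bond_interior b z.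
Proof.
case: b => [e|k] /=; first exact: near_in_itvoo.
rewrite in_itv/= andbT => x0; apply: filterS (lt_nbhsr x0) => z /= z0.
by rewrite in_itv/= andbT.
Qed.

Lemma kirchhoffE v (w : bond G -> R -> R) :
  kirchhoff v w <-> \sum_(j : bond_end | end_vertex j == v) end_thick j * end_dnu j w = 0.
Proof. by rewrite /kirchhoff !big_sumType/=. Qed.
End ends.

Section pointwise.
Context {R : realType}.
Variables (f : R -> R) (G : metric_graph R) (u : R -> bond G -> R -> R).
Hypothesis hu : entire_solution f u.
Implicit Types (x y z m t T r e k : R).

Lemma solution_jointly_continuous b : jointly_continuous_on (bond_set b) (fun t => u t b).
Proof.
move=> t x e Sx e0; have [_ /(_ b) cu _ _ _] := hu.
move: cu => /subspace_continuousP/(_ (t, x) Sx) /=.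
move/cvgrPdist_lt => /(_ e e0); rewrite near_withinE.
move=> [[/= N1 N2] [/= /near_le_ball[r1 r10 H1] /near_le_ball[r2 r20 H2]] H].
exists (Num.min r1 r2); first by rewrite lt_min r10.
move=> t' x'; rewrite !le_min => /andP[t1 _] /andP[_ x2] Sx'.
rewrite distrC; apply: (H (t', x')) => //; split; [exact: H1|exact: H2].
Qed.

(** At the contact point, the parabola bounds the second space derivative from
    below by [C] and the past bounds the time derivative from above by [m]. *)
Lemma interior_touch t b x B C m : bond_interior b x ->
  (\forall y \near 0, u t b x + B * y + C * y ^+ 2 / 2 <= u t b (x + y)) ->
  (\forall s \near t, s < t -> u t b x + m * (s - t) <= u s b x) ->
  C + f (u t b x) <= m.
Proof.
move=> xI touch past; have [_ _ /(_ t b) sol _ _] := hu.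
have [dt dx ddx eq] := sol x xI.
have dut := derivable_is_derive1 dt.
have dm : derive1 (fun s => u s b x) t <= m.
  rewrite leNgt; apply/negP => lt.
  pose m' := (m + derive1 (fun s => u s b x) t) / 2.
  have [m1 m2] : m < m' /\ m' < derive1 (fun s => u s b x) t by rewrite /m'; split; lra.
  have n1 := is_derive_near_ge dut m2.
  have n2 := (near_shift0 _ _).1 past.
  have [r r0 rP] := near_le_ball (filterI n1 n2).
  have := rP (- r); rewrite subr0 normrN gtr0_norm// => /(_ (lexx _))[[_ /= H1] H2].
  have r0' : - r <= 0 by rewrite oppr_le0 ltW.
  have rt : t + - r < t by rewrite ltrBlDr ltrDl.
  have {}H1 := H1 r0'; have {}H2 := H2 rt.
  have : t + - r - t = - r by ring.
  by move=> E; rewrite E in H2; nra.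
have nd : \forall z \near x, is_derive (z : R) 1 (u t b) (derive1 (u t b) z).
  apply: filterS (bond_interior_near xI) => z /sol[_ dz _ _].
  exact: derivable_is_derive1.
have := touching_second_derivative nd (derivable_is_derive1 ddx) touch.
by move: dm; rewrite eq; lra.
Qed.

Lemma end_derivative_ge t (j : bond_end G) q :
  (\forall y \near 0^'+, u t (end_bond j) (end_coord j 0) + q * y
     <= u t (end_bond j) (end_coord j y)) -> q <= end_dnu j (u t).
Proof.
have [_ _ /(_ t) sol /(_ t) C1 _] := hu.
pose g y := u t (end_bond j) (end_coord j y).
have g0 : g y @[y --> 0^'+] --> g 0.
  apply/cvgrPdist_le => e e0.
  have S0 : bond_set (end_bond j) (end_coord j 0).
    by apply: end_coord_set; rewrite lexx end_len_gt0.
  have [r r0 rP] := solution_jointly_continuous t S0 e0.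
  have m0 : 0 < Num.min r (end_len j / 2) by rewrite lt_min r0 divr_gt0// end_len_gt0.
  apply: (right0_near m0) => y /andP[y0]; rewrite le_min => /andP[yr yL].
  rewrite distrC ltW//; apply: rP.
  - by rewrite subrr normr0 ltW.
  - by rewrite end_coordB subr0 gtr0_norm.
  - by apply: end_coord_set; rewrite ltW//=; have := end_len_gt0 j; lra.
have L0 := end_len_gt0 j.
have key (dg : R -> R) (l : R) : (forall y : R, 0 < y < end_len j -> is_derive y 1 g (dg y)) ->
    dg y @[y --> 0^'+] --> l -> end_dnu j (u t) = lim ((g h - g 0) / h @[h --> 0^'+]) ->
    (\forall y \near 0^'+, g 0 + q * y <= g y) -> q <= end_dnu j (u t).
  move=> dgE dgl -> gq; have ql := right_difference_quotient L0 dgE g0 dgl.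
  by rewrite (cvg_lim (@Rhausdorff R) ql); exact: right_quotient_ge ql gq.
case: j @g g0 L0 key => [[e|e]|k] /= g0 L0 key; have := C1; rewrite /C1_up_to_ends.
- move=> /(_ (inl e))[d _ c _]; apply: key c _ => // y yI.
  by apply: derivable_is_derive1; apply: d; rewrite /= in_itv.
- move=> /(_ (inl e))[d _ _ c].
  apply: (key (fun y => - derive1 (u t (inl e)) ((len e)%:num - y)) (- lim (derive1 (u t (inl e)) x @[x --> (len e)%:num^'-]))).
  + move=> y /andP[y0 yL].
    have dL : is_derive (-1 * y + (len e)%:num) 1 (u t (inl e)) (derive1 (u t (inl e)) (-1 * y + (len e)%:num)).
      apply: derivable_is_derive1; apply: d; rewrite /= in_itv/=.
      by apply/andP; split; lra.
    have := is_derive_comp_affine dL.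
    have -> : -1 * y + (len e)%:num = (len e)%:num - y by ring.
    rewrite mulrN1; congr (is_derive _ _ _ _).
    by apply/funext => z; rewrite mulN1r addrC.
  + apply: cvgN; apply/cvgrPdist_le => ep ep0.
    move/cvgrPdist_le : c => /(_ ep ep0); rewrite near_withinE => /near_le_ball[r r0 rP].
    apply: (right0_near r0) => y /andP[y0 yr]; apply: rP; last by rewrite ltrBlDr ltrDl.
    by rewrite addrAC subrr add0r normrN gtr0_norm.
  + by rewrite /dnu_dst /g0 subr0.
- move=> /(_ (inr k))[d _ c _]; apply: key c _ => // y /andP[y0 _].
  by apply: derivable_is_derive1; apply: d; rewrite /= in_itv/= y0.
Qed.

(** The inner derivatives at the vertex dominate the slopes [q], and the Kirchhoff
    condition says that their weighted sum vanishes. *)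
Lemma vertex_touch t (v : vertex G) (q : bond_end G -> R) :
  (forall j, end_vertex j = v -> \forall y \near 0^'+,
     u t (end_bond j) (end_coord j 0) + q j * y <= u t (end_bond j) (end_coord j y)) ->
  \sum_(j : bond_end G | end_vertex j == v) end_thick j * q j <= 0.
Proof.
move=> touch; have [_ _ _ _ /(_ t v)/kirchhoffE K] := hu.
rewrite -[leRHS]K; apply: ler_sum => j /eqP jv; rewrite ler_wpM2l//; first exact/ltW/end_thick_gt0.
by apply: end_derivative_ge; exact: touch.
Qed.
End pointwise.

(** * The lower limit is a stationary supersolution *)

Section low.
Context {R : realType}.
Variables (f : R -> R) (a : R) (G : metric_graph R) (u : R -> bond G -> R -> R).
Hypothesis hf : bistable f a.
Hypothesis hu : entire_solution f u.
Hypothesis u01 : forall t b x, bond_set b x -> 0 < u t b x < 1.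
Implicit Types (x y z m t T r e k : R).

(** Relaxing the limit in space as well as in time makes this function lower
    semicontinuous, so that minima over compact sets are attained. *)
Definition low (b : bond G) : R -> R := lower_limit (fun t => u t b) (bond_set b).

Lemma solution_bounds b t x : bond_set b x -> 0 <= u t b x <= 1.
Proof. by move=> /(u01 t)/andP[/ltW -> /ltW]. Qed.

Lemma low01 b x : bond_set b x -> 0 <= low b x <= 1.
Proof. by apply: lower_limit01; exact: solution_bounds. Qed.

Lemma low_lsc b : lsc_in (bond_set b) (low b).
Proof. by apply: lower_limit_lsc; exact: solution_bounds. Qed.

Lemma jointly_continuous_sub (S S' : set R) (U : R -> R -> R) : S' `<=` S ->
  jointly_continuous_on S U -> jointly_continuous_on S' U.
Proof.
move=> SS cU t x e /SS Sx e0; have [r r0 rP] := cU t x e Sx e0.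
by exists r => // t' x' ? ? /SS; exact: rP.
Qed.

Lemma quadratic_continuous (A B C : R) :
  continuous (fun y => A + B * y + C * y ^+ 2 / 2).
Proof. by move=> y; exact: is_derive_continuous (is_derive_quad A B C y). Qed.

(** A parabola contradicting [super_at], with a slightly smaller curvature, would
    be a barrier as in [barrier_growth]: the solution would end up strictly above
    its own lower limit. *)
Lemma low_super_at b x : bond_interior b x -> super_at f (low b) x.
Proof.
move=> xI B C touch; rewrite leNgt; apply/negP => pos.
set A := low b x in touch pos; pose d := C + f A.
have d0 : 0 < d by [].
have cf : {for A, continuous f} by exact: bistable_continuous hf _.
have d40 : 0 < d / 4 by rewrite divr_gt0.
move/cvgrPdist_le : cf => /(_ _ d40)/near_le_ball[e1 e10 e1P].
pose C' := C - d / 2.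
pose g y := A + B * y + C' * y ^+ 2 / 2.
have cg : continuous g by exact: quadratic_continuous.
have g0 : g 0 = A by rewrite /g mulr0 expr0n/= mulr0 mul0r !addr0.
have e120 : 0 < e1 / 2 by rewrite divr_gt0.
have /cvgrPdist_le/(_ _ e120) gnear := cg 0.
have inn := (near_shift0 _ _).1 (bond_interior_near xI).
have [r r0 rP] := near_le_ball (filterI touch (filterI gnear inn)).
pose K := `[x - r, x + r]%classic.
have KP z : K z <-> `|z - x| <= r.
  by rewrite /K /= in_itv/= ler_distl.
have Kint z : K z -> bond_interior b z.
  move=> /KP zr; have := rP (z - x); rewrite subr0 => /(_ zr)[_ [_ /=]].
  by rewrite addrC subrK.
have KS z : K z -> bond_set b z by move=> /Kint; exact: bond_interior_set.
pose psi z := g (z - x).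
have cpsi : continuous psi.
  move=> z; apply: (@continuous_comp _ _ _ (fun z => z - x) g); last exact: cg.
  by apply: cvgB; [exact: cvg_id|exact: cvg_cst].
have psiA z : K z -> `|psi z - A| <= e1 / 2.
  move=> /KP zr; have := rP (z - x); rewrite subr0 => /(_ zr)[_ [H _]].
  by rewrite /psi distrC -g0.
have psilow z : K z -> psi z + d / 4 * (z - x) ^+ 2 <= low b z.
  move=> /KP zr; have := rP (z - x); rewrite subr0 => /(_ zr)[/= H _].
  move: H; rewrite (addrC x) subrK; apply: le_trans.
  by rewrite /psi /g /C'; lra.
pose e := Num.min (e1 / 8) (d * r ^+ 2 / 32).
have e0 : 0 < e by rewrite lt_min !divr_gt0// mulr_gt0// exprn_gt0.
have [ee1 eer] : e <= e1 / 8 /\ e <= d * r ^+ 2 / 32 by rewrite !ge_min !lexx orbT.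
have cK : compact K by exact: segment_compact.
have evt1 : \forall T \near +oo, forall t z, T <= t -> K z -> psi z - 2 * e < u t b z.
  apply: (@lower_limit_uniform _ _ _ (@solution_bounds b) K (fun z => psi z - 2 * e)) => //.
    by move=> z; apply: cvgB; [exact: cpsi|exact: cvg_cst].
  move=> z Kz; apply: lt_le_trans (psilow z Kz).
  have : 0 <= d / 4 * (z - x) ^+ 2 by rewrite mulr_ge0 ?sqr_ge0// ltW.
  by lra.
pose bdry := [set z | K z /\ `|z - x| = r].
have bE : bdry = [set x - r] `|` [set x + r].
  apply/seteqP; split => z /=.
    move=> [_]; case: (lerP 0 (z - x)) => zx; [rewrite ger0_norm//|rewrite ltr0_norm//] => E.
      by right; rewrite -E; ring.
    by left; rewrite -E; ring.
  have nr : `|r| = r by rewrite gtr0_norm.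
  move=> [->|->]; split.
  - by apply/KP; rewrite addrAC subrr add0r normrN nr.
  - by rewrite addrAC subrr add0r normrN nr.
  - by apply/KP; rewrite addrAC subrr add0r nr.
  - by rewrite addrAC subrr add0r nr.
have evt2 : \forall T \near +oo, forall t z, T <= t -> bdry z -> psi z + 2 * e < u t b z.
  apply: (@lower_limit_uniform _ _ _ (@solution_bounds b) bdry (fun z => psi z + 2 * e)).
  - by rewrite bE; apply: compactU; exact: compact_set1.
  - by move=> z [/KS].
  - by move=> z; apply: cvgD; [exact: cpsi|exact: cvg_cst].
  - move=> z [Kz zr]; apply: lt_le_trans (psilow z Kz).
    have -> : (z - x) ^+ 2 = r ^+ 2 by rewrite -zr real_normK// num_real.
    have : 0 < d * r ^+ 2 by rewrite mulr_gt0// exprn_gt0.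
    by move: e0 eer; lra.
have [T [T1 T2]] := filter_ex (filterI evt1 evt2).
have d80 : 0 < d / 8 by rewrite divr_gt0.
have grow := @barrier_growth _ unit (fun=> fun t => u t b) (fun=> K) (fun=> psi)
  (fun=> jointly_continuous_sub KS (@solution_jointly_continuous _ _ _ _ hu b)) (fun=> cK)
  (fun=> cpsi) T e (d / 8) e0 d80 (fun t _ => T1 t).
have {grow} : forall t (j : unit) z, T + 3 * e / (d / 8) <= t -> K z -> psi z + e < u t b z.
  apply: grow => t k _ z Tt ke Kz uz above past.
  have zin : `|z - x| < r.
    rewrite lt_neqAle; move/KP: (Kz) => ->; rewrite andbT; apply/eqP => zr.
    have := T2 t z Tt (conj Kz zr); rewrite uz.
    by move: ke; rewrite ler_norml => /andP[_ ?]; lra.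
  have rz : 0 < r - `|z - x| by rewrite subr_gt0.
  have : C' + f (u t b z) <= d / 8.
    apply: (interior_touch hu (Kint z Kz) (B := B + C' * (z - x)) _ past).
    apply: (@ball_le_near _ _ 0 _ rz) => y; rewrite subr0 => yr.
    have Kzy : K (z + y).
      apply/KP; rewrite addrAC; apply: le_trans (ler_normD _ _) _; lra.
    apply: le_trans (above tt _ Kzy); rewrite uz /psi /g.
    by rewrite le_eqVlt; apply/orP; left; apply/eqP; field.
  have uA : `|u t b z - A| <= e1.
    rewrite uz (_ : _ - A = (psi z - A) + k); last by ring.
    have := psiA z Kz; have := ler_normD (psi z - A) k; lra.
  have := e1P _ uA; rewrite ler_norml => /andP[_].
  by rewrite /C' /d in d0 *; lra.
move=> grow.
have /cvgrPdist_le := cpsi x.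
have e20 : 0 < e / 2 by rewrite divr_gt0.
move=> /(_ _ e20)/near_le_ball[r1 r10 r1P].
have psix : psi x = A by rewrite /psi subrr g0.
have : A + e / 2 <= low b x.
  apply: lower_limit_ge; [exact: solution_bounds|exact: bond_interior_set|].
  exists (T + 3 * e / (d / 8)), (Num.min r r1); split; first by rewrite lt_min r0.
  move=> t y Tt _; rewrite le_min => /andP[yr yr1].
  have := grow t tt y Tt ((KP y).2 yr); have := r1P y yr1.
  by rewrite psix ler_norml => /andP[_]; lra.
by rewrite -/A; lra.
Qed.

Definition end_sign (j : bond_end G) : R := if j is inl (inr _) then -1 else 1.

Lemma end_coordD (j : bond_end G) x z : end_coord j (x + z) = end_coord j x + end_sign j * z.
Proof. by case: j => [[e|e]|k] /=; ring. Qed.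

Lemma end_sign2 (j : bond_end G) : end_sign j ^+ 2 = 1.
Proof. by case: j => [[e|e]|k] /=; rewrite ?sqrrN expr1n. Qed.

Lemma end_coord_ge0 (j : bond_end G) x : bond_set (end_bond j) x -> 0 <= end_coord j x.
Proof.
by case: j => [[e|e]|k] /=; rewrite in_itv/= => /andP[] //; rewrite subr_ge0.
Qed.

Lemma end_segment_compact (j : bond_end G) r : compact [set x | 0 <= end_coord j x <= r].
Proof.
case: j => [[e|e]|k] /=.
- have -> : [set x | 0 <= x <= r] = `[0, r]%classic.
    by apply/seteqP; split => x /=; rewrite in_itv.
  exact: segment_compact.
- have -> : [set x | 0 <= (len e)%:num - x <= r] = `[(len e)%:num - r, (len e)%:num]%classic.
    by apply/seteqP; split => x /=; rewrite in_itv/= => /andP[? ?]; apply/andP; split; lra.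
  exact: segment_compact.
- have -> : [set x | 0 <= x <= r] = `[0, r]%classic.
    by apply/seteqP; split => x /=; rewrite in_itv.
  exact: segment_compact.
Qed.

(** The Kirchhoff inequality of a supersolution.  If the total flux were positive,
    slopes slightly smaller than [q] would still have a positive total flux; with
    them and a curvature exceeding the bound of [f], the barrier could be touched
    neither at the vertex nor inside the bonds, and [barrier_growth] would raise
    the solution above its lower limit. *)
Lemma low_vertex (Q : vertex G) (A : R) (q : bond_end G -> R) :
  (forall j, end_vertex j = Q -> A <= low (end_bond j) (end_coord j 0) /\
     \forall y \near 0^'+, A + q j * y <= low (end_bond j) (end_coord j y)) ->
  (exists2 j, end_vertex j = Q & low (end_bond j) (end_coord j 0) = A) ->
  \sum_(j : bond_end G | end_vertex j == Q) end_thick j * q j <= 0.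
Proof.
move=> touch [j0 j0Q j0A]; rewrite leNgt; apply/negP; set Sg := \sum_(_ | _) _ => Sg0.
pose W := \sum_(j : bond_end G | end_vertex j == Q) end_thick j.
have W0 : 0 <= W by apply: sumr_ge0 => j _; exact/ltW/end_thick_gt0.
have W1 : 0 < W + 1 by lra.
pose ep := Sg / (2 * (W + 1)).
have ep0 : 0 < ep by rewrite divr_gt0// mulr_gt0.
pose q' (j : bond_end G) := q j - ep.
have Sg'0 : 0 < \sum_(j : bond_end G | end_vertex j == Q) end_thick j * q' j.
  under eq_bigr do rewrite /q' mulrBr.
  rewrite sumrB -/Sg -mulr_suml -/W subr_gt0 /ep.
  rewrite mulrA ltr_pdivrMr ?mulr_gt0//; nra.
have [L L0 LP] := bistable_bound hf.
pose La := L + 1.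
have La0 : 0 < La by rewrite /La; lra.
have [r r0 rP] : exists2 r, 0 < r & forall y, 0 < y <= r -> La * y <= ep /\
   forall j : bond_end G, end_vertex j = Q ->
     y < end_len j /\ A + q j * y <= low (end_bond j) (end_coord j y).
  apply: near_right0; apply: filterI.
    apply: (@right0_near _ _ (ep / La)); first by rewrite divr_gt0.
    by move=> y /andP[_]; rewrite ler_pdivlMr// mulrC.
  apply: (@filter_forall _ _ (fun j y => end_vertex j = Q -> y < end_len j /\
     A + q j * y <= low (end_bond j) (end_coord j y)) (at_right 0)) => j.
  have [jQ|jQ] := pselect (end_vertex j = Q); last by apply: filterE => y /jQ.
  have [_ t] := touch j jQ.
  have tl : \forall y \near 0^'+, y < end_len j by apply: nbhs_right_lt; exact: end_len_gt0.
  by apply: filterS2 t tl => y.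
have La_r : La * r <= ep by apply: (rP r _).1; rewrite r0 lexx.
pose S (j : bond_end G) : set R := if end_vertex j == Q then [set x | 0 <= end_coord j x <= r] else set0.
have SP j x : S j x -> end_vertex j = Q /\ 0 <= end_coord j x <= r.
  by rewrite /S; case: ifPn => // /eqP.
have rL j : end_vertex j = Q -> r < end_len j.
  have rI : 0 < r <= r by rewrite r0 lexx.
  by move=> jQ; have [_ /(_ j jQ)[]] := rP r rI.
have SS j x : S j x -> bond_set (end_bond j) x.
  move=> /SP[jQ /andP[x0 xr]]; rewrite -(end_coordK j x); apply: end_coord_set.
  by rewrite x0 (le_lt_trans xr)// rL.
pose psi (j : bond_end G) (x : R) := A + q' j * end_coord j x + La * (end_coord j x) ^+ 2 / 2.
have cpsi j : continuous (psi j).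
  move=> x; apply: (@continuous_comp _ _ _ (end_coord j) (fun y => A + q' j * y + La * y ^+ 2 / 2)).
    exact: end_coord_continuous.
  exact: quadratic_continuous.
have psilow j x : S j x -> psi j x + ep / 2 * end_coord j x <= low (end_bond j) x.
  move=> /SP[jQ /andP[]]; rewrite le_eqVlt => /predU1P[E _|x0 xr].
    have xE : end_coord j 0 = x by rewrite E end_coordK.
    have [+ _] := touch j jQ; rewrite xE /psi -E.
    by rewrite expr0n/= !mulr0 !mul0r !addr0.
  have yI : 0 < end_coord j x <= r by rewrite x0.
  have [Lay /(_ j jQ)[_]] := rP _ yI.
  rewrite end_coordK; apply: le_trans; rewrite /psi /q'.
  have : La * end_coord j x ^+ 2 <= ep * end_coord j x.
    by rewrite expr2 mulrA ler_wpM2r// ltW.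
  by lra.
pose e := ep * r / 16.
have e0 : 0 < e by rewrite divr_gt0// mulr_gt0.
have cS j : compact (S j).
  by rewrite /S; case: ifP => _; [exact: end_segment_compact|exact: compact0].
have evt1 : \forall T \near +oo, forall j, forall t z, T <= t -> S j z ->
    psi j z - 2 * e < u t (end_bond j) z.
  apply: (@filter_forall _ _ (fun j T => forall t z, T <= t -> S j z ->
    psi j z - 2 * e < u t (end_bond j) z) (pinfty_nbhs R)) => j.
  apply: (@lower_limit_uniform _ _ _ (@solution_bounds (end_bond j)) (S j) (fun z => psi j z - 2 * e)).
  - exact: cS.
  - exact: SS.
  - by move=> z; apply: cvgB; [exact: cpsi|exact: cvg_cst].
  - move=> z Sz; apply: lt_le_trans (psilow j z Sz).
    have [_ /andP[z0 _]] := SP j z Sz.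
    have : 0 <= ep / 2 * end_coord j z by rewrite mulr_ge0// ltW// divr_gt0.
    by lra.
have evt2 : \forall T \near +oo, forall j, forall t z, T <= t ->
    (end_vertex j = Q /\ z = end_coord j r) -> psi j z + 2 * e < u t (end_bond j) z.
  apply: (@filter_forall _ _ (fun j T => forall t z, T <= t ->
    (end_vertex j = Q /\ z = end_coord j r) ->
    psi j z + 2 * e < u t (end_bond j) z) (pinfty_nbhs R)) => j.
  have [jQ|jQ] := pselect (end_vertex j = Q); last by apply: filterE => T t z _ [/jQ].
  have Sr : S j (end_coord j r).
    by rewrite /S jQ eqxx /= end_coordK lexx ltW.
  have := @lower_limit_uniform _ _ _ (@solution_bounds (end_bond j)) [set end_coord j r]
    (fun z => psi j z + 2 * e).
  have h1 : [set end_coord j r] `<=` bond_set (end_bond j) by move=> z ->; exact: SS.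
  have h2 : continuous (fun z => psi j z + 2 * e).
    by move=> z; apply: cvgD; [exact: cpsi|exact: cvg_cst].
  move=> /(_ (@compact_set1 _ _) h1 h2) H.
  apply: filterS (H _) => [T HT t z Tt [_ zE]|z ->]; first exact: HT.
  apply: lt_le_trans (psilow j _ Sr); rewrite end_coordK.
  by have : 0 < ep * r by [rewrite mulr_gt0]; rewrite /e; lra.
have [T [T1 T2]] := filter_ex (filterI evt1 evt2).
have half0 : 0 < 1 / 2 :> R by lra.
have grow : forall t j z, T + 3 * e / (1 / 2) <= t -> S j z -> psi j z + e < u t (end_bond j) z.
  apply: (@barrier_growth _ _ (fun j => fun t => u t (end_bond j)) S psi _ cS cpsi T e (1 / 2)) => //.
  - move=> j; apply: (@jointly_continuous_sub (bond_set (end_bond j))) => [x|].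
      exact: SS.
    exact: (solution_jointly_continuous hu).
  - by move=> t j x Tt Sx; exact: T1.
  move=> t k j x Tt ke Sx ux above past.
  have [jQ /andP[x0 xr]] := SP j x Sx.
  have x_lt_r : end_coord j x < r.
    rewrite lt_neqAle xr andbT; apply/eqP => E.
    have /(T2 j t x Tt) : end_vertex j = Q /\ x = end_coord j r by rewrite -E end_coordK.
    by rewrite ux; move: ke; rewrite ler_norml => /andP[_ ?]; lra.
  move: x0; rewrite le_eqVlt => /predU1P[E|x0].
    suff : \sum_(j : bond_end G | end_vertex j == Q) end_thick j * q' j <= 0.
      by rewrite leNgt Sg'0.
    apply: (vertex_touch (t := t) hu) => i iQ.
    have xE : x = end_coord j 0 by rewrite E end_coordK.
    have same : u t (end_bond i) (end_coord i 0) = u t (end_bond j) x.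
      have [sv _ _ _ _] := hu; rewrite xE; apply: (sv t Q).
        by rewrite -iQ; exact: end_at_vertex.
      by rewrite -jQ; exact: end_at_vertex.
    apply: (right0_near r0) => y /andP[y0 yr].
    have Siy : S i (end_coord i y) by rewrite /S iQ eqxx /= end_coordK (ltW y0).
    apply: le_trans (above i _ Siy); rewrite same ux /psi -E end_coordK.
    have : 0 <= La * y ^+ 2 by rewrite mulr_ge0 ?sqr_ge0// ltW.
    by rewrite expr0n/= !mulr0 mul0r; lra.
  have xint : bond_interior (end_bond j) x.
    rewrite -(end_coordK j x); apply: end_coord_interior.
    by rewrite x0 (lt_trans x_lt_r)// rL.
  have : La + f (u t (end_bond j) x) <= 1 / 2.
    apply: (interior_touch hu xint (B := (q' j + La * end_coord j x) * end_sign j) _ past).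
    have m0 : 0 < Num.min (end_coord j x) (r - end_coord j x).
      by rewrite lt_min x0 subr_gt0.
    apply: (@ball_le_near _ _ 0 _ m0) => y; rewrite subr0 le_min => /andP[y1 y2].
    have ny : `|end_sign j * y| = `|y|.
      by case: j {above past Sx jQ xr x_lt_r x0 ux xint m0 y1 y2} => [[?|?]|?] /=; rewrite ?mul1r// mulN1r normrN.
    have Sxy : S j (x + y).
      rewrite /S jQ eqxx /= end_coordD; move: y1 y2; rewrite -ny !ler_norml.
      by move=> /andP[? ?] /andP[? ?]; apply/andP; split; lra.
    apply: le_trans (above j _ Sxy); rewrite ux /psi end_coordD.
    rewrite -subr_ge0 [leRHS](_ : _ = La * y ^+ 2 / 2 * (end_sign j ^+ 2 - 1)).
      by rewrite end_sign2 subrr mulr0.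
    by field.
  have := LP _ (solution_bounds t (SS j x Sx)); rewrite ler_norml => /andP[? _].
  by rewrite /La; lra.
have : A + e / 2 <= low (end_bond j0) (end_coord j0 0).
  have S0 : bond_set (end_bond j0) (end_coord j0 0).
    by apply: end_coord_set; rewrite lexx end_len_gt0.
  apply: lower_limit_ge; [exact: solution_bounds|exact: S0|].
  pose r1 := e / (2 * (`|q' j0| + 1)).
  have qq : 0 < `|q' j0| + 1 by rewrite ltr_wpDl.
  have r10 : 0 < r1 by rewrite divr_gt0// mulr_gt0.
  exists (T + 3 * e / (1 / 2)), (Num.min r r1); split; first by rewrite lt_min r0.
  move=> t x Tt Sx; rewrite -{1}(end_coordK j0 x) end_coordB subr0 le_min => /andP[xr xr1].
  have x0 := end_coord_ge0 Sx.
  rewrite ger0_norm// in xr xr1.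
  have Sj0 : S j0 x by rewrite /S j0Q eqxx /= x0.
  apply: ltW; apply: le_lt_trans (grow t j0 x Tt Sj0); rewrite /psi.
  have : 0 <= La * end_coord j0 x ^+ 2 by rewrite mulr_ge0 ?sqr_ge0// ltW.
  have : end_coord j0 x * (2 * (`|q' j0| + 1)) <= e by rewrite -ler_pdivlMr// mulr_gt0.
  have : - `|q' j0| <= q' j0 by rewrite lerNl -normrN ler_norm.
  by nra.
by rewrite j0A; lra.
Qed.
End low.

(** * The ray where the front comes from *)

Section invaded_ray.
Context {R : realType}.
Variables (f : R -> R) (a : R) (phi : R -> R) (c : R).
Variables (G : metric_graph R) (u : R -> bond G -> R -> R).
Hypotheses (hf : bistable f a) (hphi : traveling_wave f a phi c).
Implicit Types (x y z m t T r e k : R).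

Lemma low_ray_supersolution (i : ray G) : entire_solution f u ->
  (forall t b x, bond_set b x -> 0 < u t b x < 1) ->
  ray_supersolution f (low u (inr i)).
Proof.
move=> hu u01; split.
- exact: (@low_lsc _ _ _ u01 (inr i)).
- by move=> x x0; apply: (low01 u01); apply/ray_set.
- move=> x x0; apply: (low_super_at hf hu u01).
  by rewrite /= in_itv/= andbT.
Qed.

Lemma sup_ge0 (A : set R) : (forall x, A x -> 0 <= x) -> 0 <= sup A.
Proof.
move=> A0; have [[[x Ax] ub]|nsup] := pselect (has_sup A).
  by apply: le_trans (A0 x Ax) _; exact: ub_le_sup.
by rewrite sup_out.
Qed.

Lemma front_like_initial (i : ray G) e : front_like_solution f phi c i u -> 0 < e ->
  exists M, forall t x, t <= M -> 0 <= x -> phi (- x - c * t) - e <= u t (inr i) x.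
Proof.
move=> [_ u01 /cvgrPdist_lt lim] e0.
have [M [_ MP]] := lim e e0.
exists (M - 1) => t x tM x0.
have := MP t; rewrite /= => /(_ (le_lt_trans tM _)); rewrite ltrBlDr ltrDl ltr01 => /(_ isT).
set A := [set _ | x in _]; set B := [set _ | q in _]; rewrite sub0r normrN => AB.
have B0 : 0 <= sup B by apply: sup_ge0 => _ [q _ <-].
have Sx : bond_set (inr i : bond G) x by apply/ray_set.
have hA : has_ubound A.
  exists 1 => _ [y Sy <-]; have /andP[? ?] := u01 t (inr i) y Sy.
  have [_ _ /(_ (- y - c * t))/andP[? ?] _ _] := hphi.
  by rewrite ler_norml; apply/andP; split; lra.
have : `|u t (inr i) x - phi (- x - c * t)| <= sup A by apply: ub_le_sup => //; exists x.
move: AB; rewrite ltr_norml ler_norml => /andP[_ ?] /andP[? _]; lra.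
Qed.

(** The stationary subsolution [phi (s - x) - k] lies below the solution at a
    very negative time [t0], for [s = - c * t0], and stays below it for ever.  A
    small linear correction, growing exponentially in time, makes the barrier
    negative far away on the ray, so that only a compact part of it matters. *)
Lemma front_like_persistent (i : ray G) k : front_like_solution f phi c i u -> 0 < k ->
  (forall z, 0 < derive1 (derive1 phi) z + f (phi z - k)) -> k <= 1 ->
  exists t0 s, forall t x, t0 <= t -> 0 <= x -> phi (s - x) - k <= u t (inr i) x.
Proof.
move=> hfl k0 strict k1; have [hu u01 _] := hfl.
have c0 : 0 < c by have [] := hphi.
have phi01 z : 0 < phi z < 1 by have [_ _ H _ _] := hphi; exact: H.
have k20 : 0 < k / 2 by rewrite divr_gt0.
have [M MP] := front_like_initial hfl k20.
have [Z ZP] := wave_near_y hphi k0.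
pose t0 := Num.min M (- Z / c); pose s := - c * t0.
exists t0, s => t1 x1 t01 x10; rewrite leNgt; apply/negP => bad.
have sk : phi s < k.
  apply: ZP; rewrite /s mulNr lerNr mulrC -ler_pdivlMr//.
  by rewrite ge_min lexx orbT.
have init x : 0 <= x -> phi (s - x) - k / 2 <= u t0 (inr i) x.
  move=> x0; have := MP t0 x; rewrite ge_min lexx => /(_ isT x0).
  by have -> : - x - c * t0 = s - x by rewrite /s; ring.
have [L L0 lipL] := bistable_lipschitz hf.
(* The rate 2 * L exceeds the Lipschitz constant of f, so the correction
   preserves the subsolution property. *)
pose E t := expR (2 * L * t + - (2 * L * t0)).
have E0 t : 0 < E t by exact: expR_gt0.
have Emono t : t0 <= t -> 1 <= E t.
  move=> t0t; rewrite -[leLHS]expR0 ler_expR -mulrBr.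
  by rewrite !mulr_ge0 ?(ltW L0)// subr_ge0.
pose dlt := phi (s - x1) - k - u t1 (inr i) x1.
have dlt0 : 0 < dlt by rewrite subr_gt0.
pose ep := dlt / (2 * (x1 + 1) * E t1).
have den : 0 < 2 * (x1 + 1) * E t1 by rewrite !mulr_gt0//; lra.
have ep0 : 0 < ep by rewrite divr_gt0.
pose r := Num.max x1 ep^-1.
have r0 : 0 <= r by rewrite le_max x10.
pose W t x := phi (-1 * x - - s) - k - ep * x * E t.
pose gap (j : unit) t x := u t (inr i) x - W t x.
have cE : continuous E.
  move=> t; apply: (@continuous_comp _ _ _ (fun t => 2 * L * t + - (2 * L * t0)) expR).
    by apply: cvgD; [apply: cvgM; [exact: cvg_cst|exact: cvg_id]|exact: cvg_cst].
  exact: continuous_expR.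
have cW x t : {for (x, t), continuous (fun p : R * R => W p.2 p.1)}.
  apply: cvgB.
    apply: cvgB; last exact: cvg_cst.
    apply: (@continuous_comp _ _ _ (fun p : R * R => -1 * p.1 - - s) phi).
      apply: cvgB; last exact: cvg_cst.
      by apply: cvgM; [exact: cvg_cst|exact: cvg_fst].
    exact: wave_continuous hphi _.
  apply: cvgM; first by apply: cvgM; [exact: cvg_cst|exact: cvg_fst].
  apply: (@continuous_comp _ _ _ (fun p : R * R => p.2) E); first exact: cvg_snd.
  exact: cE.
have SP x : `[0, r]%classic x -> bond_set (inr i : bond G) x.
  by rewrite /= !in_itv/= andbT => /andP[].
have tI : t0 <= t1 <= t1 by rewrite t01 lexx.
have x1I : `[0, r]%classic x1 by rewrite /= in_itv/= x10 le_max lexx.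
suff : 0 < gap tt t1 x1.
  rewrite /gap /W; have -> : -1 * x1 - - s = s - x1 by ring.
  have : ep * x1 * E t1 <= dlt / 2.
    rewrite /ep; have -> : dlt / (2 * (x1 + 1) * E t1) * x1 * E t1 = dlt / 2 * (x1 / (x1 + 1)).
      field; have x11 : 0 < x1 + 1 by lra.
      by rewrite !gt_eqF.
    rewrite ler_piMr ?divr_ge0 ?(ltW dlt0)// ler_pdivrMr; lra.
  by rewrite /dlt; move: dlt0; rewrite /dlt; lra.
apply: (@first_touch _ unit (fun=> `[0, r]%classic) gap t0 t1 _ _ _ _ _ t1 tt x1 tI x1I).
- by move=> ?; exact: segment_compact.
- move=> [] t x _ Sx; set g := gap tt t x => g0.
  have g20 : 0 < g / 2 by rewrite divr_gt0.
  have [rr rr0 rrP] := solution_jointly_continuous hu t (SP x Sx) g20.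
  have /cvgrPdist_lt/(_ _ g20) Wn := cW x t.
  have near_r : \forall p \near (x, t), `|p.1 - x| <= rr /\ `|p.2 - t| <= rr.
    have nx : \forall z \near x, `|z - x| <= rr by apply: (ball_le_near rr0).
    have nt : \forall z \near t, `|z - t| <= rr by apply: (ball_le_near rr0).
    exists ([set z | `|z - x| <= rr], [set z | `|z - t| <= rr]) => //=.
  apply: filterS2 Wn near_r => -[x' t'] /= W1 [xr tr] _ Sx'.
  have := rrP t' x' tr xr (SP x' Sx').
  move: W1; rewrite !ltr_norml => /andP[w1 w2] /andP[u1 u2].
  have gE : g = u t (inr i) x - W t x by [].
  by rewrite /gap; lra.
- move=> [] t x _ Sx; set g := gap tt t x => g0.
  have g20 : 0 < - g / 2 by rewrite divr_gt0// oppr_gt0.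
  have [rr rr0 rrP] := solution_jointly_continuous hu t (SP x Sx) g20.
  have cWt : {for t, continuous (fun t => W t x)}.
    apply: cvgB; first exact: cvg_cst.
    by apply: cvgM; [exact: cvg_cst|exact: cE].
  have nt : \forall z \near t, `|z - t| <= rr by apply: (ball_le_near rr0).
  move/cvgrPdist_lt : cWt => /(_ _ g20) Wn.
  apply: filterS2 Wn nt => t' W1 tr _.
  have := rrP t' x tr; rewrite subrr normr0 => /(_ (ltW rr0) (SP x Sx)).
  move: W1; rewrite !ltr_norml => /andP[w1 w2] /andP[u1 u2].
  have gE : g = u t (inr i) x - W t x by [].
  by rewrite /gap; lra.
- move=> [] x /SP/ray_set x0; have := init x x0.
  rewrite /gap /W; have -> : -1 * x - - s = s - x by ring.
  have := mulr_ge0 (mulr_ge0 (ltW ep0) x0) (ltW (E0 t0)).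
  by lra.
move=> t [] x /andP[t0t tt1] Sx gx nonneg before.
have /andP[u0 u1] := u01 t _ _ (SP x Sx).
have [x0 xr] : 0 <= x /\ x <= r by move: Sx; rewrite /= in_itv/= => /andP[].
have phi1 := phi01 (-1 * x - - s).
have x_gt0 : 0 < x.
  rewrite lt_neqAle x0 andbT; apply/eqP => xE.
  move: gx u0; rewrite /gap /W -xE mulr0 sub0r opprK mulr0 mul0r; lra.
have x_ltr : x < r.
  rewrite lt_neqAle xr andbT; apply/eqP => xE.
  have : 1 <= ep * x * E t.
    rewrite xE (@le_trans _ _ (ep * r))//.
      rewrite -(mulfV (lt0r_neq0 ep0)) ler_wpM2l ?(ltW ep0)//.
      by rewrite le_max lexx orbT.
    by apply: ler_peMr; [exact: mulr_ge0 (ltW ep0) r0|exact: Emono (ltW t0t)].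
  by move: gx; rewrite /gap /W; move: phi1 => /andP[? ?]; lra.
pose zt := ep * x * E t.
have zt0 : 0 < zt := mulr_gt0 (mulr_gt0 ep0 x_gt0) (E0 t).
have th1 : (-1 : R) * -1 = 1 by rewrite mulrNN mulr1.
have [b [C [Cpos _ touch]]] := moving_wave_touch hphi th1 (strict (-1 * x - - s)).
have xint : bond_interior (inr i : bond G) x by rewrite /= in_itv/= x_gt0.
have ux : u t (inr i) x = W t x by move: gx; rewrite /gap; clear -hf hphi u; lra.
have : C + f (u t (inr i) x) <= - (L * zt).
  apply: (interior_touch hu xint (B := b - ep * E t)).
    have xI : 0 < x < r by rewrite x_gt0.
    apply: filterS2 touch (near0_in_interval xI) => y H yI.
    have := nonneg tt (x + y); rewrite /gap ux /W /= in_itv/= yI => /(_ isT).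
    by move: H; clear -hf hphi u; lra.
  have dE : is_derive t 1 (fun t => ep * x * E t) (ep * x * (E t * (2 * L))).
    apply: is_derive_mulC.
    exact: is_derive1_comp (is_derive_expR _) (is_derive_affine _ _ _).
  have slope : L * zt < ep * x * (E t * (2 * L)).
    have -> : ep * x * (E t * (2 * L)) = 2 * (L * zt) by rewrite /zt; ring.
    by have : 0 < L * zt by [rewrite mulr_gt0]; clear -hf hphi u; lra.
  have nslope : \forall t' \near t, t' <= t -> ep * x * E t' <= zt + L * zt * (t' - t).
    apply/near_shift0; apply: filterS (is_derive_near_ge dE slope) => y [_ H] ty.
    by rewrite addrAC subrr add0r; apply: H; move: ty; clear -hf hphi u; lra.
  have nt0 : \forall t' \near t, t0 < t' by exact: lt_nbhsr.
  apply: filterS2 nslope nt0 => t' H t0t' t't.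
  have tI' : t0 <= t' < t by rewrite t't ltW.
  have := before t' tt x tI' Sx; have := H (ltW t't).
  by rewrite /gap ux /W /zt; clear -hf hphi u; lra.
have := lipL (W t x) (phi (-1 * x - - s) - k).
have Wlow : -1 <= W t x by rewrite -ux; move: u0; clear -hf hphi u; lra.
have Wphi : W t x <= phi (-1 * x - - s) - k by rewrite /W -/zt; move: zt0; clear -hf hphi u; lra.
have phk1 : phi (-1 * x - - s) - k <= 1 by case/andP: phi1 => _; move: k0; clear -hf hphi u; lra.
move=> /(_ Wlow Wphi phk1); rewrite ler_norml => /andP[_].
have -> : phi (-1 * x - - s) - k - W t x = zt by rewrite /W /zt; ring.
by rewrite ux; lra.
Qed.

Lemma front_like_invades (i : ray G) : front_like_solution f phi c i u ->
  tends_to_one (low u (inr i)).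
Proof.
move=> hfl e e0; have [_ u01 _] := hfl.
have [k0 k00 strict] := wave_strict_subsolution hf hphi.
pose k := Num.min (Num.min k0 1) (e / 4).
have kpos : 0 < k by rewrite !lt_min k00 ltr01 divr_gt0.
have [kk0 k1 ke] : [/\ k <= k0, k <= 1 & k <= e / 4].
  by rewrite /k !ge_min !lexx !orbT.
have sk z : 0 < derive1 (derive1 phi) z + f (phi z - k) by apply: strict; rewrite kpos.
have [t0 [s H]] := front_like_persistent hfl kpos sk k1.
have [Z ZP] := wave_near_Ny hphi kpos.
exists (Num.max 1 (s - Z + 1)) => x; rewrite ge_max => /andP[x1 xZ].
apply: (@lt_le_trans _ _ (1 - 2 * k)); first by lra.
apply: lower_limit_ge.
- by move=> t y Sy; have /andP[/ltW -> /ltW] := u01 t _ _ Sy.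
- by apply/ray_set; lra.
exists t0, 1; split => // t y tt /ray_set y0; rewrite ler_norml => /andP[y1 y2].
apply: le_trans (H t y tt y0).
have : 1 - k < phi (s - y) by apply: ZP; lra.
by lra.
Qed.
End invaded_ray.

(** * Barriers on the bounded graph *)

Section core.
Context {R : realType}.
Variable G : metric_graph R.
Implicit Types (x y K : R) (q : ray G -> R) (g : vertex G -> R).

(** The points of the bounded graph within the whole graph: its edges and the
    origins of the rays. *)
Definition core (b : bond G) : set R :=
  match b with inl e => `[0, (len e)%:num] | inr _ => [set 0] end.

Lemma core_set b : core b `<=` bond_set b.
Proof.
by case: b => [e|k] x //= ->; rewrite in_itv/= lexx.
Qed.

Lemma core_compact b : compact (core b).
Proof. by case: b => [e|k]; [exact: segment_compact|exact: compact_set1]. Qed.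

Lemma core0 b : core b 0.
Proof. by case: b => [e|k] //=; rewrite in_itv/= lexx ltW. Qed.

Lemma core_end (j : bond_end G) : core (end_bond j) (end_coord j 0).
Proof.
by case: j => [[e|e]|k] //=; rewrite in_itv/= ?subr0 ?lexx ?ltW.
Qed.

Lemma coreP b x : core b x -> (exists2 e, b = inl e & 0 < x < (len e)%:num) \/
  exists j, end_bond j = b /\ end_coord j 0 = x.
Proof.
case: b => [e|k] /=; last by move=> ->; right; exists (inr k).
rewrite in_itv/= !le_eqVlt => /andP[/predU1P[<- _|x0]].
  by right; exists (inl (inl e)).
move=> /predU1P[->|xL]; last by left; exists e => //; rewrite x0.
by right; exists (inl (inr e)); rewrite /= subr0.
Qed.

Lemma core_min (h : bond G -> R -> R) (b1 : bond G) :
  (forall b, lsc_in (core b) (h b)) ->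
  exists b0 x0, core b0 x0 /\ forall b x, core b x -> h b0 x0 <= h b x.
Proof.
move=> lh.
have mb b : exists x0, core b x0 /\ forall x, core b x -> h b x0 <= h b x.
  have ne : core b !=set0 by exists 0; exact: core0.
  by have [x0 ? ?] := lsc_in_min (@core_compact b) ne (lh b); exists x0.
have [xm xmP] := choice mb.
have [b0 _ b0min] := @arg_minP _ _ _ b1 predT (fun b => h b (xm b)) isT.
exists b0, (xm b0); split; first exact: (xmP b0).1.
move=> b x cx; apply: le_trans (b0min b isT) _.
exact: (xmP b).2.
Qed.

Definition edge_slope K g (e : edge G) : R :=
  (g (edst e) - g (esrc e)) / (len e)%:num - K * (len e)%:num / 2.

(** The second derivative is the constant [K] on every edge: a [K] larger than
    the bound of [f] gives a strict subsolution at all heights. *)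
Definition core_fun K g (b : bond G) (x : R) : R :=
  match b with
  | inl e => g (esrc e) + edge_slope K g e * x + K * x ^+ 2 / 2
  | inr k => g (rsrc k)
  end.

Definition core_slope K g q (j : bond_end G) : R :=
  match j with
  | inl (inl e) => edge_slope K g e
  | inl (inr e) => - (edge_slope K g e + K * (len e)%:num)
  | inr k => q k
  end.

Lemma core_fun_end K g (j : bond_end G) :
  core_fun K g (end_bond j) (end_coord j 0) = g (end_vertex j).
Proof.
case: j => [[e|e]|k] //=.
  by rewrite mulr0 expr0n/= mulr0 mul0r !addr0.
by rewrite subr0 /edge_slope; field.
Qed.

Lemma core_fun_near_end K g q (j : bond_end G) y : if j is inr _ then True else
  core_fun K g (end_bond j) (end_coord j y) =
    g (end_vertex j) + core_slope K g q j * y + K * y ^+ 2 / 2.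
Proof. by case: j => [[e|e]|k] //=; rewrite /edge_slope; field. Qed.

Lemma core_fun_bounds K g m M b x : 0 <= K -> (forall v, m <= g v <= M) ->
  core b x -> m - K * total_length G ^+ 2 <= core_fun K g b x <= M.
Proof.
move=> K0 gmM; have KT : 0 <= K * total_length G ^+ 2.
  by rewrite mulr_ge0// sqr_ge0.
case: b => [e|k] /=; last by move=> _; have /andP[? ?] := gmM (rsrc k); apply/andP; split; lra.
rewrite in_itv/= => /andP[x0 xL]; set l := (len e)%:num in xL *.
have l0 : 0 < l by rewrite /l.
pose th := x / l.
have th0 : 0 <= th by rewrite divr_ge0// ltW.
have th1 : th <= 1 by rewrite ler_pdivrMr// mul1r.
have -> : g (esrc e) + edge_slope K g e * x + K * x ^+ 2 / 2 =
    (1 - th) * g (esrc e) + th * g (edst e) - K * l ^+ 2 / 2 * (th * (1 - th)).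
  by rewrite /edge_slope -/l /th; field; rewrite gt_eqF.
have lT : l <= total_length G.
  rewrite /total_length (bigD1 e)//= lerDl sumr_ge0 => // e' _; exact: ltW.
have l2T : K * l ^+ 2 <= K * total_length G ^+ 2.
  by rewrite ler_wpM2l// ler_pXn2r// nnegrE ltW// (lt_le_trans l0).
have Kl0 : 0 <= K * l ^+ 2 by rewrite mulr_ge0// sqr_ge0.
have tt0 : 0 <= th * (1 - th) by rewrite mulr_ge0// subr_ge0.
have tt1 : th * (1 - th) <= 1 by nra.
have /andP[m1 M1] := gmM (esrc e); have /andP[m2 M2] := gmM (edst e).
have h1 : 0 <= (1 - th) * (g (esrc e) - m) by rewrite mulr_ge0 ?subr_ge0.
have h2 : 0 <= th * (g (edst e) - m) by rewrite mulr_ge0 ?subr_ge0.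
have h3 : 0 <= (1 - th) * (M - g (esrc e)) by rewrite mulr_ge0 ?subr_ge0.
have h4 : 0 <= th * (M - g (edst e)) by rewrite mulr_ge0 ?subr_ge0.
have h5 : 0 <= K * l ^+ 2 * (th * (1 - th)) by rewrite mulr_ge0.
have h6 : K * l ^+ 2 * (th * (1 - th)) <= K * l ^+ 2 by rewrite ler_piMr.
by apply/andP; split; lra.
Qed.

Definition total_mass : R := \sum_(e : edge G) (ethick e)%:num * (len e)%:num.

Definition total_resistance : R := \sum_(e : edge G) (len e)%:num / (ethick e)%:num.

(** The discrete Laplace equation is solved with the fluxes prescribed by the rays
    and the surplus, diminished by what the curvature [K] consumes, spread evenly,
    so that every vertex gets a strictly positive flux. *)
Lemma core_potential K q : 0 <= K ->
  K * total_mass < \sum_(k : ray G) (rthick k)%:num * q k ->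
  exists g, (forall v, 0 < \sum_(j : bond_end G | end_vertex j == v)
                           end_thick j * core_slope K g q j) /\
    forall v w, `|g v - g w| <=
      2 * (\sum_(k : ray G) (rthick k)%:num * `|q k|) * total_resistance.
Proof.
move=> K0 surplus; set Sq := \sum_k _ in surplus.
have KT0 : 0 <= K * total_mass.
  by rewrite mulr_ge0// sumr_ge0// => e _; rewrite mulr_ge0.
set Sabs := \sum_(k : ray G) (rthick k)%:num * `|q k|.
have Sq_abs : Sq <= Sabs.
  by apply: ler_sum => k _; rewrite ler_wpM2l// ler_norm.
have [k0 _|noray] := pickP (@predT (ray G)); last first.
  by move: (le_lt_trans KT0 surplus); rewrite /Sq big1 ?ltxx// => k; have := noray k.
have V0 : 0 < #|vertex G|%:R :> R.
  by rewrite ltr0n; apply/card_gt0P; exists (rsrc k0).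
pose s := (Sq - K * total_mass) / #|vertex G|%:R.
have s0 : 0 < s by rewrite divr_gt0// subr_gt0.
pose half (e : edge G) := (ethick e)%:num * (K * (len e)%:num / 2).
have half0 e : 0 <= half e by rewrite mulr_ge0// divr_ge0// mulr_ge0.
pose rays v := \sum_(k : ray G | rsrc k == v) (rthick k)%:num * q k.
pose b v := s - rays v
  + (\sum_(e | esrc e == v) half e + \sum_(e | edst e == v) half e).
pose cond (e : edge G) := (ethick e)%:num / (len e)%:num.
have cond0 e : 0 < cond e by rewrite divr_gt0.
have halves : \sum_v (\sum_(e | esrc e == v) half e + \sum_(e | edst e == v) half e)
    = K * total_mass.
  rewrite big_split/= (sum_by_endpoint (@esrc _ G) (fun=> half)).
  rewrite (sum_by_endpoint (@edst _ G) (fun=> half)) -big_split/= mulr_sumr.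
  by apply: eq_bigr => e _; rewrite /half; field.
have sV : s *+ #|vertex G| = Sq - K * total_mass.
  by rewrite -mulr_natr /s divfK// gt_eqF.
have bsum : \sum_v b v = 0.
  rewrite big_split/= halves big_split/= sumr_const sV sumrN.
  rewrite (sum_by_endpoint (@rsrc _ G) (fun _ k => (rthick k)%:num * q k)) -/Sq; ring.
have [g gP] := laplacian_solvable cond0 (@graph_connected _ G) bsum.
exists g; split.
  move=> v; rewrite !big_sumType/=.
  have -> : \sum_(k : ray G | rsrc k == v) (rthick k)%:num * q k = rays v by [].
  have -> : \sum_(e : edge G | esrc e == v) (ethick e)%:num * edge_slope K g e
      = \sum_(e | esrc e == v) cond e * (g (edst e) - g (esrc e))
        - \sum_(e | esrc e == v) half e.
    rewrite -sumrB; apply: eq_bigr => e _.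
    by rewrite /edge_slope /cond /half; field.
  have -> : \sum_(e : edge G | edst e == v)
         (ethick e)%:num * - (edge_slope K g e + K * (len e)%:num)
      = \sum_(e | edst e == v) cond e * (g (esrc e) - g (edst e))
        - \sum_(e | edst e == v) half e.
    rewrite -sumrB; apply: eq_bigr => e _.
    by rewrite /edge_slope /cond /half; field.
  have := gP v; rewrite /laplacian /b; lra.
move=> v w.
have k0abs : 0 <= Sabs by apply: sumr_ge0 => k _; rewrite mulr_ge0.
have Sabs0 : 0 < 2 * Sabs.
  by rewrite mulr_gt0// (lt_le_trans _ Sq_abs)// (le_lt_trans KT0).
have -> : total_resistance = \sum_e (cond e)^-1.
  by apply: eq_bigr => e _; rewrite /cond invf_div.
apply: (potential_oscillation cond0 (@graph_connected _ G)) => //.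
under eq_bigr do rewrite gP.
apply: (@le_trans _ _ (\sum_v (s + \sum_(k : ray G | rsrc k == v) (rthick k)%:num * `|q k|
   + (\sum_(e | esrc e == v) half e + \sum_(e | edst e == v) half e)))).
  apply: ler_sum => x _; rewrite /b.
  apply: le_trans (ler_normD _ _) _; apply: lerD; last first.
    by rewrite ger0_norm// addr_ge0// sumr_ge0.
  apply: le_trans (ler_normB _ _) _; rewrite (gtr0_norm s0) lerD2l.
  apply: le_trans (ler_norm_sum _ _ _) _; apply: ler_sum => k _.
  by rewrite normrM gtr0_norm.
rewrite big_split/= halves big_split/= sumr_const sV.
rewrite (sum_by_endpoint (@rsrc _ G) (fun _ k => (rthick k)%:num * `|q k|)) -/Sabs.
by lra.
Qed.
End core.

Section core_barrier.
Context {R : realType}.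
Variables (f : R -> R) (a : R) (G : metric_graph R) (u : R -> bond G -> R -> R).
Hypothesis hf : bistable f a.
Hypothesis hu : entire_solution f u.
Hypothesis u01 : forall t b x, bond_set b x -> 0 < u t b x < 1.

Lemma low_lsc_core b : lsc_in (core b) (low u b).
Proof. by apply: lsc_in_sub (@core_set _ G b) _; exact: low_lsc. Qed.

(** The potential of [core_potential], raised until it touches the lower limit on
    the core, does so at a height within [omega] of the minimum [beta]; there it
    contradicts [low_super_at] or [low_vertex]. *)
Lemma core_flux_contradiction K (q : ray G -> R) beta omega b1 x1 :
  0 <= K ->
  K * total_mass G < \sum_(k : ray G) (rthick k)%:num * q k ->
  (forall b x, core b x -> beta <= low u b x) -> core b1 x1 -> low u b1 x1 = beta ->
  2 * (\sum_(k : ray G) (rthick k)%:num * `|q k|) * total_resistance G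
    + K * total_length G ^+ 2 <= omega ->
  (forall A, beta <= A <= beta + omega -> A <= 1 -> 0 < K + f A) ->
  (forall A k, beta <= A <= beta + omega -> A <= low u (inr k) 0 ->
    \forall y \near 0^'+, A + q k * y <= low u (inr k) y) ->
  False.
Proof.
move=> K0 surplus betaP cx1 lx1 om fpos slopes.
have [g [flux osc]] := core_potential K0 surplus.
pose h b x := low u b x + - core_fun K g b x.
have cfun b : continuous (core_fun K g b).
  by case: b => [e|k]; [exact: quadratic_continuous|move=> x; exact: cvg_cst].
have lh b : lsc_in (core b) (h b).
  apply: (@lsc_in_comp_add _ _ _ id (fun x => - core_fun K g b x)).
  - exact: low_lsc_core.
  - by move=> x; exact: cvg_id.
  - by [].
  - by move=> x; apply: cvgN; exact: cfun.
have [b0 [x0 [c0 hmin]]] := core_min b1 lh.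
set A := low u b0 x0 in hmin *.
have gbound v0 v : g v0 - 2 * (\sum_(k : ray G) (rthick k)%:num * `|q k|) * total_resistance G
    <= g v.
  by have := osc v0 v; rewrite ler_norml => /andP[_]; lra.
have A1 : A <= 1 by have /andP[] := low01 u01 (core_set c0).
have above b x : core b x -> A + (core_fun K g b x - core_fun K g b0 x0) <= low u b x.
  by move=> /hmin; rewrite /h -/A; lra.
have AI : beta <= A <= beta + omega.
  rewrite betaP//=; have := above _ _ cx1; rewrite lx1.
  suff : core_fun K g b0 x0 - core_fun K g b1 x1 <= omega by lra.
  have [vm _ vmP] := @arg_maxP _ _ _ (match b1 with inl e => esrc e | inr k => rsrc k end)
     predT g isT.
  set M := g vm in vmP; set osc0 := 2 * _ * _ in om osc gbound.
  have gmM v : M - osc0 <= g v <= M by rewrite gbound/=; exact: vmP.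
  have /andP[_ H1] := core_fun_bounds K0 gmM c0.
  have /andP[H2 _] := core_fun_bounds K0 gmM cx1.
  by lra.
case: (coreP c0) => [[e b0E xI]|[j0 [j0b j0x]]].
  have xint : bond_interior b0 x0 by rewrite b0E /= in_itv.
  have := low_super_at hf hu u01 xint; rewrite -/A.
  move=> /(_ (edge_slope K g e + K * x0) K) H.
  suff : K + f A <= 0 by rewrite leNgt fpos.
  apply: H; apply: filterS (near0_in_interval xI) => y yI.
  have cy : core b0 (x0 + y) by rewrite b0E /= in_itv.
  apply: le_trans (above _ _ cy); rewrite -/A -subr_ge0 b0E /=.
  by rewrite [leRHS](_ : _ = 0)//; field.
pose Q := end_vertex j0.
have G0 : core_fun K g b0 x0 = g Q by rewrite -j0b -j0x core_fun_end.
have := flux Q; rewrite ltNge => /negP; apply.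
apply: (low_vertex hf hu u01 (A := A) (q := core_slope K g q)); last by exists j0; rewrite // j0b j0x.
move=> j jQ.
have A_end : A <= low u (end_bond j) (end_coord j 0).
  by have := above _ _ (core_end j); rewrite core_fun_end jQ G0; lra.
split => //.
case: j jQ A_end => [j|k] jQ A_end; last exact: slopes.
pose jj : bond_end G := inl j.
have L0 : 0 < end_len jj by exact: end_len_gt0.
apply: (right0_near L0) => y /andP[y0 yL].
have cy : core (end_bond jj) (end_coord jj y).
  by move: yL; rewrite /jj; case: {jj L0 jQ A_end} j => [e|e] /= yL; rewrite in_itv/=; apply/andP; split; lra.
apply: le_trans (above _ _ cy).
have := core_fun_near_end K g q jj y; rewrite /= => E.
have {}E : core_fun K g (end_bond jj) (end_coord jj y) =
    g (end_vertex jj) + core_slope K g q jj * y + K * y ^+ 2 / 2 by [].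
rewrite E G0 (_ : end_vertex jj = Q)//.
have Ky : 0 <= K * y ^+ 2 / 2 by rewrite divr_ge0// mulr_ge0// sqr_ge0.
set sl := core_slope K g q jj.
by change (A + sl * y <= A + (g Q + sl * y + K * y ^+ 2 / 2 - g Q)); lra.
Qed.
End core_barrier.

(** * Invasion *)

Section flux_margin.
Context {R : realType}.

Lemma sum_one_against_many (T : finType) (i : T) (x y : R) :
  \sum_k (if k == i then x else y) = x + (#|T|%:R - 1) * y.
Proof.
rewrite (bigD1 i)//= eqxx; congr (_ + _).
rewrite (eq_bigr (fun=> y)) => [|k /negbTE -> //].
rewrite sumr_const cardC1 -[LHS]mulr_natl; congr (_ * _).
have T0 : (0 < #|T|)%N by apply/card_gt0P; exists i.
by rewrite -[in RHS](prednK T0) -addn1 natrD addrK.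
Qed.

(** The slopes [q] on the invaded ray and [p] on the [n] others satisfy
    [q ^ 2 - (n * p) ^ 2 = 2 * (F1 + (n ^ 2 - 1) * Fb) - mu], which is at least
    [mu] because [Fb >= Fa]; here [m] is an allowance for the variation of the
    height. *)
Lemma flux_margin (F1 Fa Fb n mu : R) : 1 <= n -> Fa <= Fb -> Fb <= 0 ->
  F1 + (n ^+ 2 - 1) * Fa = mu -> 0 < mu ->
  let m := mu / (1 + n ^+ 2) in let qm := Num.sqrt (2 * (F1 - Fa)) in
  exists p q, [/\ 0 < p, p ^+ 2 = - (2 * Fb) + m, 0 <= q, q ^+ 2 = 2 * (F1 - Fb) - m &
    q <= qm /\ n * p <= q /\ mu <= (q - n * p) * (2 * qm)].
Proof.
move=> n1 Fab Fb0 muE mu0 m qm.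
have n20 : 0 <= n ^+ 2 - 1.
  by rewrite subr_ge0 expr2; apply: (@le_trans _ _ (1 * 1)); [rewrite mulr1|apply: ler_pM].
have den : 0 < 1 + n ^+ 2 by lra.
have m0 : 0 < m by rewrite divr_gt0.
have mE : m * (1 + n ^+ 2) = mu by rewrite divfK// gt_eqF.
have Fbmu : mu <= F1 + (n ^+ 2 - 1) * Fb.
  by rewrite -muE lerD2l ler_wpM2l.
pose P := - (2 * Fb) + m; pose Q := 2 * (F1 - Fb) - m.
have P0 : 0 < P by rewrite /P; lra.
have QP : mu <= Q - n ^+ 2 * P.
  rewrite /Q /P; have -> : 2 * (F1 - Fb) - m - n ^+ 2 * (- (2 * Fb) + m) =
     2 * (F1 + (n ^+ 2 - 1) * Fb) - m * (1 + n ^+ 2) by ring.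
  by rewrite mE; lra.
have nP : 0 <= n ^+ 2 * P by rewrite mulr_ge0 ?sqr_ge0// ltW.
have Q0 : 0 < Q by lra.
exists (Num.sqrt P), (Num.sqrt Q).
set p := Num.sqrt P; set q := Num.sqrt Q.
have p0 : 0 < p by rewrite sqrtr_gt0.
have q0 : 0 < q by rewrite sqrtr_gt0.
have p2 : p ^+ 2 = P by rewrite sqr_sqrtr// ltW.
have q2 : q ^+ 2 = Q by rewrite sqr_sqrtr// ltW.
have qqm : q <= qm by rewrite ler_wsqrtr// /Q; lra.
have npq : n * p <= q.
  rewrite -(ler_pXn2r (n := 2))// ?nnegrE ?(ltW q0)//; last by rewrite mulr_ge0 ?ltW//; lra.
  by rewrite exprMn p2 q2; lra.
split=> //; first exact: ltW.
split=> //; split=> //.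
apply: (@le_trans _ _ ((q - n * p) * (q + n * p))).
  by rewrite -subr_sqr exprMn p2 q2.
by rewrite ler_wpM2l ?subr_ge0//; lra.
Qed.
End flux_margin.

Section invasion.
Context {R : realType}.
Variables (f : R -> R) (a : R) (phi : R -> R) (c : R).
Hypotheses (hf : bistable f a) (hphi : traveling_wave f a phi c).
Variable F : R -> R.
Hypothesis hF : potential_primitive f F.

Let F1_gt0 : 0 < F 1.
Proof. by rewrite -(potential_primitiveE hf hF ltr01); have [_ _ _ _ []] := hf. Qed.

Section on_graph.
Variables (G : metric_graph R) (i : ray G) (u : R -> bond G -> R -> R) (rho : R).
Hypothesis hfl : front_like_solution f phi c i u.
Hypothesis hrho : forall k : ray G, (rthick k)%:num = rho.
Let hu : entire_solution f u. Proof. by case: hfl. Qed.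
Let u01 t b x : bond_set b x -> 0 < u t b x < 1. Proof. by case: hfl => _ H _; exact: H. Qed.
Let n : R := #|ray G|%:R - 1.
Hypothesis n_ge1 : 1 <= n.

Let rho_gt0 : 0 < rho. Proof. by rewrite -(hrho i). Qed.

Let slopes (p q : R) (k : ray G) : R := if k == i then q else - p.

Lemma slopes_flux p q : \sum_k (rthick k)%:num * slopes p q k = rho * (q - n * p).
Proof.
under eq_bigr do rewrite hrho.
by rewrite -mulr_sumr sum_one_against_many mulrN.
Qed.

Lemma slopes_flux_abs p q : 0 <= p -> 0 <= q ->
  \sum_k (rthick k)%:num * `|slopes p q k| = rho * (q + n * p).
Proof.
move=> p0 q0; under eq_bigr do rewrite hrho.
rewrite -mulr_sumr -(sum_one_against_many i); congr (_ * _).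
by apply: eq_bigr => k _; rewrite /slopes; case: ifP => _; rewrite ?normrN ger0_norm.
Qed.

Lemma slopes_below A p q : 0 <= A -> 0 < p -> 0 <= q -> A < 1 ->
  - (2 * F A) < p ^+ 2 -> q ^+ 2 < 2 * (F 1 - F A) ->
  forall k, A <= low u (inr k) 0 ->
    \forall y \near 0^'+, A + slopes p q k * y <= low u (inr k) y.
Proof.
move=> A0 p0 q0 A1 pA qA k Ak.
have sup := low_ray_supersolution hf k hu u01.
have AI : 0 <= A <= low u (inr k) 0 by rewrite A0.
rewrite /slopes; case: eqP => [ki|_].
  have inv : tends_to_one (low u (inr k)).
    by rewrite ki; exact (front_like_invades hf hphi hfl).
  exact: (ray_slope_ge_invaded hf hphi hF sup inv AI A1 q0 qA F1_gt0).
have := ray_slope_ge hf hF sup AI p0 pA.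
by apply: filterS => y; rewrite mulNr.
Qed.

(** When [F beta > 0] there is a flux surplus with slopes of arbitrarily small
    size.  Barriers that are affine on the edges then suffice, because [f] is
    positive just above [beta]. *)
Lemma core_height_high beta b1 x1 :
  (forall b x, core b x -> beta <= low u b x) -> core b1 x1 -> low u b1 x1 = beta ->
  0 < F beta -> beta < 1 -> False.
Proof.
move=> betaP c1 l1 Fb b1lt.
have /andP[beta0 _] := low01 u01 (core_set c1); rewrite l1 in beta0.
have abeta : a < beta.
  rewrite ltNge; apply/negP => ba; move: Fb; rewrite ltNge => /negP; apply.
  by rewrite -hF.1; exact: (primitive_nincr hf hF).
pose M := (1 + beta) / 2.
have [Mb M1] : beta < M /\ M < 1 by rewrite /M; split; lra.
pose kap := 2 * (F 1 - F M).
have kap0 : 0 < kap.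
  rewrite mulr_gt0// subr_gt0; apply: (primitive_lt1 hf hF).
  by rewrite M1 andbT ltW// (lt_trans abeta).
have R0 : 0 <= total_resistance G.
  by apply: sumr_ge0 => e _; rewrite divr_ge0.
have C0 : 0 < 4 * rho * (total_resistance G + 1) by rewrite !mulr_gt0//; lra.
pose t := Num.min 1 (Num.min (kap / 2) ((M - beta) / (4 * rho * (total_resistance G + 1)))).
have t0 : 0 < t by rewrite !lt_min ltr01 !divr_gt0// subr_gt0.
have [t1 tk tM] : [/\ t <= 1, t <= kap / 2 & t * (4 * rho * (total_resistance G + 1)) <= M - beta].
  by rewrite -ler_pdivlMr// /t !ge_min !lexx !orbT.
pose p := t / (2 * n).
have n0 : 0 < n by apply: lt_le_trans n_ge1; exact: ltr01.
have p0 : 0 < p by rewrite divr_gt0// mulr_gt0.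
have np : n * p = t / 2 by rewrite /p; field; rewrite gt_eqF.
apply: (@core_flux_contradiction _ f a G u hf hu u01 0 (slopes p t) beta (M - beta) b1 x1) => //.
- by rewrite mul0r slopes_flux np mulr_gt0//; lra.
- rewrite slopes_flux_abs ?(ltW p0) ?(ltW t0)// np mul0r addr0; apply: le_trans tM.
  have : 0 <= t * rho * total_resistance G by rewrite !mulr_ge0// ltW.
  have : 0 < t * rho by rewrite mulr_gt0.
  by lra.
- move=> A /andP[bA AM] _; rewrite add0r; have [_ _ _ [_ fpos] _] := hf.
  by apply: fpos; apply/andP; split; lra.
move=> A k /andP[bA AM] Ak.
have FA : F beta <= F A by apply: (primitive_ndecr hf hF) => //; lra.
have FM : F A <= F M by apply: (primitive_ndecr hf hF) => //; lra.
apply: slopes_below => //.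
- exact: le_trans bA.
- exact: ltW.
- by lra.
- by apply: (@lt_trans _ _ 0); [lra|rewrite exprn_gt0].
- have : t ^+ 2 <= t by rewrite expr2 ler_piMr// ltW.
  by move: tk; rewrite /kap; lra.
Qed.

(** When [F beta <= 0], the hypothesis on the potential leaves a flux margin,
    which a small core can neither consume through the curvature [L + 1] nor spoil
    through the oscillation of its potential. *)
Lemma core_height_low beta b1 x1 (L mu omega : R) :
  (forall b x, core b x -> beta <= low u b x) -> core b1 x1 -> low u b1 x1 = beta ->
  F beta <= 0 ->
  0 < L -> (forall x, 0 <= x <= 1 -> `|f x| <= L) ->
  F 1 + (n ^+ 2 - 1) * F a = mu -> 0 < mu ->
  0 < omega -> 4 * L * omega <= mu / (1 + n ^+ 2) -> 2 * L * omega <= F 1 ->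
  let qm := Num.sqrt (2 * (F 1 - F a)) in
  (L + 1) * total_mass G * (4 * qm) <= rho * mu ->
  4 * rho * qm * total_resistance G + (L + 1) * total_length G ^+ 2 <= omega ->
  False.
Proof.
move=> betaP c1 l1 Fb L0 LP muE mu0 om0 om1 om2 qm mass res.
have /andP[beta0 beta1] := low01 u01 (core_set c1); rewrite l1 in beta0 beta1.
have Fa_b : F a <= F beta by apply: (primitive_min hf hF); rewrite beta0.
have [p [q [p0 p2 q0 q2 [qqm [npq margin]]]]] := flux_margin n_ge1 Fa_b Fb muE mu0.
rewrite -/qm in qqm margin.
have m0 : 0 < mu / (1 + n ^+ 2) by rewrite divr_gt0// ltr_pwDl// sqr_ge0.
set m := mu / (1 + n ^+ 2) in om1 p2 q2 m0.
have F1a : 0 < F 1 - F a by have := F1_gt0; lra.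
have qm0 : 0 < qm by rewrite sqrtr_gt0 mulr_gt0.
have lipF A : beta <= A -> A <= 1 -> `|F A - F beta| <= L * (A - beta).
  move=> bA A1; rewrite ler_norml; apply/andP; split.
    rewrite -mulNr; apply: (primitive_increment hF) => // z /andP[z0 z1].
    have /LP : 0 <= z <= 1 by rewrite (le_trans beta0 z0) (le_trans z1).
    by rewrite ler_norml => /andP[].
  apply: (primitive_decrement hF) => // z /andP[z0 z1].
  have /LP : 0 <= z <= 1 by rewrite (le_trans beta0 z0) (le_trans z1).
  by rewrite ler_norml => /andP[].
have F_om A : beta <= A <= beta + omega -> A <= 1 -> `|F A - F beta| <= L * omega.
  move=> /andP[bA Ao] A1; apply: le_trans (lipF A bA A1) _.
  by rewrite ler_wpM2l ?(ltW L0)//; lra.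
apply: (@core_flux_contradiction _ f a G u hf hu u01 (L + 1) (slopes p q) beta omega b1 x1) => //.
- by lra.
- rewrite slopes_flux.
  have qm2 : 0 < 2 * qm by rewrite mulr_gt0.
  rewrite -(ltr_pM2r qm2).
  have h1 : rho * mu <= rho * ((q - n * p) * (2 * qm)) by rewrite ler_wpM2l// ltW.
  have h2 : 0 < rho * mu by rewrite mulr_gt0.
  have -> : rho * (q - n * p) * (2 * qm) = rho * ((q - n * p) * (2 * qm)) by ring.
  have -> : (L + 1) * total_mass G * (2 * qm) = (L + 1) * total_mass G * (4 * qm) / 2 by field.
  by lra.
- rewrite slopes_flux_abs ?(ltW p0)//; apply: le_trans res; rewrite lerD2r.
  apply: ler_wpM2r.
    by apply: sumr_ge0 => e _; rewrite divr_ge0.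
  have : rho * (q + n * p) <= rho * (2 * qm) by rewrite ler_wpM2l ?(ltW rho_gt0)//; lra.
  by lra.
- move=> A /andP[bA _] A1; have := LP A; rewrite (le_trans beta0 bA) A1 => /(_ isT).
  by rewrite ler_norml => /andP[? _]; lra.
move=> A k AI Ak.
have A1 : A <= 1.
  apply: le_trans Ak _.
  have S0 : bond_set (inr k : bond G) 0 by apply/ray_set.
  by have /andP[] := low01 u01 S0.
have bA : beta <= A by case/andP: AI.
have := F_om A AI A1; rewrite ler_norml => /andP[FA1 FA2].
have Lom : 0 < L * omega by rewrite mulr_gt0.
apply: slopes_below => //.
- exact: le_trans bA.
- rewrite lt_neqAle A1 andbT; apply/eqP => A1'.
  by move: FA2; rewrite A1'; lra.
- by rewrite p2; lra.
- by rewrite q2; lra.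
Qed.
End on_graph.

Lemma small_core_invaded (N : nat) (rho rmin rmax : R) : (2 <= N)%N -> 0 < rho -> 0 < rmin ->
  0 < F 1 + ((N%:R - 1) ^+ 2 - 1) * F a ->
  exists2 delta, 0 < delta & forall (G : metric_graph R) (i : ray G) u,
    front_like_solution f phi c i u -> #|ray G| = N ->
    (forall k : ray G, (rthick k)%:num = rho) ->
    (forall e : edge G, rmin <= (ethick e)%:num <= rmax) -> total_length G < delta ->
    forall b x, core b x -> low u b x = 1.
Proof.
move=> N2 rho0 rmin0; set mu := F 1 + _ => mu0.
set n : R := N%:R - 1 in mu mu0.
have N2' : (2 : R) <= N%:R by rewrite ler_nat.
have n1 : 1 <= n by rewrite /n; lra.
have [L L0 LP] := bistable_bound hf.
have a0 : 0 < a by have [/andP[]] := hf.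
have Fa0 : F a < 0 by apply: (primitive_lt0 hf hF); rewrite a0 lexx.
pose qm := Num.sqrt (2 * (F 1 - F a)).
have qm0 : 0 < qm by rewrite sqrtr_gt0 mulr_gt0//; have := F1_gt0; lra.
pose m := mu / (1 + n ^+ 2).
have m0 : 0 < m by rewrite divr_gt0// ltr_pwDl// sqr_ge0.
(* Over heights within omega, F varies by less than m / 2 and does not rise from
   nonpositive values to F 1. *)
pose omega := Num.min (m / (4 * L)) (F 1 / (2 * L)).
have om0 : 0 < omega.
  by rewrite lt_min; apply/andP; split; apply: divr_gt0 => //; exact: mulr_gt0.
have om1 : 4 * L * omega <= m by rewrite mulrC -ler_pdivlMr ?mulr_gt0// ge_min lexx.
have om2 : 2 * L * omega <= F 1 by rewrite mulrC -ler_pdivlMr ?mulr_gt0// ge_min lexx orbT.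
pose r' := `|rmax| + 1.
have r'0 : 0 < r' by rewrite ltr_wpDl.
have d1 : 0 < (L + 1) * r' * (4 * qm) by rewrite !mulr_gt0//; lra.
have d2 : 0 < 4 * rho * qm / rmin + (L + 1).
  by rewrite addr_gt0 ?divr_gt0 ?mulr_gt0//; lra.
(* The second bound keeps the flux consumed by the curvature below the margin,
   the third keeps the oscillation of the potential below omega. *)
pose delta := Num.min 1 (Num.min (rho * mu / ((L + 1) * r' * (4 * qm)))
  (omega / (4 * rho * qm / rmin + (L + 1)))).
exists delta.
  rewrite !lt_min ltr01/=; apply/andP; split; apply: divr_gt0 => //.
  exact: mulr_gt0.
move=> G i u hfl cardG hrho thick small b x cx.
have u01 : forall t b x, bond_set b x -> 0 < u t b x < 1 by case: hfl.
have [b1 [x1 [c1 betaP]]] := core_min b (low_lsc_core u01).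
set beta := low u b1 x1 in betaP.
have nG : #|ray G|%:R - 1 = n by rewrite cardG.
have l0 : 0 <= total_length G by apply: sumr_ge0.
have [l1 l2 l3] : [/\ total_length G <= 1,
    total_length G * ((L + 1) * r' * (4 * qm)) <= rho * mu &
    total_length G * (4 * rho * qm / rmin + (L + 1)) <= omega].
  have sm := ltW small; rewrite !le_min in sm; case/and3P: sm => l1 h2 h3.
  split => //.
    by rewrite -(ler_pdivlMr _ _ d1).
  by rewrite -(ler_pdivlMr _ _ d2).
have mass : total_mass G <= r' * total_length G.
  rewrite /total_mass /total_length mulr_sumr; apply: ler_sum => e _.
  rewrite ler_wpM2r//; have /andP[_ h] := thick e; apply: le_trans h _.
  by rewrite /r'; have := ler_norm rmax; lra.
have res : total_resistance G <= total_length G / rmin.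
  rewrite /total_resistance /total_length mulr_suml; apply: ler_sum => e _.
  by rewrite ler_wpM2l// lef_pV2 ?posrE//; have /andP[] := thick e.
have beta1 : beta <= 1 by have /andP[] := low01 u01 (core_set c1).
suff E1 : beta = 1.
  apply/eqP; rewrite eq_le; apply/andP; split; last by rewrite -E1; exact: betaP.
  by have /andP[] := low01 u01 (core_set cx).
apply/eqP; rewrite eq_le beta1 leNgt; apply/negP => blt.
have [Fb|Fb] := ltP 0 (F beta).
  by apply: (core_height_high hfl hrho _ betaP c1 erefl Fb blt); rewrite nG.
have n1G : 1 <= #|ray G|%:R - 1 :> R by rewrite nG.
apply: (core_height_low hfl hrho n1G betaP c1 erefl Fb L0 LP _ mu0 om0 _ om2).
- by rewrite nG.
- by rewrite nG.
- apply: le_trans l2; rewrite -/qm.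
  have h : (L + 1) * total_mass G <= (L + 1) * (r' * total_length G) by rewrite ler_wpM2l//; lra.
  have := ler_wpM2r (ltW (mulr_gt0 (ltr0Sn R 3) qm0)) h; lra.
- apply: le_trans l3; rewrite -/qm mulrDr; apply: lerD.
    have c0 : 0 <= 4 * rho * qm by rewrite !mulr_ge0// ltW.
    by apply: le_trans (ler_wpM2l c0 res) _; rewrite le_eqVlt; apply/orP; left; apply/eqP; field; rewrite gt_eqF.
  rewrite mulrC ler_wpM2r//; first by lra.
  by rewrite expr2 ler_piMr.
Qed.
End invasion.

Theorem theorem2p19 (R : realType) (f : R -> R) (a : R) (phi : R -> R) (c : R)
    (N : nat) (rho : 'I_N -> {posnum R})
    (hf : bistable f a) (hphi : traveling_wave f a phi c)
    (hN : (2 <= N)%N) (hrho : forall i j : 'I_N, rho i = rho j)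
    (hF : 0 < potential f 1 + ((N%:R - 1) ^+ 2 - 1) * potential f a)
    (rmin rmax : R) (hrmin : 0 < rmin) :
  exists delta : R, 0 < delta /\
    forall (D : metric_graph R) (P : 'I_N -> vertex D),
      bounded_graph D ->
      (forall e : edge D, rmin <= (ethick e)%:num <= rmax) ->
      total_length D < delta ->
      forall (i j : ray (replace_center (Om := star_graph rho) P))
             (u : R -> bond (replace_center (Om := star_graph rho) P) -> R -> R),
        i <> j ->
        front_like_solution f phi c i u ->
        propagation_index u j 1.
Proof.
have [F FP] := potential_primitive_exists hf.
have [/andP[a0 _] _ _ _ _] := hf.
rewrite (potential_primitiveE hf FP ltr01) (potential_primitiveE hf FP a0) in hF.
have i0 : 'I_N by exact: Ordinal hN.
have [delta delta0 deltaP] :=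
  small_core_invaded hf hphi FP rmax hN (gt0 (rho i0) : 0 < (rho i0)%:num) hrmin hF.
exists delta; split => // D P _ thick small i j u _ hfl.
have core1 := deltaP _ i u hfl (card_ord N)
  (fun k => congr1 (fun r : {posnum R} => r%:num) (hrho k i0)) thick small.
have [hu u01 _] := hfl.
have low1 b x : bond_set b x -> low u b x = 1.
  case: b => [e|k] Sx; first exact: core1.
  have sup := low_ray_supersolution hf k hu u01.
  apply: (ray_saturated hf hphi sup); last exact/ray_set.
  exact: (core1 (inr k) 0).
exists (fun _ _ => 1); split; last exact: cvg_cst.
move=> b x Sx; apply/cvgrPdist_le => e e0.
have lt1 : 1 - e < low u b x by rewrite low1// ltrBlDr ltrDl.
have [T [r [r0 H]]] := lower_limit_gt (fun t => @solution_bounds _ _ _ u01 b t) Sx lt1.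
exists T; split; first exact: num_real.
move=> t /= Tt; have := H t x (ltW Tt) Sx; rewrite subrr normr0 => /(_ (ltW r0)) ge.
have /andP[_ lt] := u01 t b x Sx.
by rewrite ger0_norm ?subr_ge0 ?(ltW lt)//; lra.
Qed.
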